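(* Assume that there exist $L,L'\in(0,\infty)$ such that for all $\theta\in D$ \[ \langle\theta-\theta^*,f(\theta)\rangle\le -L\|\theta-\theta^*\|^2\quad\text{and}\quad \langle\theta-\theta^*,f(\theta)\rangle\le -L'\|f(\theta)\|^2 , \] and assume that there exist measurable functions $\Gamma_1,\Gamma_2\colon D\to(0,\infty)$ and constants $M\in(1,\infty)$, $K,K_1,\alpha,\beta\in(0,\infty)$ with $\alpha\ge\beta$ and a constant $\beta_1$, with $\beta_1\in[0,\min(\beta,1/2)]$ if $\beta\ne 1/2$ and $\beta_1\in[0,1/2)$ if $\beta=1/2$, such that for all $k\in\mathbb{N}$ and all $\theta\in D$ (i) $\mathbb{E}\bigl[\|F_k(\theta,U)-F_{k-1}(\theta,U)-\mathbb{E}[F_k(\theta,U)-F_{k-1}(\theta,U)]\|^p\bigr]^{1/p}\le\Gamma_1(\theta)M^{-k\beta}$, (ii) $\|\mathbb{E}[F_k(\theta,U)-F(\theta,U)]\|\le\Gamma_2(\theta)M^{-k\alpha}$, (iii) $C_k\le KM^k$, (iv) $\Gamma_1(\theta)\le K_1(1+\|\theta\|)^{\beta_1p}$ and $\Gamma_2(\theta)\le K_1(1+\|\theta\|)^{\alpha p}$. Let $\theta_0\in D$, $r\in(-1,\infty)$, $\gamma_0\in\bigl(\frac{1+r}{2L},\infty\bigr)$, $\sigma_0,\varepsilon_0\in(0,\infty)$, put $\rho=\frac12(1+r)$, and for all $n\in\mathbb{N}$ let \[ \gamma_n=\gamma_0\frac1n,\qquad \sigma_n^2=\sigma_0^2\frac1{n^r},\qquad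 \varepsilon_n=\varepsilon_0\frac1{n^\rho}. \] Let $(\theta_n)_{n\in\mathbb{N}_0}$ be the projected multilevel Robbins-Monro scheme with these parameters and $\mathrm{cost}_n$ its computational cost (both defined in the context). Then for all $\eta\in(0,\rho)$ there exists $\kappa\in(0,\infty)$ such that for all $n\in\mathbb{N}$ \[ \mathbb{E}\Bigl[\sup_{k\ge n}k^{\eta p}\|\theta_k-\theta^*\|^p\Bigr]^{1/p}\le\kappa\,n^{-(\rho-\eta)} . \] In particular, for all $\delta\in(0,\infty)$ we have $\lim_{n\to\infty}n^{\rho-\delta}\|\theta_n-\theta^*\|=0$ almost surely. If additionally $\alpha>\beta\wedge\frac12$ and $r>\frac{\beta\wedge 1/2}{\alpha-\beta\wedge 1/2}$, then there exists $\kappa'\in(0,\infty)$ such that for all $n\in\mathbb{N}$ \[ \mathrm{cost}_n\le\kappa'\begin{cases}n^{2\rho},&\text{if }\beta>1/2,\\ n^{2\rho}(\ln(n+1))^2,&\text{if }\beta=1/2,\\ n^{2\rho\left(1+\frac{1-2\beta}{2\alpha}\right)},&\text{if }\beta<1/2.\end{cases} \]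
   Context: Fix $p\in[2,\infty)$, a probability space $(\Omega,\mathcal{F},P)$, a scalar product $\langle\cdot,\cdot\rangle$ on $\mathbb{R}^d$ with induced norm $\|\cdot\|$, a closed and convex set $D\subset\mathbb{R}^d$, a non-empty set $\mathcal{U}$ equipped with a $\sigma$-field, a random variable $U\colon\Omega\to\mathcal{U}$ and a product-measurable function $F\colon D\times\mathcal{U}\to\mathbb{R}^d$ such that $F(\theta,U)$ is integrable for every $\theta\in D$. Put $f(\theta)=\mathbb{E}[F(\theta,U)]$ and assume that $f\colon D\to\mathbb{R}^d$ has a unique zero $\theta^*\in D$. Let $F_1,F_2,\ldots\colon D\times\mathcal{U}\to\mathbb{R}^d$ be product-measurable with $F_k(\theta,U)$ integrable for all $\theta\in D$ and $k\in\mathbb{N}$, put $F_0=0$, and let $C_k\in(0,\infty)$, $k\in\mathbb{N}$ (the cost assigned to one simulation of $F_k(\theta,U)-F_{k-1}(\theta,U)$). Let $\mathrm{pr}_D\colon\mathbb{R}^d\to D$ be the orthogonal projection onto $D$ with respect to $\langle\cdot,\cdot\rangle$. Notation: $a\wedge b=\min(a,b)$, $a\vee b=\max(a,b)$, $x_+=\max(x,0)$. Projected multilevel Robbins-Monro scheme. Given $\Gamma_1,\Gamma_2,M,\alpha,\beta$, an initial vector $\theta_0\in D$ and sequences $(\gamma_n),(\varepsilon_n),(\sigma_n)$ in $(0,\infty)$, put for $n\in\mathbb{N}$, $\theta\in D$ \[ m_n(\theta)=1\vee\Bigl\lceil\tfrac1\alpha\log_M\Bigl(\tfrac{\Gamma_2(\theta)}{\varepsilon_n}\Bigr)\Bigr\rceil,\qquad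 \kappa_n(\theta)=\begin{cases}(\Gamma_1(\theta)/\sigma_n)^2M^{m_n(\theta)(\frac12-\beta)_+},&\beta\ne1/2,\\(\Gamma_1(\theta)/\sigma_n)^2m_n(\theta),&\beta=1/2,\end{cases} \] and $N_{n,k}(\theta)=\lceil\kappa_n(\theta)M^{-k(\beta+1/2)}\rceil$ for $k=1,\dots,m_n(\theta)$. Let $(U_{n,k,\ell})_{n,k,\ell\in\mathbb{N}}$ be independent copies of $U$, \[ Z_n(\theta)=\sum_{k=1}^{m_n(\theta)}\frac1{N_{n,k}(\theta)}\sum_{\ell=1}^{N_{n,k}(\theta)}\bigl(F_k(\theta,U_{n,k,\ell})-F_{k-1}(\theta,U_{n,k,\ell})\bigr), \] and define $\theta_n=\mathrm{pr}_D\bigl(\theta_{n-1}+\gamma_nZ_n(\theta_{n-1})\bigr)$ for $n\in\mathbb{N}$. The computational cost is \[ \mathrm{cost}_n=\mathbb{E}\Bigl[\sum_{j=1}^n\sum_{k=1}^{m_j(\theta_{j-1})}N_{j,k}(\theta_{j-1})\,C_k\Bigr]. \] *)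

(* Defs.v *)
From HB Require Import structures.
From mathcomp Require Import all_boot all_order all_algebra.
From mathcomp Require Import all_classical all_reals all_analysis.
Export numFieldNormedType.Exports.

Set Implicit Arguments.
Unset Strict Implicit.
Unset Printing Implicit Defensive.
Import Order.TTheory GRing.Theory Num.Theory.
Local Open Scope classical_set_scope.
Local Open Scope ring_scope.

(* R^d with its Borel sigma-algebra: a copy of 'rV[R]_d, convertible to it,
   since row vectors carry no canonical measurable structure. *)
Notation borel_rV R d := (g_sigma_algebraType (@open 'rV[R]_d)).

(* A function on D x S with values in R^d is given by a total function, of which
   only the values at theta in D are constrained. *)
Definition product_measurable (R : realType) (d : nat) (dS : measure_display)
    (S : measurableType dS) (D : set 'rV[R]_d) (G : 'rV[R]_d -> S -> 'rV[R]_d) :=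
  measurable_fun ((D `*` setT) : set (borel_rV R d * S))
    (fun x : borel_rV R d * S => G x.1 x.2 : borel_rV R d).

Section vector_valued.
Context {R : realType} {d : nat} {dO : measure_display} {Omega : measurableType dO}.
Variable P : probability Omega R.

Definition vintegrable (Y : Omega -> 'rV[R]_d) :=
  forall i, P.-integrable setT (fun w => (Y w 0 i)%:E).

Definition vexpectation (Y : Omega -> 'rV[R]_d) : 'rV[R]_d :=
  \row_i fine 'E_P[fun w => Y w 0 i].

End vector_valued.

Section independence.
Context {R : realType} {dO dS : measure_display}.
Context {Omega : measurableType dO} {S : measurableType dS}.
Variable P : probability Omega R.

(* The family (X i) for i in A is independent. *)
Definition mutually_independent (I : choiceType) (A : set I)
    (X : I -> {RV P >-> S}) :=
  forall (s : seq I) (B : I -> set S), uniq s ->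
    (forall i, i \in s -> A i) -> (forall i, measurable (B i)) ->
    P (\big[setI/setT]_(i <- s) (X i @^-1` B i)) =
    (\prod_(i <- s) P (X i @^-1` B i))%E.

Definition same_distribution (X Y : {RV P >-> S}) :=
  forall B : set S, measurable B -> distribution P X B = distribution P Y B.

End independence.

Section scalar_product.
Context {R : realType} {d : nat}.
Variable dot : {dot 'rV[R]_d for idfun}.

Definition dnorm (x : 'rV[R]_d) : R := Num.sqrt (dot x x).

Definition nearest (D : set 'rV[R]_d) (x : 'rV[R]_d) : set 'rV[R]_d :=
  [set y | D y /\ forall z, D z -> dnorm (x - y) <= dnorm (x - z)].

(* For D nonempty, closed and convex, the set nearest D x is a singleton. *)
Definition proj (D : set 'rV[R]_d) (x : 'rV[R]_d) : 'rV[R]_d :=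
  xget 0 (nearest D x).

End scalar_product.

(* Level k, step n and replication l range over the positive integers; the
   values at index 0 of eps, sigma, gamma, C and V are never used. *)
Section multilevel.
Context {R : realType} {d : nat} {dO dS : measure_display}.
Context {Omega : measurableType dO} {S : measurableType dS}.
Variable P : probability Omega R.
Variables (dot : {dot 'rV[R]_d for idfun}) (D : set 'rV[R]_d).
Variables (Gamma1 Gamma2 : 'rV[R]_d -> R) (M alpha beta : R).
Variables (gamma eps sigma : nat -> R).
Variables (Fk : nat -> 'rV[R]_d -> S -> 'rV[R]_d).
Variables (V : nat -> nat -> nat -> Omega -> S) (theta0 : 'rV[R]_d).
Implicit Types (n k : nat) (theta : 'rV[R]_d) (w : Omega).

Definition max_level n theta : nat :=
  `|Num.max (1 : int)
      (Num.ceil (alpha^-1 * (ln (Gamma2 theta / eps n) / ln M)))%R|%N.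

Definition repl_factor n theta : R :=
  (Gamma1 theta / sigma n) ^+ 2 *
  (if beta == 2^-1 then (max_level n theta)%:R
   else M `^ ((max_level n theta)%:R * Num.max (2^-1 - beta) 0)).

Definition repl n k theta : nat :=
  `|Num.ceil (repl_factor n theta * M `^ (- (k%:R * (beta + 2^-1))))%R|%N.

Definition ml_estimator n theta w : 'rV[R]_d :=
  \sum_(1 <= k < (max_level n theta).+1)
    (repl n k theta)%:R^-1 *:
      \sum_(1 <= l < (repl n k theta).+1)
        (Fk k theta (V n k l w) - Fk k.-1 theta (V n k l w)).

Fixpoint ml_scheme n w : 'rV[R]_d :=
  if n is n'.+1 then
    let theta := ml_scheme n' w in
    proj dot D (theta + gamma n *: ml_estimator n theta w)
  else theta0.

Definition ml_cost (C : nat -> R) n : \bar R :=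
  'E_P[fun w => \sum_(1 <= j < n.+1)
    \sum_(1 <= k < (max_level j (ml_scheme j.-1 w)).+1)
      (repl j k (ml_scheme j.-1 w))%:R * C k].

End multilevel.

(* Main.v *)
(** The drift contracts the error [theta_n - theta_star] by a factor
    [1 - lambda / n] with [lambda > rho], while the estimator has bias at most
    [eps n] and, by an inequality of Marcinkiewicz-Zygmund type, a centred p-th
    moment of order [sigma n ^ p], uniformly in [theta]; a second-order expansion
    of [|x|^p] turns this into [E |theta_n - theta_star|^p = O(n^(- rho p))].

    On a block [N <= k <= 2 N] the process [sqrt (|x|^2 + N^(- 2 rho))] evaluated
    at the error is, by convexity and after compensation of the drift, a
    submartingale up to terms of the order of the error itself.  Doob's maximal
    inequality is applied to it through Burkholder's function, whose expectation is
    followed step by step, so that conditional expectations are replaced by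
    Fubini's theorem for independent sigma-algebras.  This bounds the maximum over
    the block in L^p by [O(N^(- rho))], and summing over dyadic blocks gives a
    geometric series because [eta < rho].

    The growth conditions on [Gamma1] and [Gamma2] make the cost of step [n] at most
    [(1 + |theta_(n-1)|)^p] times a deterministic rate, and the p-th moments of
    the scheme are bounded. *)

From HB Require Import structures.
Require Import Defs.
From mathcomp Require Import all_boot all_order all_algebra.
From mathcomp Require Import all_classical all_reals all_analysis.
From mathcomp Require Import measurable_realfun.
From mathcomp Require Import ring lra.
Import Order.TTheory GRing.Theory Num.Theory.
Set Implicit Arguments.
Unset Strict Implicit.
Unset Printing Implicit Defensive.
Local Open Scope classical_set_scope.
Local Open Scope ring_scope.

(** * Scalar products and projections *)

(** Since [rho = (1 + r) / 2], step [n] adds a bias of order [n^(- rho) / n] and a centred noise of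
    order [n^(- rho) / sqrt n]. In the expansion of a [p]-th power the bias enters linearly and the
    noise quadratically, so both cost the fraction [1 / n], which is also the size of the
    contraction.

    The norm itself is unsuitable for the maximal inequality: its second derivative blows up at the
    target, where the error concentrates. Smoothing at the scale [c = N^(- rho)] of the error on the
    block bounds the second-order remainder by [|y|^2 / (2 c)], of order [c / N] per step and [c]
    over [N] steps. On such a block the drift need not contract: it is a displacement of relative
    size [1 / N], and [(1 + K / N)^N] stays bounded. The contraction serves only the rate at single
    times.

    One-step estimates are stated for a frozen past: a deterministic vector plus a perturbation with
    known mean and bounded [p]-th moment. The multilevel structure is thereby confined to the
    moments of the estimator, its measurability and the cost. *)

Lemma lipschitz_continuous (R : realType) (V W : normedModType R) (f : V -> W)
    (C : R) : 0 < C -> (forall x y, `|f x - f y| <= C * `|x - y|) ->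
  continuous f.
Proof.
move=> C0 hf x; apply/cvgrPdist_le => e e0; apply/nbhs_normP.
exists (e / C); rewrite /= ?divr_gt0// => y /= xy.
by rewrite (le_trans (hf _ _))// -ler_pdivlMl// mulrC ltW.
Qed.

Section scalar_product.
Context {R : realType} {d : nat}.
Variable dot : {dot 'rV[R]_d for idfun}.
Implicit Types (x y z : 'rV[R]_d) (a : R).

Lemma dotC x y : dot x y = dot y x.
Proof. by rewrite (@hermitian_subproof _ _ _ _ dot) expr0 mul1r. Qed.

Lemma dot_sqr_ge0 x : 0 <= dot x x.
Proof.
have [->|x0] := eqVneq x 0; first by rewrite linear0r.
exact/ltW/neq0_dnorm_gt0.
Qed.

Lemma dotDl x y z : dot (x + y) z = dot x z + dot y z.
Proof. exact: linearDl. Qed.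

Lemma dotDr x y z : dot x (y + z) = dot x y + dot x z.
Proof. exact: linearDr. Qed.

Lemma dotNl x y : dot (- x) y = - dot x y.
Proof. exact: linearNl. Qed.

Lemma dotNr x y : dot x (- y) = - dot x y.
Proof. exact: linearNr. Qed.

Lemma dotZl a x y : dot (a *: x) y = a * dot x y.
Proof. exact: linearZl_LR. Qed.

Lemma dotZr a x y : dot x (a *: y) = a * dot x y.
Proof. by rewrite dotC dotZl dotC. Qed.

Lemma dot0l x : dot 0 x = 0.
Proof. exact: linear0l. Qed.

Lemma dnorm_ge0 x : 0 <= dnorm dot x.
Proof. exact: sqrtr_ge0. Qed.

Lemma sqr_dnorm x : dnorm dot x ^+ 2 = dot x x.
Proof. by rewrite sqr_sqrtr// dot_sqr_ge0. Qed.

Lemma dnorm_eq0 x : dnorm dot x = 0 -> x = 0.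
Proof.
move=> x0; apply/eqP/negPn/negP => /(@neq0_dnorm_gt0 _ _ _ dot).
by rewrite -sqr_dnorm x0 expr0n ltxx.
Qed.

Lemma dnorm0 : dnorm dot 0 = 0.
Proof. by rewrite /dnorm dot0l sqrtr0. Qed.

Lemma dnormN x : dnorm dot (- x) = dnorm dot x.
Proof. by rewrite /dnorm dotNl dotNr opprK. Qed.

Lemma dnormZ a x : dnorm dot (a *: x) = `|a| * dnorm dot x.
Proof.
by rewrite /dnorm dotZl dotZr mulrA -expr2 sqrtrM ?sqr_ge0// sqrtr_sqr.
Qed.

Lemma dnormZ_ge0 a x : 0 <= a -> dnorm dot (a *: x) = a * dnorm dot x.
Proof. by move=> a0; rewrite dnormZ ger0_norm. Qed.

Lemma sqr_dnormD x y :
  dnorm dot (x + y) ^+ 2 = dnorm dot x ^+ 2 + 2 * dot x y + dnorm dot y ^+ 2.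
Proof.
by rewrite !sqr_dnorm dotDl !dotDr (dotC y x); ring.
Qed.

Lemma cauchy_schwarz x y : `|dot x y| <= dnorm dot x * dnorm dot y.
Proof.
have [/dnorm_eq0 ->|x0] := eqVneq (dnorm dot x) 0.
  by rewrite dot0l normr0 dnorm0 mul0r.
have xgt0 : 0 < dnorm dot x by rewrite lt_neqAle eq_sym x0 dnorm_ge0.
have /(ler_wpM2l (ltW xgt0)) : 0 <= dnorm dot x * dnorm dot y ^+ 2
    - dot x y ^+ 2 / dnorm dot x.
  have := dot_sqr_ge0 (y - (dot x y / dnorm dot x ^+ 2) *: x).
  rewrite dotDl !dotDr !dotNl !dotNr !dotZl !dotZr -!sqr_dnorm (dotC y x).
  set s := dnorm dot x in xgt0 *; set t := dnorm dot y; set u := dot x y.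
  move=> /(ler_wpM2l (ltW xgt0)); rewrite mulr0 => /le_trans; apply.
  by rewrite le_eqVlt; apply/orP; left; apply/eqP; field.
rewrite mulr0 => h.
rewrite -(@ler_pXn2r _ 2)// ?nnegrE ?mulr_ge0 ?dnorm_ge0//.
rewrite -normrX ger0_norm ?sqr_ge0// -subr_ge0 (le_trans h)// exprMn.
by rewrite le_eqVlt; apply/orP; left; apply/eqP; field.
Qed.

Lemma dot_le x y : dot x y <= dnorm dot x * dnorm dot y.
Proof. exact: le_trans (ler_norm _) (cauchy_schwarz _ _). Qed.

Lemma dot_ge x y : - (dnorm dot x * dnorm dot y) <= dot x y.
Proof. by have := cauchy_schwarz x y; rewrite ler_norml => /andP[]. Qed.

Lemma dnormD x y : dnorm dot (x + y) <= dnorm dot x + dnorm dot y.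
Proof.
rewrite -(@ler_pXn2r _ 2)// ?nnegrE ?addr_ge0 ?dnorm_ge0//.
by rewrite sqr_dnormD; have := dot_le x y; nra.
Qed.

Lemma dnorm_distl x y : dnorm dot x - dnorm dot y <= dnorm dot (x - y).
Proof. by rewrite lerBlDr -{1}(subrK y x) dnormD. Qed.

Lemma dnormB_sym x y : dnorm dot (x - y) = dnorm dot (y - x).
Proof. by rewrite -opprB dnormN. Qed.

Lemma dnorm_dist x y : `|dnorm dot x - dnorm dot y| <= dnorm dot (x - y).
Proof. by rewrite ler_norml lerNl opprB dnorm_distl dnormB_sym dnorm_distl. Qed.

Lemma dnorm_sum I (s : seq I) (x : I -> 'rV[R]_d) :
  dnorm dot (\sum_(i <- s) x i) <= \sum_(i <- s) dnorm dot (x i).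
Proof.
elim/big_ind2 : _ => //; first by rewrite dnorm0.
by move=> u a v b ua vb; rewrite (le_trans (dnormD _ _))// lerD.
Qed.

(** Expanding one argument in the standard basis reduces expectations of scalar products to means of
    coordinates, which is how vector-valued means are defined. *)
Lemma dot_row x y : dot x y = \sum_i y 0 i * dot x (delta_mx 0 i).
Proof.
rewrite {1}(row_sum_delta y) linear_sumr; apply: eq_bigr => i _.
exact: dotZr.
Qed.

Lemma coord_le (x : 'rV[R]_d) i : `|x 0 i| <= `|x|.
Proof.
rewrite [`|x|]mx_normrE; apply: (le_trans _ (le_bigmax _ _ (0, i))) => //=.
Qed.

Lemma dnorm_le_norm : exists2 C, 0 < C & forall x, dnorm dot x <= C * `|x|.
Proof.
exists (1 + \sum_i dnorm dot (delta_mx 0 i)).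
  by rewrite ltr_wpDr// sumr_ge0// => i _; exact: dnorm_ge0.
move=> x; rewrite {1}(row_sum_delta x) (le_trans (dnorm_sum _ _))// mulrDl.
rewrite (@le_trans _ _ (\sum_i dnorm dot (delta_mx 0 i) * `|x|))//.
  apply: ler_sum => i _; rewrite dnormZ mulrC ler_wpM2l ?dnorm_ge0//.
  exact: coord_le.
by rewrite mulr_suml lerDr mul1r.
Qed.

Lemma dnorm_continuous : continuous (dnorm dot).
Proof.
have [C C0 hC] := dnorm_le_norm.
apply: (lipschitz_continuous C0) => x y.
exact: le_trans (dnorm_dist _ _) (hC _).
Qed.

(** The scalar-product norm attains a positive minimum on the compact unit sphere of the maximum
    norm, and homogeneity does the rest. This makes balls of the scalar-product norm bounded, as
    needed for the existence of projections. *)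
Lemma norm_le_dnorm : exists2 C, 0 < C & forall x, `|x| <= C * dnorm dot x.
Proof.
pose A := [set x : 'rV[R]_d | `|x| = 1].
have hA : A !=set0 -> exists2 c, c \in A & forall t, t \in A ->
    dnorm dot c <= dnorm dot t.
  move=> A0; apply: compact_EVT_min => //.
    apply: bounded_closed_compact.
      by exists 1; split; [exact: num_real|move=> M M1 x /= ->; exact: ltW].
    apply: (@preimage_closed 'rV[R]_d R (fun x => `|x|) [set t : R | t = 1]).
      by move=> x _; exact: norm_continuous.
    exact: closed_eq.
  by apply: continuous_subspaceT; exact: dnorm_continuous.
(* The sphere is empty only if [d = 0], and then every vector is zero. *)
have [[y0 Ay0]|A0] := pselect (A !=set0); last first.
  exists 1 => // x; rewrite mul1r.
  have [->|x0] := eqVneq x 0; first by rewrite normr0 dnorm_ge0.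
  have : A (`|x|^-1 *: x).
    by rewrite /A /= normrZ normfV normr_id mulVf// normr_eq0.
  by move=> Ax; case: A0; exists (`|x|^-1 *: x).
have [c /set_mem Ac hc] := hA (ex_intro _ _ Ay0).
have c0 : 0 < dnorm dot c.
  rewrite lt_neqAle dnorm_ge0 andbT eq_sym; apply/eqP => /dnorm_eq0 c0.
  by move: Ac; rewrite /A /= c0 normr0 => /eqP; rewrite eq_sym oner_eq0.
exists (dnorm dot c)^-1; first by rewrite invr_gt0.
move=> x; have [->|x0] := eqVneq x 0.
  by rewrite normr0 mulr_ge0 ?dnorm_ge0// invr_ge0 ltW.
have nx0 : 0 < `|x| by rewrite normr_gt0.
rewrite ler_pdivlMl// mulrC -ler_pdivlMl// -dnormZ_ge0 ?invr_ge0// hc//.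
by apply/mem_set; rewrite /A /= normrZ normfV normr_id mulVf// gt_eqF.
Qed.

Lemma nearest_exists (D : set 'rV[R]_d) x : closed D -> D !=set0 ->
  nearest dot D x !=set0.
Proof.
move=> cD [y0 Dy0]; have [C C0 hC] := norm_le_dnorm.
pose r := dnorm dot (x - y0).
pose A := D `&` [set y | dnorm dot (x - y) <= r].
have cf : continuous (fun y => dnorm dot (x - y)).
  have [B B0 hB] := dnorm_le_norm.
  apply: (lipschitz_continuous B0) => y z.
  rewrite (le_trans (dnorm_dist _ _))// opprB addrC addrA subrK.
  by rewrite (le_trans (hB _))// distrC.
have cA : compact A.
  apply: bounded_closed_compact.
    exists (`|x| + C * r); split; first exact: num_real.
    move=> M hM y [_ /= yr]; apply/ltW/(le_lt_trans _ hM).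
    rewrite -{1}(subKr x y) (le_trans (ler_normB _ _))// lerD2l.
    by rewrite (le_trans (hC _))// ler_pM2l.
  apply: closedI => //.
  apply: (@preimage_closed 'rV[R]_d R (fun y => dnorm dot (x - y))
    [set t : R | t <= r]).
    by move=> y _; exact: cf.
  exact: closed_le.
have A0 : A !=set0 by exists y0; split => //=.
have [c /set_mem[Dc /= cr] hc] :=
  compact_EVT_min A0 cA (continuous_subspaceT cf).
exists c; split => // z Dz; have [zr|/ltW rz] := leP (dnorm dot (x - z)) r.
  by apply: hc; apply/mem_set; split.
exact: le_trans rz.
Qed.

Section projection.
Variable D : set 'rV[R]_d.
Hypotheses (cD : closed D) (D0 : D !=set0) (cvD : @convex_set R 'rV[R]_d D).

Lemma projP x : nearest dot D x (Defs.proj dot D x).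
Proof. by have [y xy] := nearest_exists x cD D0; exact: (xgetI _ xy). Qed.

Lemma proj_in x : D (Defs.proj dot D x).
Proof. by have [] := projP x. Qed.

(** Variational characterization of the projection: moving from [q] towards [z] inside the convex
    set cannot decrease the distance to [x]. *)
Lemma dot_proj_le0 x z : D z -> dot (x - Defs.proj dot D x) (z - Defs.proj dot D x) <= 0.
Proof.
move=> Dz; have [Dp hp] := projP x; set q := Defs.proj dot D x in Dp hp *.
set u := x - q; set v := z - q.
have key t : 0 < t -> t <= 1 -> 2 * dot u v <= t * dnorm dot v ^+ 2.
  move=> t0 t1; have Dw : D (q + t *: v).
    have -> : q + t *: v = t *: z + (1 - t) *: q.
      by rewrite scalerBr scalerBl scale1r addrCA.
    exact/set_mem/(cvD (Itv01 (ltW t0) t1) (mem_set Dz) (mem_set Dp)).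
  have := hp _ Dw.
  have -> : x - (q + t *: v) = u + (- t) *: v by rewrite opprD addrA scaleNr.
  move=> /(@lerXn2r _ 2 _ _ (dnorm_ge0 _) (dnorm_ge0 _)).
  rewrite -/u (sqr_dnormD u) dnormZ normrN gtr0_norm// dotZr exprMn -/u => h.
  by rewrite -(ler_pM2l t0); nra.
rewrite leNgt; apply/negP => uv0.
pose n := dnorm dot v ^+ 2; have n0 : 0 <= n by exact: sqr_ge0.
(* This explicit step length lies in []0, 1]] and already contradicts [key], so that no limit
   [t -> 0] is taken. *)
have t0 : 0 < dot u v / (dot u v + n) by rewrite divr_gt0// ltr_wpDr.
have t1 : dot u v / (dot u v + n) <= 1.
  by rewrite ler_pdivrMr ?mul1r ?lerDl// ltr_wpDr.
have := key _ t0 t1; rewrite -/n mulrAC ler_pdivlMr ?ltr_wpDr//.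
by move: uv0 n0; clear; clearbody n; move: (dot u v) n => a b; nra.
Qed.

(** Adding the variational inequalities at [x] and at [y] gives [|p - q|^2 <= dot (x - y) (p - q)],
    and Cauchy-Schwarz concludes. *)
Lemma proj_nonexpansive x y :
  dnorm dot (Defs.proj dot D x - Defs.proj dot D y) <= dnorm dot (x - y).
Proof.
set p := Defs.proj dot D x; set q := Defs.proj dot D y.
have h1 : dot (x - p) (q - p) <= 0 by apply: dot_proj_le0; exact: proj_in.
have h2 : dot (y - q) (p - q) <= 0 by apply: dot_proj_le0; exact: proj_in.
have h : dnorm dot (p - q) ^+ 2 <= dot (x - y) (p - q).
  rewrite sqr_dnorm -subr_ge0.
  suff -> : dot (x - y) (p - q) - dot (p - q) (p - q) =
     - (dot (x - p) (q - p)) - dot (y - q) (p - q).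
    by rewrite -opprD oppr_ge0; lra.
  by rewrite !(dotDl, dotDr, dotNl, dotNr); ring.
have [e|e] := eqVneq (dnorm dot (p - q)) 0; first by rewrite e dnorm_ge0.
have e0 : 0 < dnorm dot (p - q) by rewrite lt_neqAle eq_sym e dnorm_ge0.
by rewrite -(ler_pM2r e0) -expr2 (le_trans h)// dot_le.
Qed.

Lemma proj_id x : D x -> Defs.proj dot D x = x.
Proof.
move=> Dx; have [_ /(_ x Dx)] := projP x; rewrite subrr dnorm0 => h.
have /eqP : dnorm dot (x - Defs.proj dot D x) = 0.
  by apply/eqP; rewrite eq_le h dnorm_ge0.
by move=> /eqP/dnorm_eq0/eqP; rewrite subr_eq0 => /eqP.
Qed.

Lemma proj_continuous : continuous (Defs.proj dot D).
Proof.
have [C C0 hC] := norm_le_dnorm; have [B B0 hB] := dnorm_le_norm.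
apply: (lipschitz_continuous (mulr_gt0 C0 B0)) => x y.
by rewrite (le_trans (hC _))// -mulrA ler_pM2l// (le_trans (proj_nonexpansive _ _)).
Qed.

End projection.
End scalar_product.

(** * Estimates for powers *)

Section powR_lemmas.
Context {R : realType}.
Implicit Types a b c s t : R.

Lemma ler_powR2r s a b : 0 <= s -> 0 <= a -> a <= b -> a `^ s <= b `^ s.
Proof.
by move=> s0 a0 ab; apply: ge0_ler_powR; rewrite ?nnegrE// (le_trans a0).
Qed.

Lemma powR_gtD s t a : 0 < a -> a `^ (s + t) = a `^ s * a `^ t.
Proof. by move=> a0; rewrite powRD// (gt_eqF a0) implybT. Qed.

Lemma powR_inv a s : 0 <= a -> a^-1 `^ s = (a `^ s)^-1.
Proof. by move=> a0; rewrite -[a^-1]powR_inv1// -powRrM mulN1r powRN. Qed.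

Lemma powRD_le s a b : 0 <= s -> 0 <= a -> 0 <= b ->
  (a + b) `^ s <= 2 `^ s * (a `^ s + b `^ s).
Proof.
move=> s0; wlog ab : a b / a <= b => [h a0 b0|a0 b0].
  case/orP: (le_total a b) => [/h|/h]; first by apply.
  by rewrite [a + b]addrC [a `^ s + _]addrC; apply.
rewrite (@le_trans _ _ ((2 * b) `^ s))//.
  by apply: ler_powR2r => //; [rewrite addr_ge0|lra].
by rewrite powRM// ler_pM2l ?powR_gt0// lerDr powR_ge0.
Qed.

(** [expR (- t) >= 1 - t] gives [expR t <= (1 - t)^-1], and [(1 + t + 2 t^2) (1 - t) = 1 + t^2 (1 -
    2 t)]. Negative [t] of any size are covered, as needed for contraction factors. *)
Lemma expR_le_quadratic t : t <= 2^-1 -> expR t <= 1 + t + 2 * t ^+ 2.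
Proof.
move=> t2; have h : 0 < 1 - t by lra.
have : expR t <= (1 - t)^-1.
  rewrite -[t in X in X <= _]opprK expRN lef_pV2 ?posrE ?expR_gt0//.
  exact: expR_ge1Dx.
move/le_trans; apply; rewrite -[leLHS]mul1r ler_pdivrMr//.
by have := sqr_ge0 t; nra.
Qed.

Lemma powR_le_expR a t s : 0 <= s -> 0 <= a -> a <= 1 + t ->
  a `^ s <= expR (t * s).
Proof.
move=> s0 a0 at1; rewrite expRM.
by apply: ler_powR2r => //; rewrite (le_trans at1)// expR_ge1Dx.
Qed.

(** * Young-type inequalities and expansions for exponents [p >= 2] *)

Section exponent_ge2.
Variables (p : R) (hp : 2 <= p).
Let p0 : 0 < p. Proof. by move: (hp); lra. Qed.
Let p1 : 1 < p. Proof. by move: (hp); lra. Qed.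
Let pn0 : p != 0. Proof. by rewrite gt_eqF// p0. Qed.

Lemma powR_mulB2 a : 0 <= a -> a `^ (p - 2) * a ^+ 2 = a `^ p.
Proof.
have h2p := hp; have h0p := p0; have h1p := p1.
rewrite le_eqVlt => /predU1P[<-|a0]; first by rewrite expr0n mulr0 powR0.
by rewrite -powR_mulrn ?(ltW a0)// -powR_gtD// subrK.
Qed.

Lemma powR_mulB1 a : 0 <= a -> a `^ (p - 1) * a = a `^ p.
Proof. by move=> a0; rewrite mulrC mulr_powRB1// p0. Qed.

Lemma powR_mulB21 a : 0 <= a -> a `^ (p - 2) * a = a `^ (p - 1).
Proof.
have h2p := hp; rewrite le_eqVlt => /predU1P[<-|a0].
  by rewrite mulr0 powR0// gt_eqF//; lra.
by rewrite -{2}(powRr1 (ltW a0)) -powR_gtD//; congr (_ `^ _); ring.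
Qed.

(** No conjugate exponents are needed: the larger of [a] and [c] dominates both factors. *)
Lemma young2 a c : 0 <= a -> 0 <= c ->
  a `^ (p - 2) * c ^+ 2 <= a `^ p + c `^ p.
Proof.
have h2p := hp; have h0p := p0; have h1p := p1.
move=> a0 c0; have [ac|/ltW ca] := leP a c.
  rewrite ler_wpDl ?powR_ge0// -(powR_mulB2 c0) ler_wpM2r ?sqr_ge0//.
  by apply: ler_powR2r => //; lra.
rewrite ler_wpDr ?powR_ge0// -(powR_mulB2 a0) ler_wpM2l ?powR_ge0//.
by rewrite lerXn2r.
Qed.

Lemma young1 a c : 0 <= a -> 0 <= c ->
  a `^ (p - 1) * c <= a `^ p + c `^ p.
Proof.
have h2p := hp; have h0p := p0; have h1p := p1.
move=> a0 c0; have [ac|/ltW ca] := leP a c.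
  rewrite ler_wpDl ?powR_ge0// -(powR_mulB1 c0) ler_wpM2r//.
  by apply: ler_powR2r => //; lra.
by rewrite ler_wpDr ?powR_ge0// -(powR_mulB1 a0) ler_wpM2l ?powR_ge0.
Qed.

(** The case distinction is made at [c = sqrt e * a]: below it the first term suffices, above it [a]
    is replaced by [c / sqrt e]. *)
Lemma young2_small e : 0 < e -> exists2 C, 0 < C & forall a c,
  0 <= a -> 0 <= c -> a `^ (p - 2) * c ^+ 2 <= e * a `^ p + C * c `^ p.
Proof.
have h2p := hp; have h0p := p0; have h1p := p1.
move=> e0; pose h := Num.sqrt e; have h0 : 0 < h by rewrite sqrtr_gt0.
have hh : h ^+ 2 = e by rewrite sqr_sqrtr// ltW.
exists (h^-1 `^ (p - 2)) => [|a c a0 c0]; first by rewrite powR_gt0// invr_gt0.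
have [ca|/ltW ac] := leP c (h * a).
  rewrite ler_wpDr ?mulr_ge0 ?powR_ge0// -hh -(powR_mulB2 a0) [leRHS]mulrCA.
  by rewrite ler_wpM2l ?powR_ge0// -exprMn lerXn2r ?nnegrE// mulr_ge0// ltW.
rewrite ler_wpDl ?mulr_ge0 ?powR_ge0// ?(ltW e0)//.
rewrite (@le_trans _ _ ((h^-1 * c) `^ (p - 2) * c ^+ 2))//; last first.
  by rewrite powRM ?invr_ge0 ?(ltW h0)// -mulrA powR_mulB2.
rewrite ler_wpM2r ?sqr_ge0//; apply: ler_powR2r => //; first lra.
by rewrite -ler_pdivrMl ?invr_gt0// invrK.
Qed.

Lemma young1_small e : 0 < e -> exists2 C, 0 < C & forall a c,
  0 <= a -> 0 <= c -> a `^ (p - 1) * c <= e * a `^ p + C * c `^ p.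
Proof.
have h2p := hp; move=> e0.
exists (e^-1 `^ (p - 1)) => [|a c a0 c0]; first by rewrite powR_gt0// invr_gt0.
have [ca|/ltW ac] := leP c (e * a).
  rewrite ler_wpDr ?mulr_ge0 ?powR_ge0// -(powR_mulB1 a0) [leRHS]mulrCA.
  by rewrite ler_wpM2l ?powR_ge0.
rewrite ler_wpDl ?mulr_ge0 ?powR_ge0// ?(ltW e0)//.
rewrite (@le_trans _ _ ((e^-1 * c) `^ (p - 1) * c))//; last first.
  by rewrite powRM ?invr_ge0 ?(ltW e0)// -mulrA powR_mulB1.
rewrite ler_wpM2r//; apply: ler_powR2r => //; first lra.
by rewrite -ler_pdivrMl ?invr_gt0// invrK.
Qed.

(* Second-order expansion of the p-th power of a norm around a vector of
   norm a, with ip the scalar product with a perturbation of norm b. *)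
Lemma powR_expansion : exists2 C : R, 0 < C & forall a b ip s,
  0 <= a -> 0 <= b -> 0 <= s -> `|ip| <= a * b ->
  s ^+ 2 = a ^+ 2 + 2 * ip + b ^+ 2 ->
  s `^ p <= a `^ p + p * a `^ (p - 2) * ip + C * (a `^ (p - 2) * b ^+ 2 + b `^ p).
Proof.
have h2p := hp; have h0p := p0; have h1p := p1.
(* [C1] serves the regime [3 p b <= a]: [p / 2] comes from the [b^2] in the increment of the squared
   norm, [9 p^2 / 2] from the quadratic term of the exponential. [C2] serves [a < 3 p b], where it
   bounds [s^p] together with the possibly negative linear term. *)
pose C1 := p / 2 + 9 * p ^+ 2 / 2.
pose C2 := (3 * p + 1) `^ p + p * (3 * p) `^ (p - 1).
have C10 : 0 < C1 by rewrite addr_gt0 ?divr_gt0 ?mulr_gt0 ?exprn_gt0.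
have C20 : 0 < C2.
  by rewrite ltr_wpDr ?mulr_ge0 ?powR_ge0 ?powR_gt0 ?(ltW p0)//; lra.
exists (C1 + C2) => [|a b ip s a0 b0 s0 ipab sE]; first by rewrite addr_gt0.
have /andP[ip1 ip2] : - (a * b) <= ip <= a * b by rewrite -ler_norml.
have ab0 : 0 <= a * b by rewrite mulr_ge0.
have hab : 0 <= a `^ (p - 2) * b ^+ 2 by rewrite mulr_ge0 ?powR_ge0 ?sqr_ge0.
have hb : 0 <= b `^ p by exact: powR_ge0.
(* If [a < 3 p b], the terms to be controlled are of order [b^p]. Otherwise, for [a > 0], the
   squared norm changes by a factor [1 + t] with [t <= 3 b / a <= 1 / p], so that [t p / 2 <= 1 / 2]
   and [expR_le_quadratic] applies. *)
have [ba|ab] := leP (3 * p * b) a; last first.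
  have sab : s <= (3 * p + 1) * b.
    rewrite (@le_trans _ _ (a + b))//; last by rewrite mulrDl mul1r lerD2r ltW.
    rewrite -(@ler_pXn2r _ 2)// ?nnegrE ?addr_ge0// sE; nra.
  have h1 : s `^ p <= (3 * p + 1) `^ p * b `^ p.
    rewrite -powRM//; last by lra.
    by apply: ler_powR2r; rewrite ?(ltW p0).
  have h2 : - (p * (3 * p) `^ (p - 1) * b `^ p) <= p * a `^ (p - 2) * ip.
    apply: (@le_trans _ _ (p * a `^ (p - 2) * (- (a * b)))); last first.
      by rewrite ler_wpM2l// mulr_ge0 ?powR_ge0 ?(ltW p0).
    rewrite mulrN lerN2 -!mulrA ler_wpM2l ?(ltW p0)// -(powR_mulB1 b0).
    rewrite !mulrA ler_wpM2r// -powRM ?mulr_ge0 ?(ltW p0)//.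
    rewrite powR_mulB21//.
    by apply: ler_powR2r => //; [lra|exact: ltW].
  have h3 : 0 <= a `^ p by exact: powR_ge0.
  have h4 : C2 * b `^ p <= (C1 + C2) * (a `^ (p - 2) * b ^+ 2 + b `^ p).
    apply: ler_pM; rewrite ?(ltW C20)//; [by rewrite lerDr ltW|by rewrite lerDr].
  have h5 : C2 * b `^ p =
    (3 * p + 1) `^ p * b `^ p + p * (3 * p) `^ (p - 1) * b `^ p by exact: mulrDl.
  lra.
move: a0; rewrite le_eqVlt => /predU1P[a0|a0].
  have b00 : b = 0.
    by apply/eqP; rewrite eq_le b0 andbT -(pmulr_rle0 _ p0); nra.
  have ip0 : ip = 0 by nra.
  have -> : s = 0.
    by move/eqP: sE; rewrite -a0 b00 ip0 expr0n !mulr0 !addr0 sqrf_eq0 => /eqP.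
  by rewrite -a0 b00 ip0 expr0n !mulr0 !(powR0 pn0) !addr0 mulr0.
pose t := (2 * ip + b ^+ 2) / a ^+ 2.
have a20 : 0 < a ^+ 2 by rewrite exprn_gt0.
have bla : 3 * b <= a by nra.
have t3 : `|2 * ip + b ^+ 2| <= 3 * a * b by rewrite ler_norml; nra.
have tE : s ^+ 2 = a ^+ 2 * (1 + t) by rewrite sE /t; field; rewrite gt_eqF.
have t10 : 0 <= 1 + t by rewrite -(pmulr_rge0 _ a20) -tE sqr_ge0.
have sp : s `^ p = a `^ p * (1 + t) `^ (p / 2).
  have hh x : 0 <= x -> x `^ p = (x ^+ 2) `^ (p / 2).
    move=> x0; rewrite -powR_mulrn// -powRrM; congr (_ `^ _); by field.
  by rewrite !hh// ?(ltW a0)// tE powRM// ltW.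
have th : t * (p / 2) <= 2^-1.
  have : t <= 3 * b / a.
    rewrite /t ler_pdivrMr//.
    have -> : 3 * b / a * a ^+ 2 = 3 * a * b by field; rewrite gt_eqF.
    by move: t3; rewrite ler_norml => /andP[_]; nra.
  move=> t4; have : t * p <= 1; last by lra.
  rewrite (@le_trans _ _ (3 * b / a * p))// ?ler_pM2r// mulrAC ler_pdivrMr//.
  by rewrite mul1r mulrAC.
have t2 : a `^ p * t ^+ 2 <= 9 * (a `^ (p - 2) * b ^+ 2).
  rewrite -(powR_mulB2 (ltW a0)) -mulrA [leRHS]mulrCA ler_wpM2l ?powR_ge0//.
  have -> : a ^+ 2 * t ^+ 2 = (2 * ip + b ^+ 2) ^+ 2 / a ^+ 2.
    by rewrite /t; field; rewrite gt_eqF.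
  rewrite ler_pdivrMr// -real_normK ?num_real//.
  have -> : 9 * b ^+ 2 * a ^+ 2 = (3 * a * b) ^+ 2 by ring.
  by rewrite lerXn2r// nnegrE ?normr_ge0// !mulr_ge0// ltW.
have hT : a `^ p * t = 2 * a `^ (p - 2) * ip + a `^ (p - 2) * b ^+ 2.
  by rewrite -(powR_mulB2 (ltW a0)) /t; field; rewrite gt_eqF.
rewrite sp; apply: (@le_trans _ _ (a `^ p *
    (1 + t * (p / 2) + 2 * (t * (p / 2)) ^+ 2))).
  rewrite ler_wpM2l ?powR_ge0// (le_trans _ (expR_le_quadratic th))//.
  by apply: powR_le_expR => //; rewrite ltW// divr_gt0.
have -> : a `^ p * (1 + t * (p / 2) + 2 * (t * (p / 2)) ^+ 2) =
  a `^ p + (a `^ p * t) * (p / 2) + (p ^+ 2 / 2) * (a `^ p * t ^+ 2) by field.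
have h6 : (p ^+ 2 / 2) * (a `^ p * t ^+ 2) <=
    (p ^+ 2 / 2) * (9 * (a `^ (p - 2) * b ^+ 2)).
  by rewrite ler_wpM2l// divr_ge0// sqr_ge0.
have h7 : C1 * (a `^ (p - 2) * b ^+ 2) <=
    (C1 + C2) * (a `^ (p - 2) * b ^+ 2 + b `^ p).
  by apply: ler_pM; rewrite ?(ltW C10)//; [rewrite lerDl ltW|rewrite lerDl].
rewrite hT; move: h6 h7; rewrite /C1.
by move: (a `^ (p - 2)) (b ^+ 2) => u v; nra.
Qed.

(* Burkholder's function for Doob's maximal inequality: S is a submartingale
   and m its running maximum. *)
Definition doob_fun (S m : R) : R :=
  (p - 1) / p * m `^ p - m `^ (p - 1) * S + (4 `^ (p - 1) + 1) * S `^ p.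

(** Comparing [4 S] with [m] bounds the mixed term by [m^p / 4 + 4^(p - 1) S^p]. As
    [(p - 1) / p >= 1 / 2], a quarter of [m^p] survives, and the summand 1 in the coefficient of
    [S^p] keeps [S^p] as well. *)
Lemma doob_fun_ge S m : 0 <= S -> 0 <= m ->
  m `^ p / 4 + S `^ p <= doob_fun S m.
Proof.
have h2p := hp; have h0p := p0; have h1p := p1.
move=> S0 m0; have h1 : 2^-1 <= (p - 1) / p by rewrite ler_pdivlMr//; lra.
have h2 : m `^ (p - 1) * S <= m `^ p / 4 + 4 `^ (p - 1) * S `^ p.
  have [Sm|/ltW mS] := leP (4 * S) m.
    rewrite ler_wpDr ?mulr_ge0 ?powR_ge0// -(powR_mulB1 m0) -mulrA.
    by rewrite ler_wpM2l ?powR_ge0//; lra.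
  rewrite ler_wpDl ?divr_ge0 ?powR_ge0// -(powR_mulB1 S0) mulrA ler_wpM2r//.
  by rewrite -powRM//; apply: ler_powR2r => //; lra.
have h3 : 2^-1 * m `^ p <= (p - 1) / p * m `^ p by rewrite ler_wpM2r ?powR_ge0.
rewrite /doob_fun; lra.
Qed.

(** As long as the maximum is not updated, the part in [m] is affine in [S]; at an update Young's
    inequality with exponents [p / (p - 1)] and [p] applies. The factor [m^(p - 1)] in front of the
    increment belongs to the past, so an increment with nonnegative conditional mean makes this term
    harmless. *)
Lemma doob_fun_step S m S' : 0 <= m -> 0 <= S' ->
  doob_fun S' (Num.max m S') <=
  doob_fun S m - m `^ (p - 1) * (S' - S) +
    (4 `^ (p - 1) + 1) * (S' `^ p - S `^ p).
Proof.
have h2p := hp; have h0p := p0; have h1p := p1.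
move=> m0 S'0; rewrite /doob_fun.
suff : (p - 1) / p * Num.max m S' `^ p - Num.max m S' `^ (p - 1) * S' <=
    (p - 1) / p * m `^ p - m `^ (p - 1) * S' by lra.
have [//|mS] := leP S' m.
have := @conjugate_powR R (m `^ (p - 1)) S' (p / (p - 1)) p (powR_ge0 _ _) S'0.
have p10 : 0 < p - 1 by lra.
rewrite divr_gt0// => /(_ isT p0).
have -> : (p / (p - 1))^-1 + p^-1 = 1 by field; rewrite gt_eqF//= gt_eqF.
have -> : (m `^ (p - 1)) `^ (p / (p - 1)) = m `^ p.
  by rewrite -powRrM; congr (_ `^ _); field; rewrite gt_eqF.
have -> : m `^ p / (p / (p - 1)) = (p - 1) / p * m `^ p.
  by field; rewrite gt_eqF//= gt_eqF.
move=> /(_ erefl); rewrite powR_mulB1//.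
have -> : (p - 1) / p * S' `^ p = S' `^ p - S' `^ p / p by field.
lra.
Qed.

End exponent_ge2.

(** The power [n^(- s)] loses only a relative amount of about [s / n] per step, less than the
    contraction [k / n]. Half of the gap [k - s] absorbs the error of this approximation, the other
    half pays for the inhomogeneity. *)
Lemma decay_recursion (v : nat -> R) (n0 : nat) (k s b : R) :
  0 <= s -> s < k -> 0 <= b -> (forall n, 0 <= v n) ->
  (forall n, (n0 <= n)%N -> v n.+1 <= (1 - k / n.+1%:R) * v n +
     b / n.+1%:R * n.+1%:R `^ (- s)) ->
  exists2 C, 0 < C & forall n, (0 < n)%N -> v n <= C * n%:R `^ (- s).
Proof.
move=> s0 sk b0 v0 hv; pose c := (k - s) / 2.
have c0 : 0 < c by rewrite divr_gt0// subr_gt0.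
(* Beyond [n1] the factor [1 - k / n.+1] is nonnegative and [s / n <= c]; the sum in [C] covers the
   indices up to [n1]. *)
pose n1 := maxn n0 (maxn (Num.truncn k).+1 (Num.truncn (s / c)).+1).
pose C := 1 + b / c + \sum_(i < n1.+1) v i * i%:R `^ s.
have S0 (i : 'I_n1.+1) : 0 <= v i * i%:R `^ s by rewrite mulr_ge0 ?powR_ge0.
have C0 : 0 < C.
  by rewrite ltr_wpDr ?sumr_ge0// ltr_wpDr// divr_ge0// ltW.
have small n : (0 < n)%N -> (n < n1.+1)%N -> v n <= C * n%:R `^ (- s).
  move=> ngt0 nn1; have n0' : 0 < n%:R :> R by rewrite ltr0n.
  rewrite powRN -ler_pdivrMr ?invr_gt0 ?powR_gt0// invrK.
  rewrite /C (bigD1 (Ordinal nn1))//= addrA addrAC lerDr.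
  have bc0 : 0 <= b / c by rewrite divr_ge0// ltW.
  by rewrite !addr_ge0// sumr_ge0.
exists C => // n ngt0; have [/(small _ ngt0)//|] := ltnP n n1.+1.
elim: n ngt0 => // n IHn _; rewrite ltnS => n1n.
have n0n : (n0 <= n)%N by rewrite (leq_trans _ n1n)// leq_maxl.
have kn : k <= n%:R.
  rewrite (le_trans (ltW (truncnS_gt k)))// ler_nat (leq_trans _ n1n)//.
  by rewrite leq_max leq_max leqnn orbT.
have scn : s / c <= n%:R.
  rewrite (le_trans (ltW (truncnS_gt _)))// ler_nat (leq_trans _ n1n)//.
  by rewrite leq_max leq_max leqnn !orbT.
have ngt0 : 0 < n%:R :> R.
  by rewrite ltr0n (leq_trans _ n1n)// leq_max leq_max !ltnS leq0n orbT.
have n1gt0 : 0 < n.+1%:R :> R by rewrite ltr0n.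
have n1E : n.+1%:R = n%:R + 1 :> R by rewrite -natr1.
have vn : v n <= C * n%:R `^ (- s).
  have [nn1|] := ltnP n n1.+1; first by apply: small; rewrite -?(ltr0n R).
  by apply: IHn; rewrite -(ltr0n R).
rewrite (le_trans (hv _ n0n))//.
have k1 : 0 <= 1 - k / n.+1%:R by rewrite subr_ge0 ler_pdivrMr// mul1r; lra.
set N := n.+1%:R in n1gt0 n1E k1 *.
(* Bernoulli's inequality in the form [expR (- s * ln (1 + 1 / n)) >= 1 - s / n]. *)
have ratio : 1 - s / n%:R <= (n%:R / N) `^ s.
  have q0 : 0 < n%:R / N by rewrite divr_gt0.
  have -> : (n%:R / N) `^ s = expR (- s * ln (1 + n%:R^-1)).
    have -> : 1 + n%:R^-1 = (n%:R / N)^-1 by rewrite n1E; field; rewrite ?gt_eqF.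
    rewrite lnV ?posrE// mulrNN /powR gt_eqF//.
  rewrite (le_trans _ (expR_ge1Dx _))// lerD2l mulNr lerN2 ler_wpM2l//.
  by rewrite le_ln1Dx// (@lt_trans _ _ 0)// ?ltrN10// invr_gt0.
have key : (1 - k / N) * n%:R `^ (- s) <= (1 - c / N) * N `^ (- s).
  have -> : N `^ (- s) = (n%:R / N) `^ s * n%:R `^ (- s).
    rewrite powRM ?ltW// ?invr_gt0// mulrAC -powR_gtD// subrr powRr0 mul1r.
    by rewrite -powR_inv1 ?ltW// -powRrM mulN1r.
  rewrite mulrA ler_wpM2r ?powR_ge0//.
  have ckN : c <= N by rewrite n1E; move: kn; rewrite /c; lra.
  apply: (@le_trans _ _ ((1 - c / N) * (1 - s / n%:R))); last first.
    by rewrite ler_wpM2l// subr_ge0 ler_pdivrMr// mul1r.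
  have h1 : s / n%:R <= (s + c) / N.
    have -> : s / n%:R = (s + s / n%:R) / N by rewrite n1E; field; rewrite -?n1E ?gt_eqF.
    rewrite ler_wpM2r ?invr_ge0 ?(ltW n1gt0)// lerD2l ler_pdivrMr// mulrC.
    by rewrite -ler_pdivrMr.
  have h2 : k / N = (s + c) / N + c / N by rewrite -mulrDl /c; congr (_ / _); field.
  have h3 : 0 <= c / N * (s / n%:R) 
    by apply: mulr_ge0; apply: divr_ge0 => //; exact: ltW.
  by rewrite h2; move: h1 h3; move: (c / N) (s / n%:R) ((s + c) / N); clear => u w x; lra.
have : b / N * N `^ (- s) <= C * (c / N) * N `^ (- s).
  rewrite ler_wpM2r ?powR_ge0// mulrA ler_wpM2r ?invr_ge0 ?(ltW n1gt0)//.
  rewrite -ler_pdivrMr// /C addrAC lerDr.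
  by rewrite addr_ge0// sumr_ge0.
move: (ler_wpM2l (ltW C0) key) (ler_wpM2l k1 vn).
move: (n%:R `^ (- s)) (N `^ (- s)) (v n) (k / N) (c / N) (b / N) => x y z w u t.
by clear; lra.
Qed.

End powR_lemmas.

(** * Borel sets of row vectors *)

Section borel_row_vectors.
Context {R : realType} {d : nat}.
Implicit Types W : set 'rV[R]_d.

Lemma open_borel_rV W : open W -> measurable (W : set (borel_rV R d)).
Proof. by move=> oW; exact: sub_sigma_algebra. Qed.

Lemma closed_borel_rV W : closed W -> measurable (W : set (borel_rV R d)).
Proof.
move=> cO; rewrite -[W]setCK; apply: measurableC; apply: open_borel_rV.
exact: closed_openC.
Qed.

Lemma continuous_borel_rV_real (f : 'rV[R]_d -> R) : continuous f ->
  measurable_fun setT (f : borel_rV R d -> R).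
Proof.
move=> cf; apply: (measurability _ (RGenOInfty.measurableE R)) => //.
move=> /= _ [_ [a ->] <-]; rewrite setTI preimage_itvoy; apply: open_borel_rV.
by apply: (@open_comp _ _ f [set t | a < t]) => [x _|]; [exact: cf|exact: open_gt].
Qed.

Lemma continuous_borel_rV (f : 'rV[R]_d -> 'rV[R]_d) : continuous f ->
  measurable_fun setT (f : borel_rV R d -> borel_rV R d).
Proof.
move=> cf.
refine (@measurability _ _ (borel_rV R d) (borel_rV R d) setT f
  (@open 'rV[R]_d) erefl _).
move=> /= _ [A oA <-]; rewrite setTI; apply: open_borel_rV.
by apply: open_comp => [x _|//]; exact: cf.
Qed.

Lemma norm_lt_coord (x : 'rV[R]_d) (e : R) : 0 < e ->
  (forall i, `|x 0 i| < e) -> `|x| < e.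
Proof.
by move=> e0 xe; rewrite [`|x|]mx_normrE; apply: bigmax_lt => // -[i j] _;
  rewrite ord1.
Qed.

Let cube (q : 'rV[rat]_d * nat) : set 'rV[R]_d :=
  [set y | forall i, `|ratr (q.1 0 i) - y 0 i| < q.2.+1%:R^-1].

(** Cubes with rational centres and radii [1 / (j + 1)] form a countable base; this makes Borel
    measurability of a row vector a coordinatewise property. *)
Let open_cubes W : open W -> W = \bigcup_(q in [set q | cube q `<=` W]) cube q.
Proof.
move=> oW; apply/seteqP; split => [x Wx|x [q /= qW /qW//]].
have /nbhs_normP[e /= e0 xeW] : nbhs x W by exact: open_nbhs_nbhs.
pose n := Num.truncn (2 / e).
have ne : 2 * n.+1%:R^-1 < e.
  by rewrite ltr_pdivrMr// mulrC -ltr_pdivrMr// truncnS_gt.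
have n0 : 0 < n.+1%:R^-1 :> R by rewrite invr_gt0.
have hq i : {q : rat | `|ratr q - x 0 i| < n.+1%:R^-1}.
  apply: cid; have [|q] := @rat_in_itvoo R (x 0 i - n.+1%:R^-1) (x 0 i + n.+1%:R^-1).
    by rewrite ltrD2l (lt_trans _ n0)// oppr_lt0.
  by rewrite in_itv/= => h; exists q; rewrite ltr_distl.
exists (\row_i sval (hq i), n) => /=; last first.
  by move=> i; rewrite mxE; exact: svalP (hq i).
move=> y; rewrite /cube /= => hy; apply: xeW => /=.
apply: norm_lt_coord => // i; rewrite !mxE.
have := hy i; rewrite mxE => hyi; have hxi := svalP (hq i).
rewrite (le_lt_trans (ler_distD (ratr (sval (hq i))) _ _))//.
by rewrite (lt_trans _ ne)// mulr_natl mulr2n ltrD// distrC.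
Qed.

Lemma measurable_coord i : measurable_fun setT (fun x : borel_rV R d => x 0 i).
Proof. by apply: continuous_borel_rV_real; exact: coord_continuous. Qed.

Context {dT : measure_display} {T : measurableType dT}.
Implicit Types (A : set T) (f g : T -> 'rV[R]_d).

Lemma measurable_rowP A f :
  (forall i, measurable_fun A (fun x => f x 0 i)) <->
  measurable_fun A (f : T -> borel_rV R d).
Proof.
split=> [mf|mf i]; last exact: (measurableT_comp (measurable_coord i)).
move=> mA; move: (mA).
refine (@measurability _ _ T (borel_rV R d) A f (@open 'rV[R]_d) erefl _).
move=> /= _ [W oW <-].
rewrite (open_cubes oW) preimage_bigcup setI_bigcupr.
rewrite bigcup_mkcond; apply: countable_bigcupT_measurable => // q.
case: ifP => // _.
rewrite [X in measurable X](_ : _ = A `&` \bigcap_i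
    (A `&` (fun x => `|ratr (q.1 0 i) - f x 0 i|) @^-1` `]-oo, q.2.+1%:R^-1[)).
  apply: measurableI => //; apply: fin_bigcap_measurable => // i _.
  apply: (_ : measurable_fun A _) => //; apply: measurableT_comp => //.
  by apply: measurable_funB => //; exact: mf.
apply/seteqP; split => x [Ax] => [hx|hx]; split => //.
  by move=> i _; split => //=; rewrite in_itv/=; exact: hx.
by move=> i; have [_ /=] := hx i I; rewrite in_itv.
Qed.

Lemma measurable_rVD A f g :
  measurable_fun A (f : T -> borel_rV R d) ->
  measurable_fun A (g : T -> borel_rV R d) ->
  measurable_fun A (fun x => f x + g x : borel_rV R d).
Proof.
move=> /measurable_rowP mf /measurable_rowP mg; apply/measurable_rowP => i.
by under eq_fun do rewrite mxE; exact: measurable_funD.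
Qed.

Lemma measurable_rVN A f :
  measurable_fun A (f : T -> borel_rV R d) ->
  measurable_fun A (fun x => - f x : borel_rV R d).
Proof.
move=> /measurable_rowP mf; apply/measurable_rowP => i.
by under eq_fun do rewrite mxE; exact: measurable_funN.
Qed.

Lemma measurable_rVB A f g :
  measurable_fun A (f : T -> borel_rV R d) ->
  measurable_fun A (g : T -> borel_rV R d) ->
  measurable_fun A (fun x => f x - g x : borel_rV R d).
Proof. by move=> mf mg; apply: measurable_rVD => //; exact: measurable_rVN. Qed.

Lemma measurable_rVZ A (c : T -> R) f :
  measurable_fun A c -> measurable_fun A (f : T -> borel_rV R d) ->
  measurable_fun A (fun x => c x *: f x : borel_rV R d).
Proof.
move=> mc /measurable_rowP mf; apply/measurable_rowP => i.
by under eq_fun do rewrite mxE; exact: measurable_funM.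
Qed.

Lemma measurable_rV_sum A (I : eqType) (s : seq I) (h : I -> T -> 'rV[R]_d) :
  (forall i, i \in s -> measurable_fun A (h i : T -> borel_rV R d)) ->
  measurable_fun A (fun x => \sum_(i <- s) h i x : borel_rV R d).
Proof.
elim: s => [_|i s IHs mh].
  by under eq_fun do rewrite big_nil; exact: measurable_cst.
under eq_fun do rewrite big_cons.
apply: measurable_rVD; first by apply: mh; rewrite mem_head.
by apply: IHs => j js; apply: mh; rewrite inE js orbT.
Qed.

Lemma measurable_dnorm (dot : {dot 'rV[R]_d for idfun}) A f :
  measurable_fun A (f : T -> borel_rV R d) ->
  measurable_fun A (fun x => dnorm dot (f x)).
Proof.
apply: (measurableT_comp (continuous_borel_rV_real (dnorm_continuous (dot:=dot)))).
Qed.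

End borel_row_vectors.

(** Needed because the numbers of levels and replications depend on the random parameter: the
    estimator selects measurably among countably many sums with fixed bounds. *)
Lemma measurable_fun_nat_family (R : realType) d1 d2 (T1 : measurableType d1)
    (T2 : measurableType d2) (h : T1 -> nat) (g : nat -> T1 -> T2) :
  measurable_fun setT h -> (forall n, measurable_fun setT (g n)) ->
  measurable_fun setT (fun x => g (h x) x).
Proof.
move=> mh mg _ B mB; rewrite setTI.
rewrite [X in measurable X](_ : _ = \bigcup_n (h @^-1` [set n] `&` g n @^-1` B)).
  apply: bigcupT_measurable => n; rewrite -[X in measurable X]setTI.
  rewrite setIA; apply: measurableI.
    exact: mh.
  by rewrite -[X in measurable X]setTI; exact: mg.
by apply/seteqP; split => [x gx|x [n _ [/= <-]]//]; exists (h x).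
Qed.

Lemma measurable_fun_nat_le d (T : measurableType d) (h : T -> nat) :
  (forall j, measurable [set x | (h x <= j)%N]) -> measurable_fun setT h.
Proof.
move=> mh _ B _; rewrite setTI.
rewrite [X in measurable X](_ : _ = \bigcup_(j in B) [set x | h x = j]); last first.
  apply/seteqP; split => [x Bx|x [j Bj /= hj]]; first by exists (h x).
  by rewrite /preimage/= hj.
apply: bigcup_measurable => j _.
case: j => [|j].
  rewrite [X in measurable X](_ : _ = [set x | (h x <= 0)%N])//.
  by apply/seteqP; split => x /=; [move=> ->|rewrite leqn0 => /eqP].
rewrite [X in measurable X](_ : _ =
    [set x | (h x <= j.+1)%N] `\` [set x | (h x <= j)%N]).
  exact: measurableD.
apply/seteqP; split => x /=; first by move=> ->; rewrite ltnn.
by move=> [h1 /negP]; rewrite -ltnNge => h2; apply/eqP; rewrite eqn_leq h1 h2.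
Qed.

(** * Independent sigma-algebras *)

Section independent_sigma_algebras.
Context {R : realType} {dO dS : measure_display}.
Context {Omega : measurableType dO} {S : measurableType dS}.
Variables (P : probability Omega R) (I : choiceType) (X : I -> {RV P >-> S}).
Implicit Types (J : set I).

(** These finite intersections form a pi-system that generates the sigma-algebra of the variables
    indexed by [J]. *)
Definition cylinder (J : set I) : set (set Omega) :=
  [set C | exists s : seq I, exists B : I -> set S,
    [/\ uniq s, forall i, i \in s -> J i, forall i, measurable (B i) &
        C = \big[setI/setT]_(i <- s) (X i @^-1` B i)]].

Lemma cylinderT J : cylinder J setT.
Proof. by exists [::], (fun=> setT); split => //; rewrite big_nil. Qed.

Lemma cylinder_preimage J i (B : set S) : J i -> measurable B ->
  cylinder J (X i @^-1` B).
Proof.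
move=> Ji mB; exists [:: i], (fun=> B); split => //; last by rewrite big_seq1.
by move=> j; rewrite inE => /eqP ->.
Qed.

Let big_preimage (s s' : seq I) (B : I -> set S) : uniq s -> uniq s' ->
    {subset s <= s'} ->
  \big[setI/setT]_(i <- s) (X i @^-1` B i) =
  \big[setI/setT]_(i <- s') (X i @^-1` (if i \in s then B i else setT)).
Proof.
move=> us us' ss'; rewrite -!bigcap_seq; apply/seteqP; split => w hw i /=.
  by move=> _; case: ifPn => // si; exact: hw.
by move=> si; have /= := hw i (ss' _ si); rewrite si.
Qed.

Lemma cylinder_setI J : setI_closed (cylinder J).
Proof.
move=> C1 C2 [s1 [B1 [us1 s1J mB1 ->]]] [s2 [B2 [us2 s2J mB2 ->]]].
exists (undup (s1 ++ s2)), (fun i => (if i \in s1 then B1 i else setT) `&`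
  (if i \in s2 then B2 i else setT)); split.
- exact: undup_uniq.
- by move=> i; rewrite mem_undup mem_cat => /orP[/s1J|/s2J].
- by move=> i; apply: measurableI; case: ifP.
- rewrite (big_preimage _ us1 (undup_uniq (s1 ++ s2))); last first.
    by move=> i si; rewrite mem_undup mem_cat si.
  rewrite (big_preimage _ us2 (undup_uniq (s1 ++ s2))); last first.
    by move=> i si; rewrite mem_undup mem_cat si orbT.
  by rewrite -big_split/=; apply: eq_bigr => i _.
Qed.

Lemma cylinder_measurable J : cylinder J `<=` measurable.
Proof.
move=> _ [s [B [_ _ mB ->]]]; apply: bigsetI_measurable => i _.
by rewrite -[X in measurable X]setTI; apply: measurable_funP => //.
Qed.

(** A copy of [Omega] carrying only the events determined by the variables in [J]. As it is
    convertible to [Omega], measurability with respect to the past or to the fresh simulations is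
    expressed by a type annotation. *)
Definition sub_space J := g_sigma_algebraType (cylinder J).

Lemma sub_space_measurable J (C : set Omega) :
  measurable (C : set (sub_space J)) -> measurable C.
Proof.
apply: smallest_sub; first exact: sigma_algebra_measurable.
exact: cylinder_measurable.
Qed.

Definition to_sub_space J (w : Omega) : sub_space J := w.

Lemma measurable_to_sub_space J : measurable_fun setT (to_sub_space J).
Proof. by move=> _ C mC; rewrite setTI; exact: (@sub_space_measurable J). Qed.

Lemma measurable_sub_space d' (T : measurableType d') J (f : sub_space J -> T) :
  measurable_fun setT f -> measurable_fun [set: Omega] (fun w : Omega => f w).
Proof. by move=> mf; exact: (measurableT_comp mf (@measurable_to_sub_space J)). Qed.

Lemma measurable_sub_space_RV J i : J i ->
  measurable_fun setT (X i : sub_space J -> S).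
Proof.
move=> Ji _ B mB; rewrite setTI; apply: sub_sigma_algebra.
exact: cylinder_preimage.
Qed.

Definition sub_space_id J1 J2 (w : sub_space J2) : sub_space J1 := w.

Lemma sub_spaceS J1 J2 : J1 `<=` J2 ->
  measurable_fun setT (@sub_space_id J1 J2).
Proof.
move=> J12 _ C mC; rewrite setTI; move: C mC.
apply: smallest_sub; first exact: sigma_algebra_measurable.
move=> _ [s [B [us sJ mB ->]]]; apply: sub_sigma_algebra.
by exists s, B; split => // i /sJ /J12.
Qed.

Variables (A : set I) (hX : mutually_independent A X).

Lemma cylinder_indep J1 J2 C1 C2 : J1 `<=` A -> J2 `<=` A ->
  J1 `&` J2 = set0 -> cylinder J1 C1 -> cylinder J2 C2 ->
  P (C1 `&` C2) = (P C1 * P C2)%E.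
Proof.
move=> J1A J2A J120 [s1 [B1 [us1 s1J mB1 ->]]] [s2 [B2 [us2 s2J mB2 ->]]].
have d12 i : i \in s2 -> i \in s1 = false.
  move=> is2; apply/negP => is1; have : (J1 `&` J2) i.
    by split; [exact: s1J|exact: s2J].
  by rewrite J120.
pose B i := if i \in s1 then B1 i else B2 i.
have e1 : \big[setI/setT]_(i <- s1) (X i @^-1` B1 i) =
          \big[setI/setT]_(i <- s1) (X i @^-1` B i).
  by apply: eq_big_seq => i is1; rewrite /B is1.
have e2 : \big[setI/setT]_(i <- s2) (X i @^-1` B2 i) =
          \big[setI/setT]_(i <- s2) (X i @^-1` B i).
  by apply: eq_big_seq => i is2; rewrite /B d12.
have mB i : measurable (B i) by rewrite /B; case: ifP.
rewrite e1 e2 -big_cat/= !hX// ?big_cat//.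
- by move=> i /s2J /J2A.
- by move=> i /s1J /J1A.
- rewrite cat_uniq us1 us2 andbT/=; apply/hasPn => i is2.
  by rewrite /= d12.
- by move=> i; rewrite mem_cat => /orP[/s1J /J1A|/s2J /J2A].
Qed.

Let unique_measure J (m1 m2 : {measure set Omega -> \bar R}) :
    (m1 setT < +oo)%E -> (forall C, cylinder J C -> m1 C = m2 C) ->
  forall C, measurable (C : set (sub_space J)) -> m1 C = m2 C.
Proof.
move=> m1oo m12 C mC.
apply: (@g_sigma_algebra_measure_unique _ _ _ (cylinder J)
  (@cylinder_measurable J) (fun=> setT)) => //.
- by move=> _; exact: cylinderT.
- by apply/seteqP; split => // w _; exists 0%N.
- exact: cylinder_setI.
Qed.

(** Independence of cylinders extends one side at a time: with one event fixed, intersecting with it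
    and scaling by its probability give two finite measures that agree on a pi-system, hence on the
    sigma-algebra it generates. *)
Lemma sub_space_indep J1 J2 C1 C2 : J1 `<=` A -> J2 `<=` A ->
  J1 `&` J2 = set0 -> measurable (C1 : set (sub_space J1)) ->
  measurable (C2 : set (sub_space J2)) ->
  P (C1 `&` C2) = (P C1 * P C2)%E.
Proof.
move=> J1A J2A J120 mC1 mC2.
have PE C : measurable C -> (fine (P C))%:E = P C.
  by move=> mC; rewrite fineK// fin_num_measure.
have P0 C : 0 <= fine (P C) by rewrite fine_ge0.
have Poo (C : set Omega) (mC : measurable C) : (mrestr P mC setT < +oo)%E.
  by rewrite /= /mrestr setTI ltey_eq fin_num_measure.
have mC1' := sub_space_measurable mC1.
have step D2 : cylinder J2 D2 -> P (C1 `&` D2) = (P C1 * P D2)%E.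
  move=> cD2; have mD2 := cylinder_measurable cD2.
  have := @unique_measure J1 (mrestr P mD2) (mscale (NngNum (P0 D2)) P)
    (Poo _ mD2) _ _ mC1.
  rewrite /= /mrestr /mscale/= => ->; first by rewrite PE// muleC.
  by move=> D1 cD1; rewrite PE// muleC; exact: (cylinder_indep J1A J2A).
have := @unique_measure J2 (mrestr P mC1') (mscale (NngNum (P0 C1)) P)
  (Poo _ mC1') _ _ mC2.
rewrite /= /mrestr /mscale/= setIC => ->; first by rewrite PE.
by move=> D2 cD2; rewrite PE// setIC; exact: step.
Qed.

Let id_mixin J := isMeasurableFun.Build _ _ _ _ _ (@measurable_to_sub_space J).
Let id_RV J : {RV P >-> sub_space J} := HB.pack (to_sub_space J) (id_mixin J).

Section fubini.
Variables J1 J2 : set I.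
Hypotheses (J1A : J1 `<=` A) (J2A : J2 `<=` A) (J120 : J1 `&` J2 = set0).
Variable f : sub_space J1 * sub_space J2 -> \bar R.
Hypotheses (mf : measurable_fun setT f) (f0 : forall x, (0 <= f x)%E).

Let diag w : sub_space J1 * sub_space J2 := (to_sub_space J1 w, to_sub_space J2 w).
Let mdiag : measurable_fun setT diag.
Proof. by apply: measurable_fun_pair; exact: measurable_to_sub_space. Qed.
Let diag_mixin := isMeasurableFun.Build _ _ _ _ _ mdiag.
Let diag_RV : {RV P >-> (sub_space J1 * sub_space J2)%type} :=
  HB.pack diag diag_mixin.

(* The diagonal map pushes P forward to the product of its restrictions to
   two independent sigma-algebras. *)
Lemma integral_indep :
  (\int[P]_w f (w, w) = \int[P]_w1 \int[P]_w2 f (w1, w2))%E.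
Proof.
have -> : (\int[P]_w f (w, w) = \int[distribution P diag_RV]_x f x)%E.
  by rewrite ge0_integral_distribution.
pose D1 := distribution P (id_RV J1); pose D2 := distribution P (id_RV J2).
have h B : measurable B -> B `<=` setT ->
    distribution P diag_RV B = (D1 \x D2)%E B.
  move=> mB _; apply/esym; apply: product_measure_unique => // C1 C2 mC1 mC2.
  rewrite /D1 /D2 /distribution /pushforward /=.
  exact: (sub_space_indep J1A J2A).
rewrite (eq_measure_integral (D1 \x D2)%E h) fubini_tonelli1//.
rewrite ge0_integral_distribution//; last first.
- by move=> y; apply: integral_ge0.
- exact: measurable_fun_fubini_tonelli_F.
apply: eq_integral => w _ /=; rewrite /fubini_F ge0_integral_distribution//.
exact: measurableT_comp.
Qed.

(** The substitute for conditioning on the past: the bound on the inner integral is proved for a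
    frozen [w1], so that the past enters only as a constant. *)
Lemma integral_indep_le (g : sub_space J1 -> \bar R) :
    (forall w, 0 <= g w)%E -> measurable_fun setT g ->
    (forall w1, \int[P]_w2 f (w1, w2) <= g w1)%E ->
  (\int[P]_w f (w, w) <= \int[P]_w g w)%E.
Proof.
move=> g0 mg fg; rewrite integral_indep; apply: ge0_le_integral => //.
- by move=> w _; apply: integral_ge0.
- apply: (measurable_sub_space (J := J1)).
  have := @measurable_fun_fubini_tonelli_F _ _ _ _ _
    (distribution P (id_RV J2)) f mf f0.
  apply: eq_measurable_fun => w _ /=.
  by rewrite /fubini_F ge0_integral_distribution//; exact: measurableT_comp.
- exact: (measurable_sub_space mg).
Qed.

End fubini.
End independent_sigma_algebras.

(** * Means and moments of random vectors *)

Section mean.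
Context {R : realType} {dO : measure_display} {Omega : measurableType dO}.
Variable P : probability Omega R.
Implicit Types (X Y : Omega -> R) (m a : R).

(** Integrability and the value of the integral travel together as a relation, so that means are
    computed by linearity without extracting finite parts. *)
Definition has_mean X m :=
  P.-integrable setT (EFin \o X) /\ (\int[P]_w (X w)%:E = m%:E)%E.

Lemma has_mean_measurable X m : has_mean X m -> measurable_fun setT X.
Proof. by move=> [/measurable_int/measurable_EFinP]. Qed.

Lemma has_mean_cst m : has_mean (fun=> m) m.
Proof.
split; first exact: finite_measure_integrable_cst.
by rewrite integral_cst//= probability_setT mule1.
Qed.

Lemma has_meanD X Y m m' : has_mean X m -> has_mean Y m' ->
  has_mean (fun w => X w + Y w) (m + m').
Proof.
move=> [iX XE] [iY YE]; split; first exact: (integrableD measurableT iX iY).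
by under eq_integral do rewrite EFinD; rewrite (integralD measurableT iX iY) XE YE.
Qed.

Lemma has_meanZ a X m : has_mean X m -> has_mean (fun w => a * X w) (a * m).
Proof.
move=> [iX XE]; split; first exact: (integrableZl measurableT a iX).
by under eq_integral do rewrite EFinM; rewrite (integralZl measurableT iX) XE.
Qed.

Lemma has_meanN X m : has_mean X m -> has_mean (fun w => - X w) (- m).
Proof.
move=> /(has_meanZ (-1)); rewrite mulN1r; congr has_mean.
by apply/funext => w; rewrite mulN1r.
Qed.

Lemma has_mean_sum I (s : seq I) (X : I -> Omega -> R) (m : I -> R) :
  (forall i, has_mean (X i) (m i)) ->
  has_mean (fun w => \sum_(i <- s) X i w) (\sum_(i <- s) m i).
Proof.
move=> hX; elim: s => [|i s IHs].
  by rewrite big_nil; under eq_fun do rewrite big_nil; exact: has_mean_cst.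
by rewrite big_cons; under eq_fun do rewrite big_cons; exact: has_meanD.
Qed.

Lemma has_mean_unique X m m' : has_mean X m -> has_mean X m' -> m = m'.
Proof. by move=> [_ XE] [_]; rewrite XE => -[]. Qed.

Lemma integrable_has_mean X : P.-integrable setT (EFin \o X) ->
  has_mean X (fine 'E_P[X]).
Proof.
move=> iX; split => //; rewrite unlock fineK//.
exact: integrable_fin_num.
Qed.

Lemma bounded_moment_has_mean Y (B : R) : (forall w, 0 <= Y w) ->
  measurable_fun setT Y -> (\int[P]_w (Y w)%:E <= B%:E)%E ->
  exists2 b, b <= B & has_mean Y b.
Proof.
move=> Y0 mY YB.
have iY : P.-integrable setT (EFin \o Y).
  apply/integrableP; split; first exact/measurable_EFinP.
  under eq_integral do rewrite /= ger0_norm//.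
  by rewrite (le_lt_trans YB)// ltry.
exists (fine (\int[P]_w (Y w)%:E)%E).
  by rewrite -lee_fin fineK//; exact: integrable_fin_num.
by split => //; rewrite fineK//; exact: integrable_fin_num.
Qed.

(** The linear term enters through its exact mean, with a coefficient of either sign; of [Y] only an
    upper bound on the integral is known, hence [0 <= a2]. *)
Lemma integral_le_affine (f ip Y : Omega -> R) (a0 a1 a2 m B : R) :
  (forall w, 0 <= f w) -> measurable_fun setT f -> has_mean ip m ->
  (forall w, 0 <= Y w) -> measurable_fun setT Y ->
  (\int[P]_w (Y w)%:E <= B%:E)%E -> 0 <= a2 ->
  (forall w, f w <= a0 + a1 * ip w + a2 * Y w) ->
  (\int[P]_w (f w)%:E <= (a0 + a1 * m + a2 * B)%:E)%E.
Proof.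
move=> f0 mf hip Y0 mY YB a20 fle.
have [b bB hY] := bounded_moment_has_mean Y0 mY YB.
have hg := has_meanD (has_meanD (has_mean_cst a0) (has_meanZ a1 hip))
  (has_meanZ a2 hY).
apply: (@le_trans _ _ (a0 + a1 * m + a2 * b)%:E).
  rewrite -(proj2 hg); apply: ge0_le_integral => //.
  - by move=> w _; rewrite lee_fin.
  - exact/measurable_EFinP.
  - by apply/measurable_EFinP; exact: (has_mean_measurable hg).
  - by move=> w _; rewrite lee_fin.
by rewrite lee_fin lerD2l ler_wpM2l.
Qed.

Lemma integral_affine_le (Y : Omega -> R) (a b B : R) :
  (forall w, 0 <= Y w) -> measurable_fun setT Y -> 0 <= a -> 0 <= b ->
  (\int[P]_w (Y w)%:E <= B%:E)%E ->
  (\int[P]_w (a * Y w + b)%:E <= (a * B + b)%:E)%E.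
Proof.
move=> Y0 mY a0 b0 YB.
have := @integral_le_affine (fun w => a * Y w + b) _ Y b 0 a _ B _ _
  (has_mean_cst 0) Y0 mY YB a0.
rewrite mulr0 addr0 [a * B + b]addrC; apply.
- by move=> w; rewrite addr_ge0// mulr_ge0.
- by apply: measurable_funD => //; exact: measurable_funM.
- by move=> w; lra.
Qed.

End mean.

Section vector_mean.
Context {R : realType} {d : nat} {dO : measure_display}.
Context {Omega : measurableType dO}.
Variables (P : probability Omega R) (dot : {dot 'rV[R]_d for idfun}).
Implicit Types (Y : Omega -> 'rV[R]_d) (m u : 'rV[R]_d).

Definition has_vmean Y m := forall i, has_mean P (fun w => Y w 0 i) (m 0 i).

Lemma has_vmean_measurable Y m : has_vmean Y m ->
  measurable_fun setT (Y : Omega -> borel_rV R d).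
Proof. by move=> hY; apply/measurable_rowP => i; exact: has_mean_measurable. Qed.

Lemma has_vmean_cst m : has_vmean (fun=> m) m.
Proof. by move=> i; exact: has_mean_cst. Qed.

Lemma has_vmeanD Y Y' m m' : has_vmean Y m -> has_vmean Y' m' ->
  has_vmean (fun w => Y w + Y' w) (m + m').
Proof.
move=> hY hY' i; rewrite mxE; under eq_fun do rewrite mxE.
exact: has_meanD.
Qed.

Lemma has_vmeanZ a Y m : has_vmean Y m ->
  has_vmean (fun w => a *: Y w) (a *: m).
Proof.
move=> hY i; rewrite mxE; under eq_fun do rewrite mxE.
exact: has_meanZ.
Qed.

Lemma has_vmeanN Y m : has_vmean Y m -> has_vmean (fun w => - Y w) (- m).
Proof.
by move=> hY i; rewrite mxE; under eq_fun do rewrite mxE; exact: has_meanN.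
Qed.

Lemma has_vmeanB Y Y' m m' : has_vmean Y m -> has_vmean Y' m' ->
  has_vmean (fun w => Y w - Y' w) (m - m').
Proof. by move=> hY hY'; apply: has_vmeanD => //; exact: has_vmeanN. Qed.

Lemma has_vmean_sum (I : eqType) (s : seq I) (Y : I -> Omega -> 'rV[R]_d)
    (m : I -> 'rV[R]_d) : (forall i, i \in s -> has_vmean (Y i) (m i)) ->
  has_vmean (fun w => \sum_(i <- s) Y i w) (\sum_(i <- s) m i).
Proof.
elim: s => [_|i s IHs hY].
  by rewrite big_nil; under eq_fun do rewrite big_nil; exact: has_vmean_cst.
rewrite big_cons; under eq_fun do rewrite big_cons.
apply: has_vmeanD; first by apply: hY; rewrite mem_head.
by apply: IHs => j js; apply: hY; rewrite inE js orbT.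
Qed.

Lemma has_vmean_unique Y m m' : has_vmean Y m -> has_vmean Y m' -> m = m'.
Proof.
move=> hY hY'; apply/rowP => i; exact: has_mean_unique (hY i) (hY' i).
Qed.

Lemma vintegrable_has_vmean Y : vintegrable P Y ->
  has_vmean Y (vexpectation P Y).
Proof. by move=> iY i; rewrite mxE; apply: integrable_has_mean; exact: iY. Qed.

Lemma has_vmean_vexpectation Y m : has_vmean Y m -> vexpectation P Y = m.
Proof.
move=> hY; apply: (has_vmean_unique _ hY) => i; rewrite mxE.
by apply: integrable_has_mean; have [] := hY i.
Qed.

Lemma has_mean_dot Y m u : has_vmean Y m ->
  has_mean P (fun w => dot u (Y w)) (dot u m).
Proof.
move=> hY; rewrite dot_row; under eq_fun do rewrite dot_row.
apply: has_mean_sum => i; rewrite mulrC; under eq_fun do rewrite mulrC.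
exact/has_meanZ/hY.
Qed.

Variables (p : R) (hp : 2 <= p).

(** A pointwise replacement for Jensen's inequality: if the [p]-th power has mean at most [t^p],
    integration bounds the second moment by [2 t^2]. All estimates stay affine in the [p]-th
    power. *)
Lemma sqr_le_moment (t x : R) : 0 < t -> 0 <= x ->
  x ^+ 2 <= t ^+ 2 + t ^+ 2 / t `^ p * x `^ p.
Proof.
move=> t0 x0; have h := hp.
have y0 : 0 <= x / t by rewrite divr_ge0// ltW.
have -> : t ^+ 2 / t `^ p * x `^ p = t ^+ 2 * (x / t) `^ p.
  have tV : t^-1 `^ p = (t `^ p)^-1.
    by rewrite -[t^-1]powR_inv1 ?(ltW t0)// -powRrM mulN1r powRN.
  by rewrite powRM ?invr_ge0 ?(ltW t0)// tV; ring.
have -> : x ^+ 2 = t ^+ 2 * (x / t) ^+ 2 by field; rewrite gt_eqF.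
rewrite -[X in X + _]mulr1 -mulrDr ler_pM2l ?exprn_gt0//.
have [y1|/ltW y1] := leP (x / t) 1.
  by rewrite ler_wpDr ?powR_ge0// expr_le1.
by rewrite ler_wpDl// -powR_mulrn// ler_powR.
Qed.

Lemma moment_perturbation : exists2 C : R, 0 < C &
  forall (u : 'rV[R]_d) Y m (t : R), 0 < t -> has_vmean Y m ->
  (\int[P]_w (dnorm dot (Y w) `^ p)%:E <= (t `^ p)%:E)%E ->
  (\int[P]_w (dnorm dot (u + Y w) `^ p)%:E <=
    (dnorm dot u `^ p + p * dnorm dot u `^ (p - 2) * dot u m +
     C * (dnorm dot u `^ (p - 2) * t ^+ 2 + t `^ p))%:E)%E.
Proof.
(* The factor 2 is the one lost in [sqr_le_moment]. *)
have [C C0 hC] := powR_expansion hp; exists (2 * C) => [|u Y m t t0 hY Yt].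
  by rewrite mulr_gt0.
set a := dnorm dot u; set a2 := a `^ (p - 2).
have a20 : 0 <= a2 by exact: powR_ge0.
have tp0 : 0 < t `^ p by exact: powR_gt0.
have mY : measurable_fun setT (fun w => dnorm dot (Y w)).
  exact/measurable_dnorm/(has_vmean_measurable hY).
have mYp : measurable_fun setT (fun w => dnorm dot (Y w) `^ p).
  exact: (measurableT_comp (measurable_powR p) mY).
have mf : measurable_fun setT (fun w => dnorm dot (u + Y w) `^ p).
  apply: (measurableT_comp (measurable_powR p)); apply: measurable_dnorm.
  apply: measurable_rVD; first exact: measurable_cst.
  exact: has_vmean_measurable hY.
have := @integral_le_affine _ _ _ P _ (fun w => dot u (Y w)) _
  (a `^ p + C * (a2 * t ^+ 2)) (p * a2) (C * (a2 * (t ^+ 2 / t `^ p) + 1))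
  _ (t `^ p) (fun w => powR_ge0 _ _) mf (has_mean_dot u hY)
  (fun w => powR_ge0 _ _) mYp Yt.
move=> H; apply: (le_trans (H _ _)).
- by rewrite mulr_ge0// ?(ltW C0)// addr_ge0// mulr_ge0// divr_ge0 ?sqr_ge0 ?ltW.
- move=> w; rewrite (le_trans (hC a (dnorm dot (Y w)) (dot u (Y w)) _ _ _ _ _ _))//;
    rewrite ?dnorm_ge0 ?cauchy_schwarz// ?sqr_dnormD//.
  have /(ler_wpM2l a20) := sqr_le_moment t0 (dnorm_ge0 dot (Y w)).
  move=> /(ler_wpM2l (ltW C0)); rewrite -/a -/a2.
  move: (dnorm dot (Y w) ^+ 2) (dnorm dot (Y w) `^ p) (t ^+ 2) (t `^ p) => x y z v.
  lra.
- rewrite lee_fin; have -> : C * (a2 * (t ^+ 2 / t `^ p) + 1) * t `^ p =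
    C * (a2 * t ^+ 2) + C * t `^ p by field; rewrite gt_eqF.
  have : 0 <= C * t `^ p by rewrite mulr_ge0 ?ltW.
  lra.
Qed.

End vector_mean.

(** * Moments of sums of independent centred vectors *)

Section marcinkiewicz_zygmund.
Context {R : realType} {d : nat} {dO dS : measure_display}.
Context {Omega : measurableType dO} {S : measurableType dS}.
Variables (P : probability Omega R) (dot : {dot 'rV[R]_d for idfun}).
Variables (I : choiceType) (X : I -> {RV P >-> S}) (A : set I).
Hypothesis hX : mutually_independent A X.
Variables (p : R) (hp : 2 <= p).

(** Summands are added one at a time. For a centred summand the linear term of the expansion
    vanishes, and with [w0 = t i ^ 2 / tau ^ 2] Young's inequality bounds the remainder by [2 C w0]
    times [|T|^p + tau^p]. The weights add up to at most 1, whence a constant independent of the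
    number of summands. *)
Lemma moment_indep_sum : exists2 B : R, 0 < B &
  forall (s : seq I) (y : I -> S -> 'rV[R]_d) (t : I -> R) (tau : R),
  uniq s -> (forall i, i \in s -> A i) -> 0 < tau ->
  (forall i, measurable_fun setT (y i : S -> borel_rV R d)) ->
  (forall i, i \in s -> 0 < t i) ->
  (forall i, i \in s -> has_vmean P (fun w => y i (X i w)) 0) ->
  (forall i, i \in s ->
    (\int[P]_w (dnorm dot (y i (X i w)) `^ p)%:E <= (t i `^ p)%:E)%E) ->
  \sum_(i <- s) t i ^+ 2 <= tau ^+ 2 ->
  (\int[P]_w (dnorm dot (\sum_(i <- s) y i (X i w)) `^ p)%:E <=
    (B * tau `^ p)%:E)%E.
Proof.
have [C C0 hC] := moment_perturbation P dot hp.
exists (expR (2 * C)) => [|s y t tau us sA tau0 my t0 y0 yt tsum].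
  exact: expR_gt0.
have h2p := hp; have taup0 : 0 < tau `^ p by exact: powR_gt0.
pose W (s' : seq I) := \sum_(i <- s') t i ^+ 2 / tau ^+ 2.
have tle i : i \in s -> t i <= tau.
  move=> si; rewrite -(@ler_pXn2r _ 2)// ?nnegrE ?(ltW (t0 _ si)) ?(ltW tau0)//.
  rewrite (le_trans _ tsum)// (big_rem i)//= lerDl; apply: sumr_ge0 => j _.
  exact: sqr_ge0.
(* The term [- 1] makes the induction close: the moment plus [tau^p] is multiplied by at most
   [1 + 2 C w0 <= expR (2 C w0)] at each summand. *)
suff H s' : uniq s' -> {subset s' <= s} ->
    (\int[P]_w (dnorm dot (\sum_(i <- s') y i (X i w)) `^ p)%:E <=
    ((expR (2 * C * W s') - 1) * tau `^ p)%:E)%E.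
  apply: (le_trans (H _ us (fun i si => si))).
  rewrite lee_fin ler_wpM2r ?(ltW taup0)//.
  rewrite lerBlDr ler_wpDr// ler_expR -[leRHS]mulr1 ler_wpM2l//.
    by rewrite mulr_ge0// ltW.
  by rewrite /W -mulr_suml ler_pdivrMr ?exprn_gt0// mul1r.
elim: s' => [_ _|i s' IH /= /andP[is' us'] ss].
  rewrite /W big_nil mulr0 expR0 subrr mul0r; under eq_integral.
    move=> w _; rewrite big_nil dnorm0 powR0; last by rewrite gt_eqF//; lra.
    over.
  by rewrite integral0.
have si : i \in s by apply: ss; rewrite mem_head.
have ss' : {subset s' <= s} by move=> j js'; apply: ss; rewrite inE js' orbT.
have {}IH := IH us' ss'.
pose J1 := [set j | j \in s']; pose J2 := [set i].
pose T w := \sum_(j <- s') y j (X j w).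
have mT : measurable_fun setT (T : sub_space X J1 -> borel_rV R d).
  apply: measurable_rV_sum => j js'; apply: measurableT_comp => //.
  exact: measurable_sub_space_RV.
have mi : measurable_fun setT (fun w : sub_space X J2 => y i (X i w) : borel_rV R d).
  by apply: measurableT_comp => //; exact: measurable_sub_space_RV.
set w0 := t i ^+ 2 / tau ^+ 2.
have w00 : 0 <= w0 by rewrite divr_ge0// sqr_ge0.
have w01 : w0 <= 1.
  by rewrite /w0 ler_pdivrMr ?exprn_gt0// mul1r lerXn2r ?nnegrE ?(ltW tau0)
    ?(ltW (t0 _ si)) ?tle.
have ti2 : t i ^+ 2 = w0 * tau ^+ 2 by rewrite /w0 divfK// gt_eqF// exprn_gt0.
have tip : t i `^ p <= w0 * tau `^ p.
  rewrite -(powR_mulB2 hp (ltW (t0 _ si))) -(powR_mulB2 hp (ltW tau0)) ti2.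
  rewrite mulrCA ler_wpM2l// ler_wpM2r ?sqr_ge0//.
  by apply: ler_powR2r; [lra|exact/ltW/t0|exact: tle].
have mTp : measurable_fun setT (fun w : sub_space X J1 => dnorm dot (T w) `^ p).
  by apply: (measurableT_comp (measurable_powR p)); exact: measurable_dnorm.
have a0 : 0 <= 2 * C * w0 by rewrite mulr_ge0// mulr_ge0// ltW.
have step := @integral_indep_le _ _ _ _ _ P I X A hX J1 J2 _ _ _
  (fun x => (dnorm dot (T x.1 + y i (X i x.2)) `^ p)%:E) _ _
  (fun w => ((1 + 2 * C * w0) * dnorm dot (T w) `^ p + 2 * C * w0 * tau `^ p)%:E).
rewrite (eq_integral (fun w => (dnorm dot (T w + y i (X i w)) `^ p)%:E)); last first.
  by move=> w _; rewrite big_cons addrC.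
apply: (le_trans (step _ _ _ _ _ _ _ _)).
- by move=> j js'; exact/sA/ss'.
- by move=> _ ->; exact: sA.
- by apply/seteqP; split => // j [/= js' ji]; move: is'; rewrite -ji js'.
- apply/measurable_EFinP; apply: (measurableT_comp (measurable_powR p)).
  apply: measurable_dnorm; apply: measurable_rVD.
    exact: (measurableT_comp mT measurable_fst).
  exact: (measurableT_comp mi measurable_snd).
- by move=> x; rewrite lee_fin powR_ge0.
- move=> w; rewrite lee_fin addr_ge0// mulr_ge0 ?powR_ge0//; lra.
- apply/measurable_EFinP; apply: measurable_funD => //.
  by apply: measurable_funM.
- move=> w1 /=; apply: (le_trans (hC (T w1) _ _ (t i) (t0 _ si) (y0 _ si) (yt _ si))).
  rewrite dotC dot0l mulr0 addr0.
  rewrite lee_fin ti2.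
  have /(ler_wpM2l w00) := young2 hp (dnorm_ge0 dot (T w1)) (ltW tau0).
  move: tip; move: (dnorm dot (T w1)) => x.
  move=> h1 h2; have : C * (x `^ (p - 2) * (w0 * tau ^+ 2) + t i `^ p) <=
    C * (w0 * (x `^ p + tau `^ p) + w0 * tau `^ p).
    by rewrite ler_wpM2l ?(ltW C0)// lerD// mulrCA.
  have : 0 <= C * (w0 * x `^ p) by rewrite mulr_ge0 ?(ltW C0)// mulr_ge0// powR_ge0.
  lra.
- have mTp' : measurable_fun setT (fun w : Omega => dnorm dot (T w) `^ p).
    exact: (measurable_sub_space mTp).
  apply: (le_trans (integral_affine_le (fun w => powR_ge0 _ _) mTp' _ _ IH)).
  + lra.
  + by rewrite mulr_ge0// ltW.
  rewrite lee_fin.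
  have -> : W (i :: s') = w0 + W s' by rewrite /W big_cons.
  rewrite mulrDr expRD.
  have := expR_ge1Dx (2 * C * w0) => /(ler_wpM2r (expR_ge0 (2 * C * W s'))).
  move=> /(ler_wpM2r (ltW taup0)).
  by move: (expR (2 * C * W s')) (expR (2 * C * w0)) (tau `^ p) => x z v; lra.
Qed.

End marcinkiewicz_zygmund.

(** * The multilevel estimator *)

Section same_law.
Context {R : realType} {dO dS : measure_display}.
Context {Omega : measurableType dO} {S : measurableType dS}.
Variables (P : probability Omega R) (X Y : {RV P >-> S}).
Hypothesis XY : same_distribution X Y.

Lemma same_law_integral (h : S -> \bar R) : measurable_fun setT h ->
  (forall u, 0 <= h u)%E -> (\int[P]_w h (X w) = \int[P]_w h (Y w))%E.
Proof.
move=> mh h0; rewrite -(@ge0_integral_distribution _ _ _ _ _ P X h)//.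
rewrite -(@ge0_integral_distribution _ _ _ _ _ P Y h)//.
by apply: eq_measure_integral => A mA _; exact: XY.
Qed.

Lemma same_law_mean (h : S -> R) (m : R) : measurable_fun setT h ->
  has_mean P (fun w => h (Y w)) m -> has_mean P (fun w => h (X w)) m.
Proof.
move=> mh [iY YE]; have mEh : measurable_fun setT (EFin \o h).
  exact/measurable_EFinP.
have iX : P.-integrable setT (fun w => (h (X w))%:E).
  apply/integrableP; split.
    by apply/measurable_EFinP; apply: measurableT_comp.
  move/integrableP : iY => [_].
  rewrite (@same_law_integral (fun u => `|(h u)%:E|%E))//.
  exact: measurableT_comp.
split => //; rewrite -YE.
rewrite -(@integral_distribution _ _ _ _ _ P X (EFin \o h))//.
rewrite -(@integral_distribution _ _ _ _ _ P Y (EFin \o h))//.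
by apply: eq_measure_integral => A mA _; exact: XY.
Qed.

End same_law.

(** * Geometric sums over levels *)

Section geometric_sums.
Context {R : realType}.

Lemma geometric_sum_gt1 (q : R) m : 1 < q ->
  \sum_(1 <= k < m.+1) q ^+ k <= q / (q - 1) * q ^+ m.
Proof.
move=> q1; have q10 : 0 < q - 1 by rewrite subr_gt0.
elim: m => [|m IH]; first by rewrite big_geq// expr0 mulr1 divr_ge0//; lra.
rewrite big_nat_recr//= exprS; apply: (le_trans (lerD IH (lexx _))).
rewrite le_eqVlt; apply/orP; left; apply/eqP.
by field; rewrite gt_eqF.
Qed.

Lemma geometric_sum_lt1 (q : R) m : 0 < q -> q < 1 ->
  \sum_(1 <= k < m.+1) q ^+ k <= q / (1 - q).
Proof.
move=> q0 q1; have q10 : 0 < 1 - q by rewrite subr_gt0.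
have : \sum_(1 <= k < m.+1) q ^+ k <= q / (1 - q) * (1 - q ^+ m).
  elim: m => [|m IH]; first by rewrite big_geq// expr0 subrr mulr0.
  rewrite big_nat_recr//= exprS; apply: (le_trans (lerD IH (lexx _))).
  rewrite le_eqVlt; apply/orP; left; apply/eqP.
  by field; rewrite gt_eqF.
move/le_trans; apply; rewrite ler_piMr// ?gerBl ?exprn_ge0 ?ltW//.
by rewrite divr_gt0.
Qed.

(** The factor of [repl_factor] that depends on the level. It is the order of growth of the sum of
    [M^(k (1/2 - beta))] over [1 <= k <= m]: geometric, linear or bounded according to the sign of
    [1/2 - beta]. *)
Definition level_weight (M beta : R) (m : nat) : R :=
  if beta == 2^-1 then m%:R else M `^ (m%:R * Num.max (2^-1 - beta) 0).

Lemma powR_natM (M e : R) k : M `^ (k%:R * e) = (M `^ e) ^+ k.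
Proof. by rewrite mulrC powRrM powR_mulrn// powR_ge0. Qed.

Lemma powR_gt1 (M e : R) : 1 < M -> 0 < e -> 1 < M `^ e.
Proof.
move=> M1 e0; rewrite /powR gt_eqF ?(lt_trans _ M1)// expR_gt1.
by rewrite mulr_gt0// ln_gt0.
Qed.

Lemma level_sum_le (M beta : R) : 1 < M -> exists2 K : R, 0 < K &
  forall m, \sum_(1 <= k < m.+1) M `^ (k%:R * (2^-1 - beta)) <=
    K * level_weight M beta m.
Proof.
move=> M1; rewrite /level_weight; have M0 : 0 < M by lra.
case: eqVneq => [->|bh].
  exists 1 => // m; under eq_bigr do rewrite subrr mulr0 powRr0.
  by rewrite big_const_nat subn1 iter_addr_0/= mul1r.
have [b2|b2] := ltP beta 2^-1.
  have q1 : 1 < M `^ (2^-1 - beta).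
    by rewrite powR_gt1// subr_gt0.
  set q := M `^ _ in q1; exists (q / (q - 1)).
    by rewrite divr_gt0 ?subr_gt0// (lt_trans _ q1).
  move=> m; under eq_bigr do rewrite powR_natM.
  rewrite max_l; last by rewrite subr_ge0 ltW.
  by rewrite powR_natM geometric_sum_gt1.
have {}b2 : 2^-1 < beta by rewrite lt_neqAle eq_sym bh b2.
have q1 : M `^ (2^-1 - beta) < 1.
  by rewrite -opprB powRN invf_lt1 ?powR_gt0// powR_gt1// subr_gt0.
have q0 : 0 < M `^ (2^-1 - beta) by rewrite powR_gt0.
set q := M `^ _ in q1 q0; exists (q / (1 - q)).
  by rewrite divr_gt0 ?subr_gt0.
move=> m; under eq_bigr do rewrite powR_natM.
rewrite max_r; last by rewrite subr_le0 ltW.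
rewrite mulr0 powRr0 mulr1.
exact: geometric_sum_lt1.
Qed.

Lemma level_weight_gt0 (M beta : R) m : 0 < M -> (0 < m)%N ->
  0 < level_weight M beta m.
Proof.
by move=> M0 m0; rewrite /level_weight; case: ifP; rewrite ?ltr0n ?powR_gt0.
Qed.

End geometric_sums.

Section levels.
Context {R : realType} {d : nat}.
Variables (Gamma1 Gamma2 : 'rV[R]_d -> R) (M alpha beta : R).
Variables (eps sigma : nat -> R).
Hypotheses (hM : 1 < M) (halpha : 0 < alpha).

Let M0 : 0 < M. Proof. exact: lt_trans hM. Qed.
Let m := max_level Gamma2 M alpha eps.
Let x n theta := alpha^-1 * (ln (Gamma2 theta / eps n) / ln M).

Let max_levelE n theta :
  (m n theta)%:R = (Num.max (1 : int) (Num.ceil (x n theta)))%:~R :> R.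
Proof. by rewrite natr_absz ger0_norm// le_max. Qed.

Lemma max_level_gt0 n theta : (0 < m n theta)%N.
Proof. by rewrite absz_gt0 gt_eqF// lt_max. Qed.

Lemma max_level_ge n theta : x n theta <= (m n theta)%:R.
Proof.
rewrite max_levelE (le_trans (ceil_ge _))// ler_int.
by rewrite le_max lexx orbT.
Qed.

Lemma max_level_le n theta : (m n theta)%:R <= 1 + Num.max 0 (x n theta).
Proof.
rewrite max_levelE; have /andP[+ _] := ceil_itv (x n theta).
rewrite intrB => h.
have [h1|h1] := leP (1 : int) (Num.ceil (x n theta)).
  apply: (@le_trans _ _ (1 + x n theta)).
    by move: h; move: (x n theta) ((Num.ceil _)%:~R : R) => a b; lra.
  by rewrite lerD2l le_max lexx orbT.
by rewrite lerDl le_max lexx.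
Qed.

Lemma powR_max_level n theta : 0 < Gamma2 theta -> 0 < eps n ->
  Gamma2 theta * M `^ (- ((m n theta)%:R * alpha)) <= eps n.
Proof.
move=> G0 e0; have lM : 0 < ln M by exact: ln_gt0.
have M0' := M0.
rewrite powRN ler_pdivrMr ?powR_gt0// mulrC -ler_pdivrMr//.
rewrite -[leLHS]lnK ?posrE ?divr_gt0// /powR gt_eqF// ler_expR.
rewrite -ler_pdivrMr// [leRHS]mulrC -ler_pdivrMl//.
exact: max_level_ge.
Qed.

Lemma repl_factorE n theta : repl_factor Gamma1 Gamma2 M alpha beta eps sigma n theta =
  (Gamma1 theta / sigma n) ^+ 2 * level_weight M beta (m n theta).
Proof. by []. Qed.

Let N := repl Gamma1 Gamma2 M alpha beta eps sigma.
Let kappa := repl_factor Gamma1 Gamma2 M alpha beta eps sigma.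

Variables (n : nat) (theta : 'rV[R]_d).
Hypotheses (G1 : 0 < Gamma1 theta) (sn : 0 < sigma n).

Lemma repl_factor_gt0 : 0 < kappa n theta.
Proof.
rewrite /kappa repl_factorE mulr_gt0 ?exprn_gt0 ?divr_gt0//.
by rewrite level_weight_gt0 ?max_level_gt0 ?M0.
Qed.

Let replE k : (N n k theta)%:R =
  (Num.ceil (kappa n theta * M `^ (- (k%:R * (beta + 2^-1)))))%:~R :> R.
Proof.
rewrite natr_absz ger0_norm// ceil_ge0 (@lt_trans _ _ 0) ?ltrN10//.
by rewrite mulr_gt0 ?repl_factor_gt0 ?powR_gt0 ?M0.
Qed.

Lemma repl_ge k :
  kappa n theta * M `^ (- (k%:R * (beta + 2^-1))) <= (N n k theta)%:R.
Proof. by rewrite replE ceil_ge. Qed.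

Lemma repl_le k :
  (N n k theta)%:R <= kappa n theta * M `^ (- (k%:R * (beta + 2^-1))) + 1.
Proof.
by rewrite replE; have /andP[+ _] := ceil_itv (kappa n theta * M `^ (- (k%:R * (beta + 2^-1))));
  rewrite intrB; lra.
Qed.

Lemma repl_gt0 k : (0 < N n k theta)%N.
Proof.
rewrite -(ltr0n R) (lt_le_trans _ (repl_ge k))//.
by rewrite mulr_gt0 ?repl_factor_gt0 ?powR_gt0 ?M0.
Qed.

(** By the lower bound on the replication numbers, level [k] contributes at most [Gamma1^2 / kappa]
    times [M^(k (1/2 - beta))]. The sum over levels is of order [level_weight], exactly the factor
    built into [kappa], and [sigma n ^ 2] remains. *)
Lemma variance_sum_le (K : R) : 0 < K ->
  (forall m, \sum_(1 <= k < m.+1) M `^ (k%:R * (2^-1 - beta)) <=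
    K * level_weight M beta m) ->
  \sum_(1 <= k < (m n theta).+1)
     (Gamma1 theta * M `^ (- (k%:R * beta))) ^+ 2 / (N n k theta)%:R <=
  K * sigma n ^+ 2.
Proof.
move=> K0 hK; have M0' := M0.
have W0 := @level_weight_gt0 _ M beta _ M0 (max_level_gt0 n theta).
apply: (@le_trans _ _ (\sum_(1 <= k < (m n theta).+1)
   Gamma1 theta ^+ 2 / kappa n theta * M `^ (k%:R * (2^-1 - beta)))).
  apply: ler_sum => k _.
  rewrite ler_pdivrMr ?ltr0n ?repl_gt0//.
  have /(ler_wpM2l (_ : 0 <= Gamma1 theta ^+ 2 / kappa n theta *
    M `^ (k%:R * (2^-1 - beta)))) := repl_ge k.
  rewrite mulr_ge0 ?powR_ge0 ?divr_ge0 ?sqr_ge0 ?(ltW repl_factor_gt0)//.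
  move=> /(_ isT); apply: le_trans.
  have -> : Gamma1 theta ^+ 2 / kappa n theta * M `^ (k%:R * (2^-1 - beta)) *
    (kappa n theta * M `^ (- (k%:R * (beta + 2^-1)))) = Gamma1 theta ^+ 2 *
    (M `^ (k%:R * (2^-1 - beta)) * M `^ (- (k%:R * (beta + 2^-1)))).
    by field; rewrite gt_eqF// repl_factor_gt0.
  rewrite -powR_gtD// exprMn -(powR_mulrn 2 (powR_ge0 M _)) -powRrM.
  rewrite ler_wpM2l ?sqr_ge0// le_eqVlt; apply/orP; left; apply/eqP.
  by congr (_ `^ _); field.
rewrite -mulr_sumr; apply: (le_trans (ler_wpM2l _ (hK _))).
  by rewrite divr_ge0 ?sqr_ge0 ?(ltW repl_factor_gt0).
rewrite /kappa repl_factorE le_eqVlt; apply/orP; left; apply/eqP.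
by field; rewrite !gt_eqF.
Qed.

End levels.

Lemma measurable_le_cst (R : realType) d (T : measurableType d) (f : T -> R)
    (c : R) : measurable_fun setT f -> measurable [set x | f x <= c].
Proof.
move=> mf; rewrite (_ : [set x | f x <= c] = setT `&` f @^-1` [set` `]-oo, c]]).
  exact: mf.
by apply/seteqP; split => x /=; rewrite in_itv/= => // -[].
Qed.

(** * Measurability of the estimator in its random parameter *)

Section estimator_measurable.
Context {R : realType} {d : nat} {dS : measure_display} {S : measurableType dS}.
Variables (D : set 'rV[R]_d) (hD : closed D).
Variable Fk : nat -> 'rV[R]_d -> S -> 'rV[R]_d.
Hypothesis hFk0 : forall theta u, Fk 0%N theta u = 0.
Hypothesis hFkmeas : forall k, (0 < k)%N -> product_measurable D (Fk k).
Variables (Gamma1 Gamma2 : 'rV[R]_d -> R) (M alpha beta : R).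
Hypotheses
  (hG1meas : measurable_fun (D : set (borel_rV R d)) (Gamma1 : borel_rV R d -> R))
  (hG2meas : measurable_fun (D : set (borel_rV R d)) (Gamma2 : borel_rV R d -> R))
  (hG1pos : forall theta, D theta -> 0 < Gamma1 theta)
  (hM : 1 < M) (halpha : 0 < alpha).
Variables eps sigma : nat -> R.
Context {dT : measure_display} {T : measurableType dT}.
Variable t : T -> 'rV[R]_d.
Hypotheses (mt : measurable_fun setT (t : T -> borel_rV R d)) (tD : forall x, D (t x)).

Lemma measurable_comp_domain (g : 'rV[R]_d -> R) :
  measurable_fun (D : set (borel_rV R d)) (g : borel_rV R d -> R) ->
  measurable_fun setT (fun x => g (t x)).
Proof.
move=> mg; apply: (@measurable_comp _ _ _ T (borel_rV R d) R D g setT t) => //.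
  exact: closed_borel_rV.
by move=> _ [x _ <-]; exact: tD.
Qed.

Lemma measurable_Fk k (v : T -> S) : measurable_fun setT v ->
  measurable_fun setT (fun x => Fk k (t x) (v x) : borel_rV R d).
Proof.
move=> mv; case: k => [|k].
  by under eq_fun do rewrite hFk0; exact: measurable_cst.
apply: (@measurable_comp _ _ _ T (borel_rV R d * S)%type (borel_rV R d)
  (D `*` setT) (fun x => Fk k.+1 x.1 x.2) setT (fun x => (t x, v x))).
- by apply: measurableX => //; exact: closed_borel_rV.
- by move=> _ [x _ <-]; split => //=.
- exact: hFkmeas.
- exact: measurable_fun_pair.
Qed.

Lemma measurable_max_level n :
  measurable_fun setT (fun x => max_level Gamma2 M alpha eps n (t x)).
Proof.
apply: measurable_fun_nat_le => j.
pose y x := alpha^-1 * (ln (Gamma2 (t x) / eps n) / ln M).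
have my : measurable_fun setT y.
  apply: measurable_funM => //; apply: measurable_funM => //.
  apply: (measurableT_comp (@measurable_ln R)); apply: measurable_funM => //.
  exact: measurable_comp_domain.
case: j => [|j].
  rewrite [X in measurable X](_ : _ = set0)//; apply/seteqP; split => // x /=.
  by rewrite leqNgt max_level_gt0.
rewrite [X in measurable X](_ : _ = [set x | y x <= j.+1%:R]).
  exact: measurable_le_cst.
apply/seteqP; split => x /=; rewrite /max_level -/(y x) -lez_nat.
  by rewrite gez0_abs ?le_max// ge_max => /andP[_]; rewrite ceil_le_int.
by rewrite gez0_abs ?le_max// ge_max ceil_le_int.
Qed.

Let kappa n x := repl_factor Gamma1 Gamma2 M alpha beta eps sigma n (t x).

Lemma measurable_repl_factor n : measurable_fun setT (kappa n).
Proof.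
apply: measurable_funM.
  apply: measurable_funX; apply: measurable_funM => //.
  exact: measurable_comp_domain.
exact: (@measurableT_comp _ _ _ _ _ _ (level_weight M beta) setT _ _ (measurable_max_level n)).
Qed.

Lemma measurable_repl n k : 0 < sigma n ->
  measurable_fun setT (fun x => repl Gamma1 Gamma2 M alpha beta eps sigma n k (t x)).
Proof.
move=> sn; apply: measurable_fun_nat_le => j.
pose y x := kappa n x * M `^ (- (k%:R * (beta + 2^-1))).
have my : measurable_fun setT y.
  by apply: measurable_funM => //; exact: measurable_repl_factor.
rewrite [X in measurable X](_ : _ = [set x | y x <= j%:R]).
  exact: measurable_le_cst.
have y0 x : 0 < y x.
  by rewrite mulr_gt0 ?powR_gt0 ?repl_factor_gt0 ?hG1pos// (lt_trans _ hM).
by apply/seteqP; split => x /=; rewrite /repl -/(y x) -lez_nat;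
  rewrite gez0_abs ?ceil_ge0 ?(lt_trans _ (y0 x)) ?ltrN10// ceil_le_int.
Qed.

(** The source space and the array [v] are arbitrary, so that a parameter from the past and
    simulations from an independent coordinate of a product space are covered too. *)
Lemma measurable_ml_estimator n (v : nat -> nat -> nat -> T -> S) : 0 < sigma n ->
  (forall k l, (0 < k)%N -> (0 < l)%N -> measurable_fun setT (v n k l)) ->
  measurable_fun setT (fun x =>
    ml_estimator Gamma1 Gamma2 M alpha beta eps sigma Fk v n (t x) x : borel_rV R d).
Proof.
move=> sn mv; rewrite /ml_estimator.
pose a k x := (repl Gamma1 Gamma2 M alpha beta eps sigma n k (t x))%:R^-1 : R.
pose b k x j : 'rV[R]_d := \sum_(1 <= l < j.+1)
  (Fk k (t x) (v n k l x) - Fk k.-1 (t x) (v n k l x)).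
pose g j x : borel_rV R d := \sum_(1 <= k < j.+1) a k x *: b k x
  (repl Gamma1 Gamma2 M alpha beta eps sigma n k (t x)).
apply: (@measurable_fun_nat_family R _ _ T (borel_rV R d) _ g).
  exact: measurable_max_level.
move=> j; apply: measurable_rV_sum => k; rewrite mem_index_iota => /andP[k0 _].
apply: measurable_rVZ.
  exact: (@measurableT_comp _ _ _ _ _ _ (fun j : nat => (j%:R)^-1 : R) setT _ _
    (measurable_repl k sn)).
apply: (@measurable_fun_nat_family R _ _ T (borel_rV R d) _ (fun j x => b k x j)).
  exact: measurable_repl.
move=> {}j; apply: measurable_rV_sum => l; rewrite mem_index_iota => /andP[l0 _].
by apply: measurable_rVB; apply: measurable_Fk; exact: mv.
Qed.

End estimator_measurable.

Section estimator.
Context {R : realType} {d : nat} {dO dS : measure_display}.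
Context {Omega : measurableType dO} {S : measurableType dS}.
Variables (P : probability Omega R) (dot : {dot 'rV[R]_d for idfun}).
Variables (D : set 'rV[R]_d) (hD : closed D) (p : R) (hp : 2 <= p).
Variables (U : {RV P >-> S}) (F : 'rV[R]_d -> S -> 'rV[R]_d).
Variable Fk : nat -> 'rV[R]_d -> S -> 'rV[R]_d.
Hypothesis hFk0 : forall theta u, Fk 0%N theta u = 0.
Hypothesis hFkmeas : forall k, (0 < k)%N -> product_measurable D (Fk k).
Hypothesis hFint : forall theta, D theta -> vintegrable P (fun w => F theta (U w)).
Hypothesis hFkint : forall k theta, (0 < k)%N -> D theta ->
  vintegrable P (fun w => Fk k theta (U w)).
Variables (Gamma1 Gamma2 : 'rV[R]_d -> R) (M alpha beta : R).
Hypotheses (hG1pos : forall theta, D theta -> 0 < Gamma1 theta)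
  (hG2pos : forall theta, D theta -> 0 < Gamma2 theta)
  (hM : 1 < M) (halpha : 0 < alpha).
Hypothesis hi : forall k theta, (0 < k)%N -> D theta ->
  let incr := fun w => Fk k theta (U w) - Fk k.-1 theta (U w) in
  ('E_P[fun w => (dnorm dot (incr w - vexpectation P incr) `^ p)%R] `^ p^-1
    <= (Gamma1 theta * M `^ (- (k%:R * beta)))%:E)%E.
Hypothesis hii : forall k theta, (0 < k)%N -> D theta ->
  dnorm dot (vexpectation P (fun w => Fk k theta (U w) - F theta (U w)))
    <= Gamma2 theta * M `^ (- (k%:R * alpha)).
Variables (eps sigma : nat -> R).
Hypotheses (hsigma : forall n, (0 < n)%N -> 0 < sigma n)
  (heps : forall n, (0 < n)%N -> 0 < eps n).
Variable V : nat -> nat -> nat -> {RV P >-> S}.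
Let A := [set i : nat * nat * nat | [/\ 0 < i.1.1, 0 < i.1.2 & 0 < i.2]%N].
Let X (i : nat * nat * nat) := V i.1.1 i.1.2 i.2.
Hypothesis hVindep : mutually_independent A X.
Hypothesis hVcopy : forall n k l, (0 < n)%N -> (0 < k)%N -> (0 < l)%N ->
  same_distribution (V n k l) U.

Let measurable_Fk_at k theta : D theta ->
  measurable_fun setT (Fk k theta : S -> borel_rV R d).
Proof.
move=> Dt; apply: (@measurable_Fk _ _ _ _ D hD Fk hFk0 hFkmeas _ S (fun=> theta)) => //.
Qed.

Let Z := ml_estimator Gamma1 Gamma2 M alpha beta eps sigma Fk V.

Lemma has_vmean_Fk k theta : D theta -> has_vmean P (fun w => Fk k theta (U w))
  (vexpectation P (fun w => Fk k theta (U w))).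
Proof.
move=> Dt; apply: vintegrable_has_vmean; case: k => [|k]; last exact: hFkint.
by move=> i; under eq_fun do rewrite hFk0 mxE; exact: integrable0.
Qed.

Lemma poweR_inv_le (x : \bar R) (q a : R) : 0 < q -> (0 <= x)%E -> 0 <= a ->
  (x `^ q^-1 <= a%:E)%E -> (x <= (a `^ q)%:E)%E.
Proof.
move=> q0 x0 a0 xa; rewrite -[x]poweRe1// -(@mulVf _ q) ?gt_eqF// poweRrM.
rewrite -poweR_EFin; apply: gt0_ler_poweR => //; first exact: ltW.
- by rewrite in_itv/= poweR_ge0 leey.
- by rewrite in_itv/= lee_fin a0 leey.
Qed.

(** The level differences telescope, so the mean is that of the finest level and its bias is
    controlled by the choice of [max_level]. The centred estimator is a sum of independent vectors,
    to which the moment inequality applies. *)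
Lemma estimator_moments : exists2 B : R, 0 < B & forall n theta,
  (0 < n)%N -> D theta -> exists zbar : 'rV[R]_d,
  [/\ dnorm dot (zbar - vexpectation P (fun w => F theta (U w))) <= eps n,
      has_vmean P (fun w => Z n theta w - zbar) 0 &
      (\int[P]_w (dnorm dot (Z n theta w - zbar) `^ p)%:E <=
        ((B * sigma n) `^ p)%:E)%E].
Proof.
have [B0 B00 hB0] := moment_indep_sum dot hVindep hp.
have [K K0 hK] := level_sum_le beta hM.
have h2p := hp; have p0 : 0 < p by lra.
(* [K] bounds the summed squares by [K * sigma n ^ 2], hence the root; [B0] multiplies a [p]-th
   moment, hence the power [1 / p]. *)
exists (B0 `^ p^-1 * Num.sqrt K) => [|n theta n0 Dt].
  by rewrite mulr_gt0 ?powR_gt0// sqrtr_gt0.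
have G1 := hG1pos Dt; have G2 := hG2pos Dt.
have sn := hsigma n0; have en := heps n0.
pose m := max_level Gamma2 M alpha eps n theta.
pose N k := repl Gamma1 Gamma2 M alpha beta eps sigma n k theta.
have N0 k : 0 < (N k)%:R :> R by rewrite ltr0n repl_gt0.
pose e k := vexpectation P (fun w => Fk k theta (U w)).
pose c k := vexpectation P (fun w => Fk k theta (U w) - Fk k.-1 theta (U w)).
have cE k : c k = e k - e k.-1.
  by apply: has_vmean_vexpectation; apply: has_vmeanB; exact: has_vmean_Fk.
pose zbar := \sum_(1 <= k < m.+1) c k.
have zbarE : zbar = e m.
  rewrite /zbar big_add1/= (eq_bigr (fun k => e k.+1 - e k)); last by move=> k _; rewrite cE.
  rewrite telescope_sumr// (_ : e 0 = 0) ?subr0//; apply: has_vmean_vexpectation.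
  by under eq_fun do rewrite hFk0; exact: has_vmean_cst.
exists zbar.
pose y (i : nat * nat * nat) u : 'rV[R]_d :=
  (N i.1.2)%:R^-1 *: (Fk i.1.2 theta u - Fk i.1.2.-1 theta u - c i.1.2).
(* The double sum over levels and replications is flattened so that its terms are indexed like the
   independent family. *)
pose s := [seq (n, k, l) | k <- index_iota 1 m.+1, l <- index_iota 1 (N k).+1].
have ZE w : Z n theta w - zbar = \sum_(i <- s) y i (X i w).
  rewrite /s big_allpairs_dep/= /Z /ml_estimator -/m /zbar -sumrB.
  apply: eq_bigr => k _; rewrite -/(N k) /y/= -scaler_sumr [in RHS]sumrB scalerBr.
  congr (_ - _); rewrite sumr_const_nat subn1/= -[c k *+ _]scaler_nat scalerA mulVf ?scale1r//.
  by rewrite gt_eqF.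
have sA i : i \in s -> [/\ i.1.1 = n, (0 < i.1.2)%N & (0 < i.2)%N].
  case/allpairsPdep => k [l [+ + ->]]/=; rewrite !mem_index_iota.
  by move=> /andP[k0 _] /andP[l0 _].
have us : uniq s.
  apply: allpairs_uniq_dep.
  - exact: iota_uniq.
  - by move=> k _; exact: iota_uniq.
  - by move=> [k l] [k' l'] _ _ /= [-> ->].
have my i : measurable_fun setT (y i : S -> borel_rV R d).
  apply: measurable_rVZ => //; apply: measurable_rVB; last exact: measurable_cst.
  by apply: measurable_rVB; exact: measurable_Fk_at.
(* Bound on the [p]-norm of a single summand; over the replications of level [k] the squares sum to
   the variance [(Gamma1 theta * M^(- k beta))^2 / N k]. *)
pose t (i : nat * nat * nat) := (N i.1.2)%:R^-1 * (Gamma1 theta * M `^ (- (i.1.2%:R * beta))).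
have M0 : 0 < M by exact: lt_trans hM.
have t0 i : 0 < t i by rewrite mulr_gt0 ?invr_gt0// mulr_gt0// powR_gt0.
have yU i : has_vmean P (fun w => y i (U w)) 0.
  rewrite -(scaler0 _ (N i.1.2)%:R^-1); apply: has_vmeanZ.
  rewrite -(subrr (c i.1.2)); apply: has_vmeanB; last exact: has_vmean_cst.
  by rewrite cE; apply: has_vmeanB; exact: has_vmean_Fk.
split.
- rewrite zbarE /e.
  have <- : vexpectation P (fun w => Fk m theta (U w) - F theta (U w)) =
     vexpectation P (fun w => Fk m theta (U w)) - vexpectation P (fun w => F theta (U w)).
    apply: has_vmean_vexpectation; apply: has_vmeanB; first exact: has_vmean_Fk.
    by apply: vintegrable_has_vmean; exact: hFint.
  apply: (le_trans (hii (max_level_gt0 _ _ _ _ _ _) Dt)).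
  exact: powR_max_level.
- under eq_fun do rewrite ZE.
  suff : has_vmean P (fun w => \sum_(i <- s) y i (X i w))
    (\sum_(i <- s) (0 : 'rV[R]_d)) by rewrite big1.
  apply: (has_vmean_sum (Y := fun i w => y i (X i w)) (m := fun=> 0)).
  move=> i /sA[i1 i2 i3] j.
  apply: (same_law_mean (Y := U) _ (h := fun u => y i u 0 j)).
  + by rewrite /X i1; exact: hVcopy.
  + exact: (proj2 (measurable_rowP _ _) (my i) j).
  + exact: yU.
- under eq_integral do rewrite ZE.
  have tau0 : 0 < Num.sqrt K * sigma n by rewrite mulr_gt0 ?sqrtr_gt0.
  have -> : (B0 `^ p^-1 * Num.sqrt K * sigma n) `^ p = B0 * (Num.sqrt K * sigma n) `^ p.
    rewrite -mulrA powRM ?powR_ge0 ?(ltW tau0)// -powRrM mulVf ?gt_eqF//.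
    by rewrite powRr1// ltW.
  apply: (hB0 s y t) => //.
  + by move=> i /sA[i1 i2 i3]; split => //=; rewrite i1.
  + move=> i /sA[i1 i2 i3] j.
    apply: (same_law_mean (Y := U) _ (h := fun u => y i u 0 j)).
    * by rewrite /X i1; exact: hVcopy.
    * exact: (proj2 (measurable_rowP _ _) (my i) j).
    * exact: yU.
  + move=> i /sA[i1 i2 i3].
    rewrite (same_law_integral (Y := U) _ (h := fun u => (dnorm dot (y i u) `^ p)%:E)).
    * have Ni0 : 0 <= (N i.1.2)%:R^-1 :> R by rewrite invr_ge0 ltW.
      rewrite /t powRM//; last by rewrite mulr_ge0 ?powR_ge0// ltW.
      rewrite -[leRHS]adde0 -EFinD.
      under eq_integral do rewrite /y dnormZ_ge0// powRM ?dnorm_ge0// -[X in X%:E]addr0.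
      apply: integral_affine_le => //.
      - by move=> w; exact: powR_ge0.
      - apply: (measurableT_comp (measurable_powR p)); apply: measurable_dnorm.
        apply: measurable_rVB; last exact: measurable_cst.
        by apply: measurable_rVB; apply: measurableT_comp => //; exact: measurable_Fk_at.
      - apply: poweR_inv_le => //.
        + by apply: integral_ge0 => w _; rewrite lee_fin powR_ge0.
        + by rewrite mulr_ge0 ?powR_ge0// ltW.
        + by have := hi i2 Dt; rewrite unlock.
    * by rewrite /X i1; exact: hVcopy.
    * apply/measurable_EFinP; apply: (measurableT_comp (measurable_powR p)).
      exact: measurable_dnorm.
    * by move=> u; rewrite lee_fin powR_ge0.
  + rewrite exprMn sqr_sqrtr ?(ltW K0)//.
    apply: (@le_trans _ _ (\sum_(1 <= k < m.+1)
      (Gamma1 theta * M `^ (- (k%:R * beta))) ^+ 2 / (N k)%:R)); last first.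
      exact: variance_sum_le.
    rewrite /s big_allpairs_dep/=; apply: ler_sum => k _.
    rewrite /t/= sumr_const_nat subn1/= -[leLHS]mulr_natr exprMn exprVn.
    rewrite le_eqVlt; apply/orP; left; apply/eqP.
    by rewrite -/(N k); field; rewrite gt_eqF.
Qed.

End estimator.

(** * One step of a perturbed recursion *)

Section smoothed_norm.
Context {R : realType} {d : nat}.
Variable dot : {dot 'rV[R]_d for idfun}.
Variable c : R.
Hypothesis c0 : 0 < c.
Implicit Types x y : 'rV[R]_d.

(** For [c > 0] the norm becomes smooth at the origin and stays convex; it exceeds the norm by at
    most [c], and its second derivative is at most [1 / c]. *)
Definition snorm x : R := Num.sqrt (dnorm dot x ^+ 2 + c ^+ 2).

Lemma sqr_snorm x : snorm x ^+ 2 = dnorm dot x ^+ 2 + c ^+ 2.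
Proof. by rewrite sqr_sqrtr// addr_ge0 ?sqr_ge0. Qed.

Lemma snorm_ge0 x : 0 <= snorm x.
Proof. exact: sqrtr_ge0. Qed.

Lemma snorm_gec x : c <= snorm x.
Proof.
rewrite -(@ler_pXn2r _ 2)// ?nnegrE ?snorm_ge0 ?(ltW c0)// sqr_snorm.
by rewrite lerDr sqr_ge0.
Qed.

Lemma snorm_gt0 x : 0 < snorm x.
Proof. exact: lt_le_trans (snorm_gec x). Qed.

Lemma snorm_ge_dnorm x : dnorm dot x <= snorm x.
Proof.
rewrite -(@ler_pXn2r _ 2)// ?nnegrE ?snorm_ge0 ?dnorm_ge0// sqr_snorm.
by rewrite lerDl sqr_ge0.
Qed.

Lemma snorm_le x : snorm x <= dnorm dot x + c.
Proof.
rewrite -(@ler_pXn2r _ 2)// ?nnegrE ?snorm_ge0 ?addr_ge0 ?dnorm_ge0 ?(ltW c0)//.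
rewrite sqr_snorm; have := mulr_ge0 (dnorm_ge0 dot x) (ltW c0); nra.
Qed.

Lemma snorm_homo x y : dnorm dot x <= dnorm dot y -> snorm x <= snorm y.
Proof.
move=> xy; rewrite -(@ler_pXn2r _ 2)// ?nnegrE ?snorm_ge0// !sqr_snorm.
by rewrite lerD2r lerXn2r ?nnegrE ?dnorm_ge0.
Qed.

Lemma snorm_distl x y : snorm x <= snorm y + dnorm dot (x - y).
Proof.
rewrite -(@ler_pXn2r _ 2)// ?nnegrE ?addr_ge0 ?snorm_ge0 ?dnorm_ge0//.
have h1 : dnorm dot x <= dnorm dot y + dnorm dot (x - y).
  by rewrite -{1}(subrK y x) addrC dnormD.
have := sqr_snorm x; have := sqr_snorm y; have := snorm_ge_dnorm y.
have := dnorm_ge0 dot (x - y); have := dnorm_ge0 dot x; have := dnorm_ge0 dot y.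
move: h1; move: (dnorm dot x) (dnorm dot y) (dnorm dot (x - y)) (snorm x) (snorm y).
move=> a b e s t h1 b0 a0 e0 bt t2 s2.
have : a ^+ 2 <= (b + e) ^+ 2 by rewrite lerXn2r ?nnegrE ?addr_ge0.
nra.
Qed.

Lemma snorm_dist x y : `|snorm x - snorm y| <= dnorm dot (x - y).
Proof.
rewrite ler_norml; have := snorm_distl x y; have := snorm_distl y x.
by rewrite dnormB_sym; lra.
Qed.

(* Convexity: x / snorm x is a subgradient of the smoothed norm at x. *)
Lemma snormD_ge x y : snorm x + dot x y / snorm x <= snorm (x + y).
Proof.
have sx := snorm_gt0 x.
have -> : snorm x + dot x y / snorm x = (snorm x ^+ 2 + dot x y) / snorm x.
  by field; rewrite gt_eqF.
rewrite ler_pdivrMr//; apply: le_trans (ler_norm _) _.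
rewrite -(@ler_pXn2r _ 2)// ?nnegrE ?mulr_ge0 ?snorm_ge0 ?normr_ge0//.
rewrite real_normK ?num_real// exprMn !sqr_snorm.
have := cauchy_schwarz dot x (x + y); rewrite dotDr -sqr_dnorm ler_norml.
set a := dnorm dot x; set b := dnorm dot (x + y); set e := dot x y.
move=> /andP[h1 h2]; have a0 : 0 <= a by exact: dnorm_ge0.
have b0 : 0 <= b by exact: dnorm_ge0.
have : (a ^+ 2 + e) ^+ 2 <= (a * b) ^+ 2.
  by rewrite -real_normK ?num_real// lerXn2r ?nnegrE ?mulr_ge0// ler_norml h1 h2.
have : 2 * c ^+ 2 * (a ^+ 2 + e) <= 2 * c ^+ 2 * (a * b).
  by rewrite ler_wpM2l// mulr_ge0// sqr_ge0.
have : 0 <= c ^+ 2 * (a - b) ^+ 2 by rewrite mulr_ge0 ?sqr_ge0.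
nra.
Qed.

(** From [sqrt (G^2 + 2 b) <= G + b / G] and [G >= c]. The linear part is that of the subgradient
    inequality, and the remainder is quadratic in [y] uniformly in [x]. *)
Lemma snormD_le x y :
  snorm (x + y) <= snorm x + dot x y / snorm x + dnorm dot y ^+ 2 / (2 * c).
Proof.
have sx := snorm_gt0 x; set G := snorm x in sx *.
pose b := dot x y + dnorm dot y ^+ 2 / 2.
have E : snorm (x + y) ^+ 2 = G ^+ 2 + 2 * b.
  by rewrite !sqr_snorm sqr_dnormD /b; field.
have G2b : 0 <= G ^+ 2 + b.
  by have := sqr_ge0 (snorm (x + y)); rewrite E; have := sqr_ge0 G; nra.
apply: (@le_trans _ _ (G + b / G)).
  have -> : G + b / G = (G ^+ 2 + b) / G by field; rewrite gt_eqF.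
  rewrite -(@ler_pXn2r _ 2)// ?nnegrE ?snorm_ge0 ?divr_ge0 ?(ltW sx)// E.
  rewrite expr_div_n ler_pdivlMr ?exprn_gt0//.
  by have := sqr_ge0 b; nra.
have -> : b / G = dot x y / G + dnorm dot y ^+ 2 / (2 * G).
  by rewrite /b; field; rewrite gt_eqF.
rewrite addrA lerD2l ler_wpM2l ?sqr_ge0// lef_pV2 ?posrE ?mulr_gt0//.
by rewrite ler_pM2l// snorm_gec.
Qed.

End smoothed_norm.

(** * Effect of one perturbed step on moments and on Burkholder's function *)

Section one_step.
Context {R : realType} {d : nat} {dO : measure_display}.
Context {Omega : measurableType dO}.
Variables (P : probability Omega R) (dot : {dot 'rV[R]_d for idfun}).
Variables (p : R) (hp : 2 <= p) (kappa : R) (kappa0 : 0 < kappa).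
Implicit Types (Y : Omega -> 'rV[R]_d) (m x e : 'rV[R]_d).

(** For [p >= 2] and [N >= 1] one has [(sqrt N)^p >= N]: the [p]-th power of the noise, like its
    square, carries at least the factor [1 / N]. *)
Let noise_scale (N tau : R) : 1 <= N -> 0 < tau ->
  let t := kappa * tau / Num.sqrt N in
  [/\ 0 < t, t ^+ 2 = kappa ^+ 2 * tau ^+ 2 / N &
      t `^ p <= kappa `^ p * tau `^ p / N].
Proof.
move=> N1 tau0 t; have h2p := hp; have k0 := kappa0.
have N0 : 0 < N by lra.
have sN : 0 < Num.sqrt N by rewrite sqrtr_gt0.
have t0 : 0 < t by rewrite divr_gt0// mulr_gt0.
split => //; first by rewrite /t expr_div_n exprMn sqr_sqrtr// ltW.
have -> : t `^ p = kappa `^ p * tau `^ p * ((Num.sqrt N) `^ p)^-1.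
  rewrite /t powRM ?invr_ge0 ?(ltW sN) ?mulr_ge0 ?(ltW k0) ?(ltW tau0)//.
  rewrite powRM ?(ltW k0) ?(ltW tau0)//; congr (_ * _).
  by rewrite powR_inv// ltW.
rewrite ler_wpM2l ?mulr_ge0 ?powR_ge0// lef_pV2 ?posrE ?powR_gt0//.
rewrite -powR12_sqrt ?(ltW N0)// -powRrM -[leLHS]powRr1 ?(ltW N0)//.
by apply: ler_powR => //; lra.
Qed.

Lemma lp_step (delta : R) : 0 < delta -> exists2 K : R, 0 < K &
  forall x Y m (N tau : R), 1 <= N -> 0 < tau -> has_vmean P Y m ->
  dnorm dot m <= kappa * tau / N ->
  (\int[P]_w (dnorm dot (Y w) `^ p)%:E <=
    ((kappa * tau / Num.sqrt N) `^ p)%:E)%E ->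
  (\int[P]_w (dnorm dot (x + Y w) `^ p)%:E <=
    ((1 + delta / N) * dnorm dot x `^ p + K / N * tau `^ p)%:E)%E.
Proof.
move=> delta0; have h2p := hp; have k0 := kappa0.
have [C C0 hC] := moment_perturbation P dot hp.
(* The two Young parameters give the linear and the quadratic term each the share [delta / (2 N)] of
   the [p]-th power. *)
pose e1 := delta / (2 * p * kappa).
pose e2 := delta / (2 * C * kappa ^+ 2).
have e10 : 0 < e1 by rewrite divr_gt0// !mulr_gt0//; lra.
have e20 : 0 < e2 by rewrite divr_gt0// !mulr_gt0// exprn_gt0.
have [K1 K10 hK1] := young1_small hp e10.
have [K2 K20 hK2] := young2_small hp e20.
pose K := p * kappa * K1 + C * kappa ^+ 2 * K2 + C * kappa `^ p.
have K0 : 0 < K.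
  by rewrite !addr_gt0// !mulr_gt0// ?exprn_gt0 ?powR_gt0//; lra.
exists K => // x Y m N tau N1 tau0 hY mle Yle.
have [t0 t2 tp] := noise_scale N1 tau0.
set t := kappa * tau / Num.sqrt N in t0 t2 tp Yle.
apply: (le_trans (hC x Y m t t0 hY Yle)); rewrite lee_fin.
set a := dnorm dot x; have a0 : 0 <= a by exact: dnorm_ge0.
have N0 : 0 < N by lra.
have h1 : p * a `^ (p - 2) * dot x m <= (delta / 2 * a `^ p + p * kappa * K1 * tau `^ p) / N.
  apply: (@le_trans _ _ (p * a `^ (p - 2) * (a * (kappa * tau / N)))).
    rewrite ler_wpM2l ?mulr_ge0 ?powR_ge0//; first lra.
    by rewrite (le_trans (dot_le _ _ _))// ler_wpM2l.
  have -> : p * a `^ (p - 2) * (a * (kappa * tau / N)) =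
      p * kappa * (a `^ (p - 1) * tau) / N.
    by rewrite -(powR_mulB21 hp a0); ring.
  rewrite ler_pM2r ?invr_gt0//.
  have /(ler_wpM2l (_ : 0 <= p * kappa)) := hK1 a tau a0 (ltW tau0).
  move=> /(_ ltac:(by rewrite mulr_ge0//; lra)) /le_trans; apply.
  by rewrite /e1 le_eqVlt; apply/orP; left; apply/eqP; field; rewrite !gt_eqF//; lra.
have h2 : C * (a `^ (p - 2) * t ^+ 2) <= (delta / 2 * a `^ p + C * kappa ^+ 2 * K2 * tau `^ p) / N.
  rewrite t2.
  have -> : C * (a `^ (p - 2) * (kappa ^+ 2 * tau ^+ 2 / N)) =
    C * kappa ^+ 2 * (a `^ (p - 2) * tau ^+ 2) / N by ring.
  rewrite ler_pM2r ?invr_gt0//.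
  have /(ler_wpM2l (_ : 0 <= C * kappa ^+ 2)) := hK2 a tau a0 (ltW tau0).
  move=> /(_ ltac:(by rewrite mulr_ge0 ?sqr_ge0// ltW)) /le_trans; apply.
  by rewrite /e2 le_eqVlt; apply/orP; left; apply/eqP; field; rewrite !gt_eqF// exprn_gt0.
have h3 : C * t `^ p <= C * kappa `^ p * tau `^ p / N.
  by rewrite -!mulrA ler_wpM2l ?(ltW C0)// !mulrA.
have -> : (1 + delta / N) * a `^ p + K / N * tau `^ p =
  a `^ p + (delta / 2 * a `^ p + p * kappa * K1 * tau `^ p) / N +
  (delta / 2 * a `^ p + C * kappa ^+ 2 * K2 * tau `^ p) / N +
  C * kappa `^ p * tau `^ p / N by rewrite /K; field; rewrite gt_eqF.
by rewrite mulrDr; lra.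
Qed.

(** [H] will be twice the compensator of a step. Young's inequality brings every product of a power
    of [S] with drift, bias or noise to the common size [Q], so that a single constant accounts for
    the step. *)
Let noise_terms (N c S H : R) : 1 <= N -> 0 < c -> 0 <= S -> 0 <= H ->
  H <= 2 * kappa / N * (S + c) ->
  let t := kappa * c / Num.sqrt N in let Q := (S `^ p + c `^ p) / N in
  [/\ S `^ (p - 1) * H <= 4 * kappa * Q,
      S `^ (p - 1) * (kappa * c / N) <= kappa * Q,
      S `^ (p - 1) * (t ^+ 2 / c) <= kappa ^+ 2 * Q &
      S `^ (p - 2) * t ^+ 2 <= kappa ^+ 2 * Q] /\
  [/\ S `^ (p - 2) * H ^+ 2 <= 16 * kappa ^+ 2 * Q,
      H `^ p <= (4 * kappa) `^ p * Q & t `^ p <= kappa `^ p * Q].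
Proof.
move=> N1 c0 S0 H0 HS t Q.
have h2p := hp; have k0 := kappa0; have N0 : 0 < N by lra.
have [t0 t2 tp] := noise_scale N1 c0; rewrite -/t in t0 t2 tp.
have k20 : 0 < kappa ^+ 2 by rewrite exprn_gt0.
have y1 := young1 hp S0 (ltW c0); have y2 := young2 hp S0 (ltW c0).
have cp0 := powR_ge0 c p; have Sp0 := powR_ge0 S p.
have QE a : a * Q = a / N * (S `^ p + c `^ p) by rewrite /Q; ring.
have aN a : 0 < a -> 0 < a / N by move=> a0; rewrite divr_gt0.
split; split.
- apply: (le_trans (ler_wpM2l (powR_ge0 S (p - 1)) HS)).
  have -> : 4 * kappa * Q = 2 * kappa / N * (2 * (S `^ p + c `^ p)) by rewrite /Q; ring.
  rewrite mulrCA ler_pM2l; last by rewrite aN// mulr_gt0.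
  by rewrite mulrDr powR_mulB1//; lra.
- have -> : S `^ (p - 1) * (kappa * c / N) = kappa / N * (S `^ (p - 1) * c) by ring.
  by rewrite QE ler_pM2l ?aN.
- have -> : S `^ (p - 1) * (t ^+ 2 / c) = kappa ^+ 2 / N * (S `^ (p - 1) * c).
    by rewrite t2; field; rewrite !gt_eqF.
  by rewrite QE ler_pM2l ?aN.
- have -> : S `^ (p - 2) * t ^+ 2 = kappa ^+ 2 / N * (S `^ (p - 2) * c ^+ 2).
    by rewrite t2; ring.
  by rewrite QE ler_pM2l ?aN.
- have HH : H ^+ 2 <= 4 * kappa ^+ 2 / N * (2 * S ^+ 2 + 2 * c ^+ 2).
    apply: (@le_trans _ _ ((2 * kappa / N * (S + c)) ^+ 2)).
      by rewrite lerXn2r ?nnegrE// (le_trans H0).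
    have -> : (2 * kappa / N * (S + c)) ^+ 2 =
      4 * kappa ^+ 2 / N * ((S + c) ^+ 2 / N) by field; rewrite gt_eqF.
    rewrite ler_pM2l; last by rewrite aN// mulr_gt0.
    rewrite ler_pdivrMr//; have e2 := sqr_ge0 (S - c).
    have e3 : 0 <= 2 * S ^+ 2 + 2 * c ^+ 2.
      by have := sqr_ge0 S; have := sqr_ge0 c; lra.
    apply: (@le_trans _ _ (2 * S ^+ 2 + 2 * c ^+ 2)); first nra.
    by rewrite -[leLHS]mulr1 ler_wpM2l.
  apply: (le_trans (ler_wpM2l (powR_ge0 _ _) HH)).
  have -> : S `^ (p - 2) * (4 * kappa ^+ 2 / N * (2 * S ^+ 2 + 2 * c ^+ 2)) =
    8 * kappa ^+ 2 / N * (S `^ (p - 2) * S ^+ 2 + S `^ (p - 2) * c ^+ 2) by ring.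
  have -> : 16 * kappa ^+ 2 * Q = 8 * kappa ^+ 2 / N * (2 * (S `^ p + c `^ p)).
    by rewrite /Q; ring.
  rewrite ler_pM2l; last by rewrite aN// mulr_gt0.
  by rewrite powR_mulB2//; lra.
- have p0 : 0 <= p by lra.
  apply: (le_trans (ler_powR2r p0 H0 HS)).
  have -> : 2 * kappa / N * (S + c) = (2 * kappa) * (N^-1 * (S + c)) by ring.
  have Sc : 0 <= S + c by rewrite addr_ge0// ltW.
  have k2 : 0 <= 2 * kappa by lra.
  have NV : 0 <= N^-1 by rewrite invr_ge0 ltW.
  have NSc : 0 <= N^-1 * (S + c) by rewrite mulr_ge0.
  rewrite (powRM p k2 NSc) (powRM p NV Sc) powR_inv ?(ltW N0)//.
  have -> : (4 * kappa) `^ p = (2 * kappa) `^ p * 2 `^ p.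
    by rewrite -powRM//; congr (_ `^ _); ring.
  rewrite -[leRHS]mulrA ler_wpM2l ?powR_ge0//.
  have -> : 2 `^ p * Q = N^-1 * (2 `^ p * (S `^ p + c `^ p)) by rewrite /Q; ring.
  apply: ler_pM; rewrite ?invr_ge0 ?powR_ge0//; last exact/powRD_le/ltW.
  rewrite lef_pV2 ?posrE ?powR_gt0// -[leLHS]powRr1 ?(ltW N0)// ler_powR//; lra.
- apply: (le_trans tp); rewrite -mulrA ler_wpM2l ?powR_ge0//.
  by rewrite /Q ler_pM2r ?invr_gt0// lerDr.
Qed.

(** The increment [D] occurs with the coefficient [- m^(p - 1)] and, from expanding [S^p], with
    [p S^(p - 1)]. Hence it is bounded from both sides with the same linear part [b], whose mean
    will be known; [s] stands for the second-order remainder. *)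
Let doob_pointwise (C : R) (S m D b z d0 H s : R) : 0 < C ->
  (forall a b ip s : R, 0 <= a -> 0 <= b -> 0 <= s -> `|ip| <= a * b ->
    s ^+ 2 = a ^+ 2 + 2 * ip + b ^+ 2 ->
    s `^ p <= a `^ p + p * a `^ (p - 2) * ip +
      C * (a `^ (p - 2) * b ^+ 2 + b `^ p)) ->
  0 <= S -> 0 <= m -> 0 <= S + D -> 0 <= z -> 0 <= H ->
  `|D| <= z + H -> d0 + b <= D -> D <= H + b + s ->
  doob_fun p (S + D) (Num.max m (S + D)) <= doob_fun p S m -
    m `^ (p - 1) * (d0 + b) + (4 `^ (p - 1) + 1) * (p * S `^ (p - 1) * (H + b + s) +
      C * (S `^ (p - 2) * (2 * z ^+ 2 + 2 * H ^+ 2) +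
     2 `^ p * (z `^ p + H `^ p))).
Proof.
move=> C0 hC S0 m0 SD0 z0 H0 Dabs Dge Dle; have h2p := hp.
apply: (le_trans (doob_fun_step hp S m0 SD0)); rewrite [S + D - S]addrC addKr.
apply: lerD; first by rewrite lerD2l lerN2 ler_wpM2l ?powR_ge0.
have A0 : 0 <= 4 `^ (p - 1) + 1 :> R by rewrite addr_ge0 ?powR_ge0.
rewrite ler_wpM2l//.
have hexp : (S + D) `^ p <= S `^ p + p * S `^ (p - 1) * D +
      C * (S `^ (p - 2) * D ^+ 2 + `|D| `^ p).
  have := hC S `|D| (S * D) (S + D) S0 (normr_ge0 _) SD0.
  rewrite normrM (ger0_norm S0) real_normK ?num_real// => /(_ (lexx _)).
  have -> : (S + D) ^+ 2 = S ^+ 2 + 2 * (S * D) + D ^+ 2 by ring.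
  move=> /(_ erefl); rewrite -(powR_mulB21 hp S0) mulrA.
  by rewrite [p * (_ * _)]mulrA.
have D2 : D ^+ 2 <= 2 * z ^+ 2 + 2 * H ^+ 2.
  have : `|D| ^+ 2 <= (z + H) ^+ 2 by rewrite lerXn2r ?nnegrE ?addr_ge0.
  by rewrite real_normK ?num_real//; have := sqr_ge0 (z - H); nra.
have p0 : 0 <= p by lra.
have Dp : `|D| `^ p <= 2 `^ p * (z `^ p + H `^ p).
  apply: (le_trans _ (powRD_le p0 z0 H0)).
  exact: ler_powR2r.
have e2 : p * S `^ (p - 1) * D <= p * S `^ (p - 1) * (H + b + s).
  by rewrite ler_wpM2l// mulr_ge0 ?powR_ge0.
have e4 : C * (S `^ (p - 2) * D ^+ 2 + `|D| `^ p) <=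
    C * (S `^ (p - 2) * (2 * z ^+ 2 + 2 * H ^+ 2) + 2 `^ p * (z `^ p + H `^ p)).
  by rewrite ler_wpM2l ?(ltW C0)// lerD// ler_wpM2l ?powR_ge0.
rewrite lerBlDl; apply: (le_trans hexp); rewrite -addrA lerD2l.
exact: lerD.
Qed.

Lemma measurable_doob_fun dT (T : measurableType dT) (f g : T -> R) :
  measurable_fun setT f -> measurable_fun setT g ->
  measurable_fun setT (fun w => doob_fun p (f w) (g w)).
Proof.
move=> mf mg; apply: measurable_funD; first apply: measurable_funB.
- by apply: measurable_funM => //; exact: (measurableT_comp (measurable_powR p)).
- by apply: measurable_funM => //; exact: (measurableT_comp (measurable_powR _)).
- by apply: measurable_funM => //; exact: (measurableT_comp (measurable_powR p)).
Qed.

Lemma measurable_snorm c dT (T : measurableType dT) (f : T -> 'rV[R]_d) :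
  measurable_fun setT (f : T -> borel_rV R d) ->
  measurable_fun setT (fun w => snorm dot c (f w)).
Proof.
move=> mf; rewrite /snorm; under eq_fun do rewrite -powR12_sqrt ?addr_ge0 ?sqr_ge0//.
apply: (measurableT_comp (measurable_powR _)); apply: measurable_funD => //.
by apply: measurable_funX; exact: measurable_dnorm.
Qed.

(** The compensator [h] covers both the drift displacement, at most [kappa / N * |e|], and the bias,
    at most [kappa / N * c]. Hence the contribution weighted by [m^(p - 1)] has the favourable sign,
    however large the running maximum is, and only multiples of [S^p + c^p] remain. *)
Lemma doob_step : exists2 K : R, 0 < K &
  forall e x Y mY (N c S m h : R), 1 <= N -> 0 < c -> has_vmean P Y mY ->
  dnorm dot (x - e) <= kappa / N * dnorm dot e ->
  dnorm dot mY <= kappa * c / N ->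
  (\int[P]_w (dnorm dot (Y w) `^ p)%:E <=
    ((kappa * c / Num.sqrt N) `^ p)%:E)%E ->
  snorm dot c e <= S -> 0 <= m -> h = kappa / N * (dnorm dot e + c) ->
  (\int[P]_w (doob_fun p (S + (snorm dot c (x + Y w) - snorm dot c e + h))
    (Num.max m (S + (snorm dot c (x + Y w) - snorm dot c e + h))))%:E <=
    (doob_fun p S m + K / N * (S `^ p + c `^ p))%:E)%E.
Proof.
have h2p := hp; have k0 := kappa0.
have [C C0 hC] := powR_expansion hp.
pose A : R := 4 `^ (p - 1) + 1.
have A0 : 0 < A by rewrite addr_gt0// powR_gt0.
(* The numbers collect the bounds of [noise_terms]: [5 kappa] is [4 kappa] for [H] plus [kappa] for
   the bias, and [36 kappa^2] is [4 kappa^2 + 2 * 16 kappa^2]. *)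
pose K := A * (p * (5 * kappa + kappa ^+ 2) + C * (36 * kappa ^+ 2 +
  2 `^ p * ((4 * kappa) `^ p + kappa `^ p))).
have K0 : 0 < K.
  rewrite mulr_gt0// addr_gt0// mulr_gt0//; first lra.
    by rewrite addr_gt0 ?mulr_gt0 ?exprn_gt0.
  rewrite addr_gt0 ?mulr_gt0 ?exprn_gt0// ?powR_gt0//.
  by rewrite addr_gt0 ?powR_gt0// mulr_gt0.
exists K => // e x Y mY N c S m h N1 c0 hY xe mYle Yle eS m0 hE.
pose S' w := S + (snorm dot c (x + Y w) - snorm dot c e + h).
change ((\int[P]_w (doob_fun p (S' w) (Num.max m (S' w)))%:E <=
    (doob_fun p S m + K / N * (S `^ p + c `^ p))%:E)%E).
have N0 : 0 < N by lra.
have [t0 t2 tp] := noise_scale N1 c0.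
set t := kappa * c / Num.sqrt N in t0 t2 tp Yle.
set g := snorm dot c; have gx := snorm_gt0 dot c0 x; rewrite -/g in eS gx.
have S0 : 0 <= S by rewrite (le_trans _ eS)// snorm_ge0.
pose Q := (S `^ p + c `^ p) / N.
have Q0 : 0 <= Q by rewrite divr_ge0 ?addr_ge0 ?powR_ge0 ?(ltW N0).
have en : 0 <= dnorm dot e by exact: dnorm_ge0.
have enS : dnorm dot e <= S by rewrite (le_trans (snorm_ge_dnorm dot c e)).
have kN : 0 < kappa / N by rewrite divr_gt0.
have h0 : 0 <= h by rewrite hE mulr_ge0 ?(ltW kN)// addr_ge0// ltW.
pose H := 2 * h.
have H0 : 0 <= H by rewrite mulr_ge0.
have HS : H <= 2 * kappa / N * (S + c).
  rewrite /H hE; have : kappa / N * (dnorm dot e + c) <= kappa / N * (S + c).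
    by rewrite ler_pM2l// lerD2r.
  by move=> hh; rewrite -(mulrA 2) -(mulrA 2) ler_pM2l.
have [[T1 T2 T3 T4] [T5 T6 T7]] := noise_terms N1 c0 S0 H0 HS.
rewrite -/t -/Q in T1 T2 T3 T4 T5 T6 T7.
pose d0 := g x - g e + h.
have gxe := snorm_dist dot c x e.
have d0ge : kappa * c / N <= d0.
  have : h = kappa / N * dnorm dot e + kappa * c / N by rewrite hE; ring.
  by move: gxe; rewrite ler_norml /d0 -/g => /andP[] ; lra.
have d0le : d0 <= H.
  have : kappa / N * dnorm dot e <= h by rewrite hE ler_pM2l// lerDl ltW.
  by move: gxe; rewrite ler_norml /d0 /H -/g => /andP[] ; lra.
pose D w := g (x + Y w) - g e + h.
have Dabs w : `|D w| <= dnorm dot (Y w) + H.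
  have h1 : `|g (x + Y w) - g e| <= dnorm dot (x + Y w - e) by exact: snorm_dist.
  have h2 : dnorm dot (x + Y w - e) <= dnorm dot (x - e) + dnorm dot (Y w).
    by rewrite addrAC dnormD.
  have h3 : kappa / N * dnorm dot e <= h by rewrite hE ler_pM2l// lerDl ltW.
  apply: (le_trans (ler_normD _ _)); rewrite (ger0_norm h0) /H; lra.
have Dge w : d0 + dot x (Y w) / g x <= D w.
  by have := snormD_ge dot c0 x (Y w); rewrite /D /d0 -/g; lra.
have Dle w : D w <= H + dot x (Y w) / g x + dnorm dot (Y w) ^+ 2 / (2 * c).
  by have := snormD_le dot c0 x (Y w); move: d0le; rewrite /D /d0 -/g; lra.
have S'0 w : 0 <= S' w.
  have := snorm_ge0 dot c (x + Y w); rewrite /S' -/g; lra.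
pose T := t ^+ 2 / t `^ p.
have T0 : 0 <= T by rewrite divr_ge0 ?sqr_ge0 ?powR_ge0.
have TtE : T * t `^ p = t ^+ 2 by rewrite /T divfK// gt_eqF// powR_gt0.
(* Coefficients of a bound affine in [dot x (Y w)] and [|Y w|^p]; [a1] may have either sign, only
   [a2] has to be nonnegative. *)
pose a1 := (A * p * S `^ (p - 1) - m `^ (p - 1)) / g x.
pose a0 := doob_fun p S m - m `^ (p - 1) * d0 +
  A * (p * S `^ (p - 1) * (H + t ^+ 2 / (2 * c)) +
       C * (S `^ (p - 2) * (2 * t ^+ 2 + 2 * H ^+ 2) + 2 `^ p * H `^ p)).
pose a2 := A * (p * S `^ (p - 1) * (T / (2 * c)) +
       C * (S `^ (p - 2) * (2 * T) + 2 `^ p)).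
have doob_le w : doob_fun p (S' w) (Num.max m (S' w)) <=
    a0 + a1 * dot x (Y w) + a2 * dnorm dot (Y w) `^ p.
  have zp := sqr_le_moment hp t0 (dnorm_ge0 dot (Y w)); rewrite -/T in zp.
  have Ds : D w <= H + dot x (Y w) / g x +
      (t ^+ 2 + T * dnorm dot (Y w) `^ p) / (2 * c).
    by rewrite (le_trans (Dle w))// lerD2l ler_pM2r// invr_gt0 mulr_gt0.
  apply: (le_trans (doob_pointwise C0 hC S0 m0 (S'0 w) (dnorm_ge0 dot (Y w)) H0
    (Dabs w) (Dge w) Ds)); rewrite -/A.
  have -> : a0 + a1 * dot x (Y w) + a2 * dnorm dot (Y w) `^ p = doob_fun p S m -
    m `^ (p - 1) * (d0 + dot x (Y w) / g x) + A * (p * S `^ (p - 1) *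
      (H + dot x (Y w) / g x + (t ^+ 2 + T * dnorm dot (Y w) `^ p) / (2 * c)) +
      C * (S `^ (p - 2) * (2 * (t ^+ 2 + T * dnorm dot (Y w) `^ p) + 2 * H ^+ 2) +
     2 `^ p * (dnorm dot (Y w) `^ p + H `^ p))).
    rewrite /a0 /a1 /a2; field; rewrite !gt_eqF//.
  rewrite lerD2l ler_pM2l// lerD2l ler_pM2l// lerD2r ler_wpM2l ?powR_ge0//.
  by rewrite lerD2r ler_pM2l.
have mYm : measurable_fun setT (Y : Omega -> borel_rV R d).
  exact: has_vmean_measurable hY.
have mS' : measurable_fun setT S'.
  apply: measurable_funD => //; apply: measurable_funD => //.
  apply: measurable_funB => //; apply: measurable_snorm.
  by apply: measurable_rVD => //; exact: measurable_cst.
have mf : measurable_fun setT (fun w => doob_fun p (S' w) (Num.max m (S' w))).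
  by apply: measurable_doob_fun => //; exact: measurable_maxr.
have doob0 w : 0 <= doob_fun p (S' w) (Num.max m (S' w)).
  have mS : 0 <= Num.max m (S' w) by rewrite le_max m0.
  by rewrite (le_trans _ (doob_fun_ge hp (S'0 w) mS))// addr_ge0 ?divr_ge0 ?powR_ge0.
have a20 : 0 <= a2.
  rewrite mulr_ge0 ?(ltW A0)// addr_ge0// mulr_ge0 ?powR_ge0 ?(ltW C0)//.
  - by rewrite mulr_ge0 ?powR_ge0//; lra.
  - by rewrite divr_ge0// mulr_ge0// ltW.
  - by rewrite addr_ge0 ?powR_ge0// mulr_ge0 ?powR_ge0// mulr_ge0.
have mYp : measurable_fun setT (fun w => dnorm dot (Y w) `^ p).
  by apply: (measurableT_comp (measurable_powR p)); exact: measurable_dnorm.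
apply: (le_trans (integral_le_affine doob0 mf (has_mean_dot dot x hY)
  (fun w => powR_ge0 _ _) mYp Yle a20 doob_le)).
rewrite lee_fin; set b := dot x mY.
have bg : `|b / g x| <= kappa * c / N.
  rewrite normrM normfV (gtr0_norm gx) ler_pdivrMr//.
  rewrite (le_trans (cauchy_schwarz _ _ _))// mulrC ler_pM ?dnorm_ge0//.
  exact: snorm_ge_dnorm.
move: bg; rewrite ler_norml => /andP[bg1 bg2].
have f1 : 0 <= m `^ (p - 1) * (d0 + b / g x) by rewrite mulr_ge0 ?powR_ge0//; lra.
have pA : 0 <= A * p by rewrite mulr_ge0 ?(ltW A0)//; lra.
have f2 : S `^ (p - 1) * (b / g x) <= kappa * Q.
  by apply: le_trans T2; rewrite ler_wpM2l ?powR_ge0.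
have -> : a0 + a1 * b + a2 * t `^ p = doob_fun p S m - m `^ (p - 1) * (d0 + b / g x) +
  A * p * (S `^ (p - 1) * H + S `^ (p - 1) * (b / g x) + S `^ (p - 1) * (t ^+ 2 / c)) +
  A * C * (4 * (S `^ (p - 2) * t ^+ 2) + 2 * (S `^ (p - 2) * H ^+ 2) +
    2 `^ p * (H `^ p + t `^ p)).
  by rewrite /a0 /a1 /a2 -TtE; field; rewrite !gt_eqF.
have g1 : A * p * (S `^ (p - 1) * H + S `^ (p - 1) * (b / g x) + S `^ (p - 1) * (t ^+ 2 / c))
   <= A * p * ((5 * kappa + kappa ^+ 2) * Q) by rewrite ler_wpM2l//; lra.
have g2 : 2 `^ p * (H `^ p + t `^ p) <= 2 `^ p * (((4 * kappa) `^ p + kappa `^ p) * Q).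
  by rewrite ler_wpM2l ?powR_ge0//; lra.
have g3 : A * C * (4 * (S `^ (p - 2) * t ^+ 2) + 2 * (S `^ (p - 2) * H ^+ 2) +
    2 `^ p * (H `^ p + t `^ p)) <= A * C * ((36 * kappa ^+ 2 +
  2 `^ p * ((4 * kappa) `^ p + kappa `^ p)) * Q).
  by rewrite ler_wpM2l ?mulr_ge0 ?(ltW A0) ?(ltW C0)//; lra.
have -> : K / N * (S `^ p + c `^ p) = A * p * ((5 * kappa + kappa ^+ 2) * Q) +
  A * C * ((36 * kappa ^+ 2 + 2 `^ p * ((4 * kappa) `^ p + kappa `^ p)) * Q).
  by rewrite /K /Q; ring.
lra.
Qed.

End one_step.

(** * Contraction by the drift *)

Section contraction.
Context {R : realType} {d : nat}.
Variables (dot : {dot 'rV[R]_d for idfun}) (L L' : R) (e v : 'rV[R]_d).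
Hypotheses (hL : 0 < L) (hL' : 0 < L').
Hypotheses (evL : dot e v <= - L * dnorm dot e ^+ 2)
  (evL' : dot e v <= - L' * dnorm dot v ^+ 2).

Lemma drift_le : dnorm dot v <= dnorm dot e / L'.
Proof.
have v0 := dnorm_ge0 dot v; have := dot_ge dot e v => h.
rewrite ler_pdivlMr//; case: (eqVneq (dnorm dot v) 0) => [->|vn0].
  by rewrite mul0r dnorm_ge0.
have vp : 0 < dnorm dot v by rewrite lt_neqAle eq_sym vn0.
rewrite -(ler_pM2r vp); have h2 := evL'; lra.
Qed.

(** No smallness of the step is required; this crude bound gives finite moments at all times,
    including the early ones where [contraction_le] may fail to apply. *)
Lemma expansion_le g : 0 <= g ->
  dnorm dot (e + g *: v) <= (1 + g / L') * dnorm dot e.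
Proof.
move=> g0; rewrite (le_trans (dnormD _ _ _))// dnormZ_ge0// mulrDl mul1r lerD2l.
by rewrite mulrAC -mulrA ler_wpM2l// drift_le.
Qed.

(** The condition with [L'] trades [g^2 |v|^2] for [- (g^2 / L') dot e v], which leaves the
    nonnegative factor [2 g - g^2 / L'] in front of [dot e v]. The condition with [L] then bounds
    the square by [(1 - 2 y) |e|^2 <= (1 - y)^2 |e|^2]. *)
Lemma contraction_le g y : 0 <= g -> g <= 2 * L' -> 0 <= y -> y <= 1 ->
  y <= L * g * (1 - g / (2 * L')) ->
  dnorm dot (e + g *: v) <= (1 - y) * dnorm dot e.
Proof.
move=> g0 gL y0 y1 yg.
rewrite -(@ler_pXn2r _ 2) ?nnegrE ?mulr_ge0 ?dnorm_ge0 ?subr_ge0//.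
rewrite sqr_dnormD dnormZ_ge0// dotZr exprMn exprMn.
have a0 : 0 <= dnorm dot e ^+ 2 by rewrite sqr_ge0.
have b0 : 0 <= dnorm dot v ^+ 2 by rewrite sqr_ge0.
move: (evL) (evL').
set a := dnorm dot e ^+ 2 in a0 *; set b := dnorm dot v ^+ 2 in b0 *.
set ip := dot e v => h1 h2.
have t0 : 0 <= 2 * g - g ^+ 2 / L'.
  have -> : 2 * g - g ^+ 2 / L' = g * (2 - g / L') by ring.
  by rewrite mulr_ge0// subr_ge0 ler_pdivrMr.
have e1 : g ^+ 2 * b <= - (g ^+ 2 / L') * ip.
  have -> : g ^+ 2 * b = - (g ^+ 2 / L') * (- L' * b).
    by field; rewrite gt_eqF.
  by rewrite ler_wnM2l// oppr_le0 divr_ge0 ?sqr_ge0// ltW.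
have e2 : (2 * g - g ^+ 2 / L') * ip <= (2 * g - g ^+ 2 / L') * (- L * a).
  by rewrite ler_wpM2l.
have e3 : 2 * y * a <= 2 * (L * g * (1 - g / (2 * L'))) * a.
  by rewrite ler_wpM2r// ler_pM2l.
have e4 : 2 * (L * g * (1 - g / (2 * L'))) * a = - ((2 * g - g ^+ 2 / L') * (- L * a)).
  by field; rewrite gt_eqF.
have e5 : (1 - y) ^+ 2 * a = a - 2 * y * a + y ^+ 2 * a by ring.
have e6 : 0 <= y ^+ 2 * a by rewrite mulr_ge0 ?sqr_ge0.
rewrite e5; move: e1 e2 e3 e6; rewrite e4; lra.
Qed.

End contraction.

Section decay_factor.
Context {R : realType}.

(** The gap [p (lambda - rho)] is divided into thirds: one is [delta], one separates [k] from
    [rho p], and one absorbs the quadratic error of the exponential once [N >= n0]. *)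
Lemma decay_factor (p lambda rho : R) : 2 <= p -> 0 < rho -> rho < lambda ->
  exists delta k n0 : R, [/\ 0 < delta, rho * p < k, 0 <= n0 &
    forall N, 0 < N -> n0 <= N -> lambda <= N ->
      (1 + delta / N) * (1 - lambda / N) `^ p <= 1 - k / N].
Proof.
move=> hp r0 rl.
have l0 : 0 < lambda := lt_trans r0 rl.
have lr : 0 < lambda - rho by lra.
have p0 : 0 < p by lra.
exists (p * (lambda - rho) / 3), (p * (lambda + 2 * rho) / 3).
exists (6 * p * lambda ^+ 2 / (lambda - rho)); split.
- by rewrite divr_gt0// mulr_gt0.
- have : 0 < p * (lambda - rho) by rewrite mulr_gt0.
  lra.
- by rewrite divr_ge0 ?mulr_ge0 ?sqr_ge0// ltW.
move=> N N0 nN lN.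
set delta := p * (lambda - rho) / 3.
pose x := (delta - p * lambda) / N.
have xE : x = - (p * (2 * lambda + rho) / 3) / N by rewrite /x /delta; congr (_ / _); field.
have x0 : x <= 0.
  by rewrite xE mulNr oppr_le0 !mulr_ge0 ?invr_ge0//; lra.
apply: (@le_trans _ _ (expR x)).
  have -> : x = delta / N + - (lambda / N) * p by rewrite /x mulrDl; ring.
  rewrite expRD; apply: ler_pM.
  - by rewrite addr_ge0// divr_ge0 ?(ltW N0)// /delta divr_ge0// mulr_ge0; lra.
  - exact: powR_ge0.
  - exact: expR_ge1Dx.
  - apply: powR_le_expR; first lra.
    + by rewrite subr_ge0 ler_pdivrMr// mul1r.
    + lra.
have x2 : x <= 2^-1 by rewrite (le_trans x0)// invr_ge0.
apply: (le_trans (expR_le_quadratic x2)).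
have e1 : x ^+ 2 <= p ^+ 2 * lambda ^+ 2 / N ^+ 2.
  have a0 : 0 <= p * (2 * lambda + rho) / 3 by rewrite divr_ge0// mulr_ge0//; lra.
  have ab : p * (2 * lambda + rho) / 3 <= p * lambda.
    by rewrite -mulrA ler_pM2l//; lra.
  rewrite xE mulNr sqrrN -exprMn -expr_div_n lerXn2r ?nnegrE//.
  - by rewrite mulr_ge0// invr_ge0 ltW.
  - by rewrite divr_ge0 ?(ltW N0)// mulr_ge0; lra.
  - by rewrite ler_pM2r ?invr_gt0.
have e2 : 2 * (p ^+ 2 * lambda ^+ 2 / N ^+ 2) <= p * (lambda - rho) / 3 / N.
  rewrite expr2 invfM.
  have -> : 2 * (p ^+ 2 * lambda ^+ 2 * (N^-1 * N^-1)) =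
    p * (2 * p * lambda ^+ 2 / N) / N by ring.
  rewrite ler_pM2r ?invr_gt0//.
  have h : 2 * p * lambda ^+ 2 / N <= (lambda - rho) / 3.
    by move: nN; rewrite !ler_pdivrMr//; lra.
  by apply: le_trans (ler_wpM2l (ltW p0) h) _; rewrite mulrA.
have e3 : x + p * (lambda - rho) / 3 / N = - (p * (lambda + 2 * rho) / 3 / N).
  by rewrite xE; field; rewrite gt_eqF.
lra.
Qed.

End decay_factor.

(** * Lp rates for Robbins-Monro schemes *)

Section robbins_monro.
Context {R : realType} {d : nat} {dO dS : measure_display}.
Context {Omega : measurableType dO} {S : measurableType dS}.
Variables (P : probability Omega R) (dot : {dot 'rV[R]_d for idfun}).
Variables (D : set 'rV[R]_d) (cD : closed D) (cvD : @convex_set R 'rV[R]_d D).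
Variables (p : R) (hp : 2 <= p).
Variables (I : choiceType) (X : I -> {RV P >-> S}) (A : set I).
Hypothesis hX : mutually_independent A X.
Variable lev : nat -> set I.
Hypotheses (levA : forall n, lev n `<=` A)
  (lev_disjoint : forall n k i, lev n i -> lev k i -> n = k).
Variable Z : nat -> 'rV[R]_d -> Omega -> 'rV[R]_d.
(** Joint measurability is tested along arbitrary maps, with parameters in [D] and samples seen only
    through the events of step [n]; this encodes that [Z n] uses no other randomness. *)
Hypothesis mZ : forall n, (0 < n)%N ->
  forall dT (T : measurableType dT) (t : T -> 'rV[R]_d) (v : T -> Omega),
  measurable_fun setT (t : T -> borel_rV R d) -> (forall x, D (t x)) ->
  measurable_fun setT (v : T -> sub_space X (lev n)) ->
  measurable_fun setT (fun x => Z n (t x) (v x) : borel_rV R d).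
Variables (theta0 : 'rV[R]_d) (Dtheta0 : D theta0) (gamma : nat -> R).

Fixpoint rm_scheme n w : 'rV[R]_d :=
  if n is n'.+1 then
    Defs.proj dot D (rm_scheme n' w + gamma n *: Z n (rm_scheme n' w) w)
  else theta0.

Let D0 : D !=set0. Proof. by exists theta0. Qed.

Lemma rm_scheme_in n w : D (rm_scheme n w).
Proof. by case: n => [//|n]; exact: proj_in. Qed.

Definition pre n : set I := [set i | exists2 j, (j <= n)%N & lev j i].

Let preA n : pre n `<=` A.
Proof. by move=> i [j _ /levA]. Qed.

Let pre_lev n : pre n `&` lev n.+1 = set0.
Proof.
apply/seteqP; split => // i [[j jn ji] /(lev_disjoint ji) jE].
by move: jn; rewrite jE ltnn.
Qed.

Lemma preS n : pre n `<=` pre n.+1.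
Proof. by move=> i [j jn ji]; exists j => //; exact: leq_trans jn _. Qed.

Lemma lev_pre n : lev n `<=` pre n.
Proof. by move=> i ni; exists n. Qed.

Lemma measurable_preS n dT (T : measurableType dT) (h : Omega -> T) :
  measurable_fun setT (h : sub_space X (pre n) -> T) ->
  measurable_fun setT (h : sub_space X (pre n.+1) -> T).
Proof.
by move=> mh; exact: (measurableT_comp mh (sub_spaceS (X:=X) (@preS n))).
Qed.

Lemma measurable_preS_diag n dT (T : measurableType dT) (h : Omega * Omega -> T) :
  measurable_fun setT (h : sub_space X (pre n) * sub_space X (lev n.+1) -> T) ->
  measurable_fun setT ((fun w => h (w, w)) : sub_space X (pre n.+1) -> T).
Proof.
move=> mh; apply: (measurableT_comp mh); apply/measurable_fun_pairP; split.
- exact: (sub_spaceS (X:=X) (@preS n)).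
- exact: (sub_spaceS (X:=X) (@lev_pre n.+1)).
Qed.

Let mproj : measurable_fun setT (Defs.proj dot D : borel_rV R d -> borel_rV R d).
Proof. by apply: continuous_borel_rV; exact: proj_continuous. Qed.

Lemma measurable_rm_scheme n :
  measurable_fun setT (rm_scheme n : sub_space X (pre n) -> borel_rV R d).
Proof.
elim: n => [|n IH]; first exact: measurable_cst.
have mt := measurable_preS IH.
apply: (measurableT_comp mproj); apply: measurable_rVD => //.
apply: measurable_rVZ => //; apply: mZ => //; first exact: rm_scheme_in.
exact: (sub_spaceS (X:=X) (@lev_pre n.+1)).
Qed.

Lemma measurable_rm_scheme_Omega n :
  measurable_fun setT (rm_scheme n : Omega -> borel_rV R d).
Proof. exact: (measurable_sub_space (@measurable_rm_scheme n)). Qed.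

Lemma measurable_rm_increment n : measurable_fun setT
  (fun x : sub_space X (pre n) * sub_space X (lev n.+1) =>
    Z n.+1 (rm_scheme n x.1) x.2 : borel_rV R d).
Proof.
apply: mZ => //.
- exact: (measurableT_comp (@measurable_rm_scheme n) measurable_fst).
- by move=> x; exact: rm_scheme_in.
Qed.

Lemma rm_step n
    (f : sub_space X (pre n) * sub_space X (lev n.+1) -> R)
    (g : sub_space X (pre n) -> R) :
  measurable_fun setT f -> (forall x, 0 <= f x) ->
  measurable_fun setT g -> (forall w, 0 <= g w) ->
  (forall w1, \int[P]_w2 (f (w1, w2))%:E <= (g w1)%:E)%E ->
  (\int[P]_w (f (w, w))%:E <= \int[P]_w (g w)%:E)%E.
Proof.
move=> mf f0 mg g0 fg.
apply: (@integral_indep_le _ _ _ _ _ P I X A hX (pre n) (lev n.+1) (@preA n)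
  (@levA n.+1) (@pre_lev n) (fun x => (f x)%:E) _ _ (fun w => (g w)%:E)) => //.
exact/measurable_EFinP.
exact/measurable_EFinP.
Qed.

Variables (f : 'rV[R]_d -> 'rV[R]_d) (theta_star : 'rV[R]_d) (L L' : R).
Hypotheses (Dstar : D theta_star) (hL : 0 < L) (hL' : 0 < L').
Hypothesis hfL : forall theta, D theta ->
  dot (theta - theta_star) (f theta) <= - L * dnorm dot (theta - theta_star) ^+ 2.
Hypothesis hfL' : forall theta, D theta ->
  dot (theta - theta_star) (f theta) <= - L' * dnorm dot (f theta) ^+ 2.
Variables (r gamma0 sigma0 eps0 rho B : R) (sigma eps : nat -> R).
Hypotheses (hr : -1 < r) (hgamma0 : (1 + r) / (2 * L) < gamma0)
  (hsigma0 : 0 < sigma0) (heps0 : 0 < eps0) (hrho : rho = 2^-1 * (1 + r))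
  (hgamma : forall n, (0 < n)%N -> gamma n = gamma0 / n%:R)
  (hsigma_pos : forall n, (0 < n)%N -> 0 < sigma n)
  (hsigma : forall n, (0 < n)%N -> sigma n ^+ 2 = sigma0 ^+ 2 / n%:R `^ r)
  (heps : forall n, (0 < n)%N -> eps n = eps0 / n%:R `^ rho)
  (hB : 0 < B).
Hypothesis Zmoments : forall n theta, (0 < n)%N -> D theta ->
  exists zbar : 'rV[R]_d,
  [/\ dnorm dot (zbar - f theta) <= eps n,
      has_vmean P (fun w => Z n theta w - zbar) 0 &
      (\int[P]_w (dnorm dot (Z n theta w - zbar) `^ p)%:E <=
        ((B * sigma n) `^ p)%:E)%E].

Let rho0 : 0 < rho. Proof. by move: (hr) (hrho); lra. Qed.
Let gamma00 : 0 < gamma0.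
Proof.
apply: le_lt_trans hgamma0; rewrite divr_ge0 ?mulr_ge0 ?(ltW hL)//.
by move: (hr); lra.
Qed.

Let gamma_gt0 n : (0 < n)%N -> 0 < gamma n.
Proof. by move=> n0; rewrite hgamma// divr_gt0 ?ltr0n ?gamma00. Qed.

Let noise n theta w : 'rV[R]_d := gamma n *: (Z n theta w - f theta).

Lemma noise_moments : exists2 kappa : R, 0 < kappa &
  forall n theta, (0 < n)%N -> D theta -> exists m,
  [/\ has_vmean P (noise n theta) m,
      dnorm dot m <= kappa * n%:R `^ (- rho) / n%:R &
      (\int[P]_w (dnorm dot (noise n theta w) `^ p)%:E <=
        ((kappa * n%:R `^ (- rho) / Num.sqrt n%:R) `^ p)%:E)%E].
Proof.
have h2p := hp; have p0 : 0 <= p by lra.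
pose k1 := gamma0 * B * sigma0 + gamma0 * eps0.
have g0 := gamma00.
have a0 : 0 < gamma0 * B * sigma0 by rewrite !mulr_gt0.
have b0 : 0 < gamma0 * eps0 by rewrite mulr_gt0.
have k10 : 0 < k1 by rewrite addr_gt0.
(* Bias and fluctuation are each of size at most [s]; the inequality [(x + y)^p <= 2^p (x^p + y^p)]
   together with [2 <= 2^p] costs a factor [4^p] on the [p]-th moment. *)
exists (4 * k1) => [|n theta n0 Dt]; first by rewrite mulr_gt0.
have [zbar [zf zm zp]] := Zmoments n0 Dt.
have N0 : 0 < n%:R :> R by rewrite ltr0n.
have N1 : 1 <= n%:R :> R by rewrite ler1n.
have sN : 0 < Num.sqrt n%:R :> R by rewrite sqrtr_gt0.
have gn := gamma_gt0 n0.
set tau := n%:R `^ (- rho).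
have tau0 : 0 < tau by rewrite powR_gt0.
have epsE : gamma n * eps n = gamma0 * eps0 * tau / n%:R.
  by rewrite hgamma// heps// /tau powRN; ring.
have sigE : gamma n * (B * sigma n) = gamma0 * B * sigma0 * tau / Num.sqrt n%:R.
  have -> : sigma n = sigma0 * n%:R `^ (- (r / 2)).
    apply/eqP; rewrite -(@eqrXn2 _ 2)// ?(ltW (hsigma_pos n0))//; last first.
      by rewrite mulr_ge0 ?powR_ge0// ltW.
    rewrite hsigma// exprMn -(powR_mulrn 2 (powR_ge0 _ _)) -powRrM.
    by rewrite -powRN; apply/eqP; congr (_ * _ `^ _); field.
  rewrite hgamma//.
  have -> : tau = n%:R `^ (- (r / 2)) * (Num.sqrt n%:R)^-1.
    rewrite -powR12_sqrt ?(ltW N0)// -powRN -powR_gtD//.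
    by rewrite /tau hrho; congr (_ `^ _); field.
  have e : (Num.sqrt n%:R)^-1 * (Num.sqrt n%:R)^-1 = n%:R^-1 :> R.
    by rewrite -invfM -expr2 sqr_sqrtr// ltW.
  by rewrite -e; ring.
have yE w : noise n theta w = gamma n *: (Z n theta w - zbar) + gamma n *: (zbar - f theta).
  by rewrite -scalerDr addrA subrK.
exists (gamma n *: (zbar - f theta)); split.
- have := has_vmeanD (has_vmeanZ (gamma n) zm) (has_vmean_cst P (gamma n *: (zbar - f theta))).
  rewrite scaler0 add0r; congr has_vmean; apply/funext => w; exact/esym/yE.
- rewrite dnormZ_ge0 ?(ltW gn)//.
  apply: (@le_trans _ _ (gamma n * eps n)); first by rewrite ler_pM2l.
  rewrite epsE ler_pM2r ?invr_gt0// ler_pM2r// /k1; lra.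
- pose s := k1 * tau / Num.sqrt n%:R.
  have s0 : 0 < s by rewrite divr_gt0 ?mulr_gt0.
  have es : gamma n * eps n <= s.
    rewrite epsE /s; apply: ler_pM.
    - by apply: mulr_ge0; exact: ltW.
    - by rewrite invr_ge0 ltW.
    - by rewrite ler_pM2r// /k1 lerDr ltW.
    - rewrite lef_pV2 ?posrE// -[leLHS]mulr1 -[leRHS](sqr_sqrtr (ltW N0)) expr2.
      by rewrite ler_pM2l// -[leLHS]sqrtr1 ler_sqrt.
  have gs : gamma n * (B * sigma n) <= s.
    by rewrite sigE /s ler_pM2r ?invr_gt0// ler_pM2r// lerDl ltW.
  have -> : 4 * k1 * tau / Num.sqrt n%:R = 4 * s by rewrite /s; ring.
  have mz : measurable_fun setT (fun w => Z n theta w - zbar : borel_rV R d).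
    exact: has_vmean_measurable zm.
  have mzp : measurable_fun setT (fun w => dnorm dot (Z n theta w - zbar) `^ p).
    by apply: (measurableT_comp (measurable_powR p)); exact: measurable_dnorm.
  have my : measurable_fun setT (noise n theta : Omega -> borel_rV R d).
    rewrite (_ : noise n theta = fun w => gamma n *: (Z n theta w - zbar) +
       gamma n *: (zbar - f theta)); last by apply/funext => w; exact: yE.
    by apply: measurable_rVD; [exact: measurable_rVZ|exact: measurable_cst].
  have a20 : 0 <= 2 `^ p * gamma n `^ p by rewrite mulr_ge0 ?powR_ge0.
  have pt w : dnorm dot (noise n theta w) `^ p <= 2 `^ p * s `^ p + 0 * 0 +
      2 `^ p * gamma n `^ p * dnorm dot (Z n theta w - zbar) `^ p.
    rewrite mulr0 addr0 yE.
    apply: (@le_trans _ _ ((gamma n * dnorm dot (Z n theta w - zbar) + s) `^ p)).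
      apply: ler_powR2r => //; first exact: dnorm_ge0.
      rewrite (le_trans (dnormD _ _ _))// !dnormZ_ge0 ?(ltW gn)// lerD2l.
      by rewrite (le_trans _ es)// ler_pM2l.
    have z0 : 0 <= gamma n * dnorm dot (Z n theta w - zbar).
      by rewrite mulr_ge0 ?dnorm_ge0// ltW.
    apply: (le_trans (powRD_le p0 z0 (ltW s0))).
    by rewrite powRM ?dnorm_ge0 ?(ltW gn)//; lra.
  have := integral_le_affine (fun w => powR_ge0 _ _)
    (measurableT_comp (measurable_powR p) (measurable_dnorm dot my))
    (has_mean_cst P 0) (fun w => powR_ge0 _ _) mzp zp a20 pt.
  move/le_trans; apply; rewrite lee_fin mulr0 addr0 -mulrA.
  have -> : gamma n `^ p * (B * sigma n) `^ p = (gamma n * (B * sigma n)) `^ p.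
    by rewrite [RHS]powRM ?(ltW gn)// mulr_ge0 ?(ltW hB)// (ltW (hsigma_pos n0)).
  have h1 : (gamma n * (B * sigma n)) `^ p <= s `^ p.
    apply: ler_powR2r => //; rewrite mulr_ge0 ?(ltW gn)// mulr_ge0 ?(ltW hB)//.
    exact/ltW/hsigma_pos.
  have -> : (4 * s) `^ p = 2 `^ p * (2 `^ p * s `^ p).
    have s20 : 0 <= 2 * s by rewrite mulr_ge0// ltW.
    by rewrite -powRM ?(ltW s0)// -powRM//; congr (_ `^ _); ring.
  have h2 : 2 <= 2 `^ p :> R.
    by rewrite -[leLHS]powRr1// ler_powR//; lra.
  rewrite -mulrDr ler_pM2l ?powR_gt0//.
  apply: (@le_trans _ _ (2 * s `^ p)); first lra.
  by rewrite ler_wpM2r ?powR_ge0.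
Qed.

Definition rm_error n w : 'rV[R]_d := rm_scheme n w - theta_star.

Lemma measurable_rm_error n :
  measurable_fun setT (rm_error n : sub_space X (pre n) -> borel_rV R d).
Proof. by apply: measurable_rVB; [exact: measurable_rm_scheme|exact: measurable_cst]. Qed.

Let drift n w : 'rV[R]_d := rm_error n w + gamma n.+1 *: f (rm_scheme n w).

(* The error before projection, as a function of the past and of the fresh
   simulations. *)
Definition raw_error n (x : Omega * Omega) : 'rV[R]_d :=
  rm_error n x.1 + gamma n.+1 *: Z n.+1 (rm_scheme n x.1) x.2.

Lemma measurable_raw_error n : measurable_fun setT
  (raw_error n : sub_space X (pre n) * sub_space X (lev n.+1) -> borel_rV R d).
Proof.
apply: measurable_rVD; first exact: (measurableT_comp (@measurable_rm_error n) measurable_fst).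
by apply: measurable_rVZ; [exact: measurable_cst|exact: measurable_rm_increment].
Qed.

Let rawE n w1 w2 : raw_error n (w1, w2) = drift n w1 + noise n.+1 (rm_scheme n w1) w2.
Proof.
rewrite /raw_error /drift /noise /= -[RHS]addrA; congr (_ + _).
by rewrite -scalerDr (addrC (f _)) subrK.
Qed.

(** The target lies in [D], so the nonexpansive projection fixes it. One-step bounds are therefore
    proved for the raw error, where drift and noise act additively. *)
Lemma rm_error_le_raw n w : dnorm dot (rm_error n.+1 w) <= dnorm dot (raw_error n (w, w)).
Proof.
have := proj_nonexpansive dot cD D0 cvD
  (rm_scheme n w + gamma n.+1 *: Z n.+1 (rm_scheme n w) w) theta_star.
by rewrite (proj_id dot cD D0 Dstar) /raw_error /rm_error /= [leRHS]/= addrAC.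
Qed.

Let p0 : 0 < p. Proof. by move: (hp); lra. Qed.

Let measurable_rawp n : measurable_fun setT
  ((fun x => dnorm dot (raw_error n x) `^ p) :
     sub_space X (pre n) * sub_space X (lev n.+1) -> R).
Proof.
apply: (measurableT_comp (measurable_powR p)); apply: measurable_dnorm.
exact: measurable_raw_error.
Qed.

Let measurable_errp n : measurable_fun setT
  ((fun w => dnorm dot (rm_error n w) `^ p) : sub_space X (pre n) -> R).
Proof.
apply: (measurableT_comp (measurable_powR p)); apply: measurable_dnorm.
exact: measurable_rm_error.
Qed.

Lemma lp_recursion delta : 0 < delta -> exists2 K : R, 0 < K &
  forall n q b, 0 <= q -> 0 <= b -> (forall w, dnorm dot (drift n w) <= q * dnorm dot (rm_error n w)) ->
  (\int[P]_w (dnorm dot (rm_error n w) `^ p)%:E <= b%:E)%E ->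
  (\int[P]_w (dnorm dot (rm_error n.+1 w) `^ p)%:E <=
    ((1 + delta / n.+1%:R) * q `^ p * b +
      K / n.+1%:R * n.+1%:R `^ (- (rho * p)))%:E)%E.
Proof.
move=> delta0; have [kappa kappa0 hn] := noise_moments.
have [K K0 hK] := lp_step P dot hp kappa0 delta0.
exists K => // n q b q0 b0 hq hb.
have N0 : 0 < n.+1%:R :> R by rewrite ltr0n.
have N1 : 1 <= n.+1%:R :> R by rewrite ler1n.
set tau := n.+1%:R `^ (- rho) : R.
have tau0 : 0 < tau by rewrite powR_gt0.
have a0 : 0 <= (1 + delta / n.+1%:R) * q `^ p.
  by rewrite mulr_ge0 ?powR_ge0// addr_ge0// divr_ge0// ltW.
have k0 : 0 <= K / n.+1%:R * tau `^ p.
  by rewrite mulr_ge0 ?powR_ge0// divr_ge0// ltW.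
have tauE : n.+1%:R `^ (- (rho * p)) = tau `^ p by rewrite -powRrM mulNr.
rewrite tauE.
have merrp := @measurable_errp n.
have mrawp := @measurable_rawp n.
pose h (w : Omega) := (1 + delta / n.+1%:R) * q `^ p * dnorm dot (rm_error n w) `^ p +
  K / n.+1%:R * tau `^ p.
have h0 w : 0 <= h w by rewrite addr_ge0// mulr_ge0// powR_ge0.
have mh : measurable_fun setT (h : sub_space X (pre n) -> R).
  apply: measurable_funD; last exact: measurable_cst.
  by apply: measurable_funM => //; exact: measurable_cst.
apply: (le_trans _ (integral_affine_le (fun w => powR_ge0 _ _)
  (measurable_sub_space merrp) a0 k0 hb)).
apply: (@le_trans _ _ (\int[P]_w (dnorm dot (raw_error n (w, w)) `^ p)%:E)%E).
  apply: ge0_le_integral => //.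
  - by move=> w _; rewrite lee_fin powR_ge0.
  - apply/measurable_EFinP; exact: (measurable_sub_space (@measurable_errp n.+1)).
  - apply/measurable_EFinP; exact: (measurable_sub_space (measurable_preS_diag mrawp)).
  - move=> w _; rewrite lee_fin; apply: ler_powR2r; rewrite ?dnorm_ge0 ?(ltW p0)//.
    exact: rm_error_le_raw.
apply: (rm_step mrawp (fun x => powR_ge0 _ _) mh h0) => w1.
have [m [hm hmm hmp]] := hn n.+1 _ isT (rm_scheme_in n w1).
under eq_integral do rewrite rawE.
apply: (le_trans (hK (drift n w1) _ _ _ _ N1 tau0 hm hmm hmp)).
rewrite lee_fin /h lerD2r -mulrA ler_wpM2l ?addr_ge0 ?divr_ge0 ?(ltW delta0)//.
by rewrite -powRM ?dnorm_ge0// ler_powR2r ?(ltW p0) ?dnorm_ge0.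
Qed.

Let expansion n w :
  dnorm dot (drift n w) <= (1 + gamma n.+1 / L') * dnorm dot (rm_error n w).
Proof.
have Dw := rm_scheme_in n w.
exact: (expansion_le hL' (hfL' Dw) (ltW (gamma_gt0 _))).
Qed.

(** Only finiteness is claimed; it allows the recursion for the rate to be run on real numbers
    instead of extended ones. *)
Let lp_finite n : exists2 b : R, 0 <= b &
  (\int[P]_w (dnorm dot (rm_error n w) `^ p)%:E <= b%:E)%E.
Proof.
elim: n => [|n [b b0 hb]].
  exists (dnorm dot (theta0 - theta_star) `^ p); first exact: powR_ge0.
  rewrite le_eqVlt; apply/orP; left; apply/eqP.
  exact: (proj2 (has_mean_cst P (dnorm dot (theta0 - theta_star) `^ p))).
have [K K0 hK] := lp_recursion ltr01.
have q0 : 0 <= 1 + gamma n.+1 / L'.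
  by rewrite addr_ge0// divr_ge0 ?(ltW hL')// ltW// gamma_gt0.
exists ((1 + 1 / n.+1%:R) * (1 + gamma n.+1 / L') `^ p * b +
      K / n.+1%:R * n.+1%:R `^ (- (rho * p))).
  by rewrite addr_ge0// ?mulr_ge0 ?powR_ge0 ?divr_ge0 ?(ltW K0)// addr_ge0.
by apply: hK => // w; exact: expansion.
Qed.

Lemma lp_rate : exists2 K : R, 0 < K & forall n, (0 < n)%N ->
  (\int[P]_w (dnorm dot (rm_error n w) `^ p)%:E <= (K * n%:R `^ (- (rho * p)))%:E)%E.
Proof.
have g0 := gamma00; have r0 := rho0; have l0 := hL; have l0' := hL'.
(* The assumption on [gamma0] means [rho < L * gamma0]. The midpoint leaves room on both sides: for
   the rate, and for the correction [1 - gamma n / (2 L')] in the contraction. *)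
pose lambda := (rho + L * gamma0) / 2.
have rg : rho < L * gamma0.
  move: hgamma0; rewrite ltr_pdivrMr ?mulr_gt0// hrho; lra.
have rl : rho < lambda by rewrite /lambda; lra.
have lg : 0 < L * gamma0 - lambda by rewrite /lambda; lra.
have lam0 : 0 < lambda := lt_trans r0 rl.
have [delta [k [n0 [delta0 hk n00 hn0]]]] := decay_factor hp r0 rl.
have [K K0 hK] := lp_recursion delta0.
pose v n := fine (\int[P]_w (dnorm dot (rm_error n w) `^ p)%:E)%E.
have vE n : (\int[P]_w (dnorm dot (rm_error n w) `^ p)%:E)%E = (v n)%:E.
  rewrite fineK// ge0_fin_numE; last first.
    by apply: integral_ge0 => w _; rewrite lee_fin powR_ge0.
  by have [b _ hb] := lp_finite n; rewrite (le_lt_trans hb)// ltry.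
have v0 n : 0 <= v n.
  by apply: fine_ge0; apply: integral_ge0 => w _; rewrite lee_fin powR_ge0.
(* A sum of nonnegative thresholds, hence at least each of them: for [decay_factor], for
   [1 - lambda / N >= 0], for [gamma n <= 2 L'] and for a contraction by [lambda / N]. *)
pose T := n0 + lambda + gamma0 / (2 * L') +
  L * gamma0 ^+ 2 / (2 * L') / (L * gamma0 - lambda).
have t1 : 0 <= gamma0 / (2 * L') by rewrite divr_ge0 ?(ltW g0)// mulr_ge0 ?(ltW l0').
have t2 : 0 <= L * gamma0 ^+ 2 / (2 * L') / (L * gamma0 - lambda).
  apply: divr_ge0 (ltW lg); apply: divr_ge0; last by rewrite mulr_ge0// ltW.
  by rewrite mulr_ge0 ?sqr_ge0 ?(ltW l0).
have T0 : 0 <= T.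
  by apply: addr_ge0 t2; apply: addr_ge0 t1; apply: addr_ge0 n00 (ltW lam0).
have [C C0 hC] : exists2 C, 0 < C &
    forall n, (0 < n)%N -> v n <= C * n%:R `^ (- (rho * p)).
  apply: (@decay_recursion _ v (Num.bound T) k (rho * p) K) => //.
  - by rewrite mulr_ge0 ?(ltW r0) ?(ltW p0).
  - exact: ltW.
  move=> n hn; have N0 : 0 < n.+1%:R :> R by rewrite ltr0n.
  have TN : T <= n.+1%:R.
    apply: (le_trans (ltW (archi_boundP T0))).
    by rewrite ler_nat (leq_trans hn).
  have [n0N lN gN LN] : [/\ n0 <= n.+1%:R, lambda <= n.+1%:R,
      gamma0 / (2 * L') <= n.+1%:R &
      L * gamma0 ^+ 2 / (2 * L') / (L * gamma0 - lambda) <= n.+1%:R].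
    by move: TN (ltW lam0); rewrite /T; split; lra.
  have q0 : 0 <= 1 - lambda / n.+1%:R by rewrite subr_ge0 ler_pdivrMr// mul1r.
  rewrite -lee_fin -vE.
  have hq w : dnorm dot (drift n w) <= (1 - lambda / n.+1%:R) * dnorm dot (rm_error n w).
    have Dw := rm_scheme_in n w.
    apply: (contraction_le hL' (hfL Dw) (hfL' Dw)).
    - exact/ltW/gamma_gt0.
    - rewrite hgamma// ler_pdivrMr// mulrC -ler_pdivrMr ?mulr_gt0//.
    - by rewrite divr_ge0 ?(ltW lam0).
    - by rewrite ler_pdivrMr// mul1r.
    rewrite hgamma//; set N : R := n.+1%:R in N0 LN *.
    have -> : L * (gamma0 / N) * (1 - gamma0 / N / (2 * L')) =
        L * gamma0 * (1 - gamma0 / N / (2 * L')) / N by ring.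
    rewrite ler_pM2r ?invr_gt0//.
    move: LN; rewrite ler_pdivrMr// => LN.
    have e : L * gamma0 * (1 - gamma0 / N / (2 * L')) =
        L * gamma0 - L * gamma0 ^+ 2 / (2 * L') / N by ring.
    have : L * gamma0 ^+ 2 / (2 * L') / N <= L * gamma0 - lambda.
      by rewrite (ler_pdivrMr _ _ N0) [leRHS]mulrC.
    by rewrite e => h; rewrite lerBrDr addrC -lerBrDr.
  apply: (le_trans (hK n _ (v n) q0 (v0 n) hq _)); first by rewrite vE.
  rewrite lee_fin lerD2r ler_wpM2r//.
  exact: hn0.
by exists C => // n n0'; rewrite vE lee_fin hC.
Qed.

End robbins_monro.

(** * The maximal inequality on blocks *)

Section maximal_inequality.
Context {R : realType} {d : nat} {dO dS : measure_display}.
Context {Omega : measurableType dO} {S : measurableType dS}.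
Variables (P : probability Omega R) (dot : {dot 'rV[R]_d for idfun}).
Variables (D : set 'rV[R]_d) (cD : closed D) (cvD : @convex_set R 'rV[R]_d D).
Variables (p : R) (hp : 2 <= p).
Variables (I : choiceType) (X : I -> {RV P >-> S}) (A : set I).
Hypothesis hX : mutually_independent A X.
Variable lev : nat -> set I.
Hypotheses (levA : forall n, lev n `<=` A)
  (lev_disjoint : forall n k i, lev n i -> lev k i -> n = k).
Variable Z : nat -> 'rV[R]_d -> Omega -> 'rV[R]_d.
Hypothesis mZ : forall n, (0 < n)%N ->
  forall dT (T : measurableType dT) (t : T -> 'rV[R]_d) (v : T -> Omega),
  measurable_fun setT (t : T -> borel_rV R d) -> (forall x, D (t x)) ->
  measurable_fun setT (v : T -> sub_space X (lev n)) ->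
  measurable_fun setT (fun x => Z n (t x) (v x) : borel_rV R d).
Variables (theta0 : 'rV[R]_d) (Dtheta0 : D theta0) (gamma : nat -> R).
Variables (f : 'rV[R]_d -> 'rV[R]_d) (theta_star : 'rV[R]_d).
Hypothesis Dstar : D theta_star.
Variables (kappa rho K0 : R).
Hypotheses (kappa0 : 0 < kappa) (rho0 : 0 < rho) (K00 : 0 < K0).
Hypothesis drift_small : forall n theta, (0 < n)%N -> D theta ->
  dnorm dot (gamma n *: f theta) <= kappa / n%:R * dnorm dot (theta - theta_star).
Hypothesis noise_small : forall n theta, (0 < n)%N -> D theta -> exists m,
  [/\ has_vmean P (fun w => gamma n *: (Z n theta w - f theta)) m,
      dnorm dot m <= kappa * n%:R `^ (- rho) / n%:R &
      (\int[P]_w (dnorm dot (gamma n *: (Z n theta w - f theta)) `^ p)%:E <=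
        ((kappa * n%:R `^ (- rho) / Num.sqrt n%:R) `^ p)%:E)%E].

Let theta := rm_scheme dot D Z theta0 gamma.
Let err := rm_error dot D Z theta0 gamma theta_star.
Let raw := raw_error dot D Z theta0 gamma theta_star.
Hypothesis lp_small : forall n, (0 < n)%N ->
  (\int[P]_w (dnorm dot (err n w) `^ p)%:E <= (K0 * n%:R `^ (- (rho * p)))%:E)%E.

Let p0 : 0 < p. Proof. by move: (hp); lra. Qed.

Let measurable_err n :
  measurable_fun setT (err n : sub_space X (pre lev n) -> borel_rV R d).
Proof. exact: (measurable_rm_error dot cD cvD mZ Dtheta0). Qed.

Let measurable_raw n : measurable_fun setT
  (raw n : sub_space X (pre lev n) * sub_space X (lev n.+1) -> borel_rV R d).
Proof. exact: (measurable_raw_error dot cD cvD mZ Dtheta0). Qed.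

Let err_raw n w : dnorm dot (err n.+1 w) <= dnorm dot (raw n (w, w)).
Proof. exact: (rm_error_le_raw dot cD cvD Z Dtheta0 gamma Dstar). Qed.

Let c (N : nat) : R := N%:R `^ (- rho).

Let c_gt0 N : (0 < N)%N -> 0 < c N.
Proof. by move=> N0; rewrite powR_gt0// ltr0n. Qed.

(* The last summand compensates the drift, so that the sums of the increments
   form a submartingale up to a small error. *)
Let incr N n (x : Omega * Omega) : R :=
  snorm dot (c N) (raw n x) - snorm dot (c N) (err n x.1) +
  kappa / n.+1%:R * (dnorm dot (err n x.1) + c N).

Let measurable_incr N n : measurable_fun setT
  (incr N n : sub_space X (pre lev n) * sub_space X (lev n.+1) -> R).
Proof.
have me : measurable_fun setT ((fun x => err n x.1) :
    sub_space X (pre lev n) * sub_space X (lev n.+1) -> borel_rV R d).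
  exact: (measurableT_comp (@measurable_err n) measurable_fst).
apply: measurable_funD.
  apply: measurable_funB; apply: measurable_snorm; first exact: measurable_raw.
  exact: me.
apply: measurable_funM; first exact: measurable_cst.
apply: measurable_funD; last exact: measurable_cst.
exact: measurable_dnorm.
Qed.

(** The compensated process and its running maximum. Increments start at the projected error and end
    at the raw one, so the process merely dominates the smoothed error, but each increment keeps the
    additive form to which the convexity bounds apply. *)
Fixpoint block N j w : R * R :=
  if j is j'.+1 then
    let s := (block N j' w).1 + incr N (N + j') (w, w) in
    (s, Num.max (block N j' w).2 s)
  else (snorm dot (c N) (err N w), snorm dot (c N) (err N w)).

Let measurable_block N j :
  measurable_fun setT ((fun w => (block N j w).1) : sub_space X (pre lev (N + j)) -> R) /\
  measurable_fun setT ((fun w => (block N j w).2) : sub_space X (pre lev (N + j)) -> R).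
Proof.
elim: j => [|j [IH1 IH2]].
  by rewrite addn0; split; apply: measurable_snorm; exact: measurable_err.
have m1 : measurable_fun setT ((fun w => (block N j.+1 w).1) :
    sub_space X (pre lev (N + j).+1) -> R).
  apply: measurable_funD; first exact: measurable_preS IH1.
  exact: (measurable_preS_diag (@measurable_incr N (N + j))).
rewrite addnS; split => //.
by apply: measurable_maxr => //; exact: measurable_preS IH2.
Qed.

Let incr_ge N n x : (0 < N)%N ->
  snorm dot (c N) (raw n x) <= snorm dot (c N) (err n x.1) + incr N n x.
Proof.
move=> N0; rewrite /incr addrA [_ + (_ - _)]addrC subrK lerDl.
by rewrite mulr_ge0 ?divr_ge0 ?(ltW kappa0)// addr_ge0 ?dnorm_ge0// ltW// c_gt0.
Qed.

Let block_ge N j w : (0 < N)%N -> snorm dot (c N) (err (N + j) w) <= (block N j w).1.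
Proof.
move=> N0; elim: j => [|j IH]; first by rewrite addn0.
rewrite addnS /=; apply: (le_trans (snorm_homo _ (err_raw _ _))).
by apply: (le_trans (incr_ge _ (w, w) N0)); rewrite lerD2r.
Qed.

Let block_max N i j w : (i <= j)%N -> (block N i w).1 <= (block N j w).2.
Proof.
elim: j => [|j IH]; first by rewrite leqn0 => /eqP ->.
rewrite leq_eqVlt => /predU1P[->|]; first by rewrite /= le_max lexx orbT.
by rewrite ltnS => /IH h; rewrite /= le_max h.
Qed.

Let block1_ge0 N j w : (0 < N)%N -> 0 <= (block N j w).1.
Proof. by move=> N0; apply: le_trans (block_ge j w N0); exact: snorm_ge0. Qed.

Let block2_ge0 N j w : (0 < N)%N -> 0 <= (block N j w).2.
Proof. by move=> N0; apply: le_trans (block_max N w (leqnn j)); exact: block1_ge0. Qed.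

Let doob N j w := doob_fun p (block N j w).1 (block N j w).2.

Let measurable_doob N j :
  measurable_fun setT (doob N j : sub_space X (pre lev (N + j)) -> R).
Proof.
by have [m1 m2] := measurable_block N j; exact: measurable_doob_fun.
Qed.

Let doob_ge N j w : (0 < N)%N ->
  (block N j w).2 `^ p / 4 + (block N j w).1 `^ p <= doob N j w.
Proof. by move=> N0; apply: doob_fun_ge => //; [exact: block1_ge0|exact: block2_ge0]. Qed.

Let doob_ge0 N j w : (0 < N)%N -> 0 <= doob N j w.
Proof.
move=> N0; apply: le_trans (doob_ge j w N0).
by rewrite addr_ge0 ?divr_ge0 ?powR_ge0.
Qed.

(** Since [n.+1 >= N] on the block, the bounds at step [n.+1] may be weakened to the scales of the
    left end [N], which makes the factor the same for all steps. *)
Let block_step : exists2 K : R, 0 < K & forall N j (b : R), (0 < N)%N -> 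
  (\int[P]_w (doob N j w)%:E <= b%:E)%E ->
  (\int[P]_w (doob N j.+1 w)%:E <=
    ((1 + K / N%:R) * b + K / N%:R * c N `^ p)%:E)%E.
Proof.
have [K Kp hK] := doob_step P dot hp kappa0.
exists K => // N j b N0 hb.
have NR : 0 < N%:R :> R by rewrite ltr0n.
set n := (N + j)%N.
have n1R : 0 < n.+1%:R :> R by rewrite ltr0n.
have n1 : 1 <= n.+1%:R :> R by rewrite ler1n.
have Nn : N%:R <= n.+1%:R :> R by rewrite ler_nat leqW// leq_addr.
have cN := c_gt0 N0.
have cn : n.+1%:R `^ (- rho) <= c N.
  rewrite /c !powRN lef_pV2 ?posrE ?powR_gt0//.
  by rewrite ler_powR2r ?(ltW rho0) ?(ltW NR).
pose phi (x : Omega * Omega) := doob_fun p ((block N j x.1).1 + incr N n x)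
   (Num.max (block N j x.1).2 ((block N j x.1).1 + incr N n x)).
have a0 : 0 <= 1 + K / N%:R by rewrite addr_ge0// divr_ge0// ltW.
have b0 : 0 <= K / N%:R * c N `^ p.
  by rewrite mulr_ge0 ?powR_ge0// divr_ge0// ltW.
have mdoob := @measurable_doob N j.
apply: (le_trans _ (integral_affine_le (fun w => doob_ge0 j w N0)
  (measurable_sub_space mdoob) a0 b0 hb)).
have [mb1 mb2] := measurable_block N j.
have mS : measurable_fun setT ((fun x => (block N j x.1).1 + incr N n x) :
    sub_space X (pre lev n) * sub_space X (lev n.+1) -> R).
  apply: measurable_funD; last exact: measurable_incr.
  exact: (measurableT_comp mb1 measurable_fst).
have mphi : measurable_fun setT
    (phi : sub_space X (pre lev n) * sub_space X (lev n.+1) -> R).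
  apply: measurable_doob_fun => //; apply: measurable_maxr => //.
  exact: (measurableT_comp mb2 measurable_fst).
have phi0 x : 0 <= phi x.
  have s0 : 0 <= (block N j x.1).1 + incr N n x.
    apply: le_trans (snorm_ge0 dot (c N) (raw n x)) _.
    by apply: (le_trans (incr_ge n x N0)); rewrite lerD2r block_ge.
  have m0 : 0 <= Num.max (block N j x.1).2 ((block N j x.1).1 + incr N n x).
    by rewrite le_max s0 orbT.
  apply: le_trans (doob_fun_ge hp s0 m0).
  by rewrite addr_ge0 ?divr_ge0 ?powR_ge0.
pose g w := (1 + K / N%:R) * doob N j w + K / N%:R * c N `^ p.
have g0 w : 0 <= g w by rewrite addr_ge0// mulr_ge0// doob_ge0.
have mg : measurable_fun setT (g : sub_space X (pre lev n) -> R).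
  apply: measurable_funD; last exact: measurable_cst.
  by apply: measurable_funM => //; exact: measurable_cst.
apply: (rm_step hX levA lev_disjoint mphi phi0 mg g0) => w1.
have Dt := rm_scheme_in dot cD Z Dtheta0 gamma n w1.
have [m [hm hmm hmp]] := noise_small (ltn0Sn n) Dt.
have rE w2 : raw n (w1, w2) = (err n w1 + gamma n.+1 *: f (theta n w1)) +
    gamma n.+1 *: (Z n.+1 (theta n w1) w2 - f (theta n w1)).
  rewrite /raw /raw_error /= -[RHS]addrA; congr (_ + _).
  by rewrite -scalerDr (addrC (f _)) subrK.
rewrite /phi /incr /=; under eq_integral do rewrite rE.
have hd : dnorm dot ((err n w1 + gamma n.+1 *: f (theta n w1)) - err n w1) <=
    kappa / n.+1%:R * dnorm dot (err n w1).
  by rewrite addrAC subrr add0r; exact: drift_small.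
have hm2 : dnorm dot m <= kappa * c N / n.+1%:R.
  by apply: (le_trans hmm); rewrite ler_pM2r ?invr_gt0// ler_pM2l.
have sn0 : 0 < Num.sqrt n.+1%:R :> R by rewrite sqrtr_gt0.
have hmp2 : (\int[P]_w (dnorm dot (gamma n.+1 *: (Z n.+1 (theta n w1) w - f (theta n w1))) `^ p)%:E <=
    ((kappa * c N / Num.sqrt n.+1%:R) `^ p)%:E)%E.
  apply: (le_trans hmp); rewrite lee_fin; apply: ler_powR2r; first exact: ltW.
    by rewrite divr_ge0 ?(ltW sn0)// mulr_ge0 ?powR_ge0// ltW.
  by rewrite ler_pM2r ?invr_gt0// ler_pM2l.
apply: (le_trans (hK (err n w1) _ _ m n.+1%:R (c N) _ _ _ n1 cN hm hd hm2 hmp2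
  (block_ge j w1 N0) (block2_ge0 j w1 N0) erefl)).
rewrite lee_fin /g.
have S0 : 0 <= (block N j w1).1 `^ p + c N `^ p by rewrite addr_ge0 ?powR_ge0.
have h1 : K / n.+1%:R * ((block N j w1).1 `^ p + c N `^ p) <=
    K / N%:R * ((block N j w1).1 `^ p + c N `^ p).
  by rewrite ler_wpM2r// ler_pM2l// lef_pV2 ?posrE.
have h2 : K / N%:R * (block N j w1).1 `^ p <= K / N%:R * doob N j w1.
  rewrite ler_wpM2l ?divr_ge0 ?(ltW Kp)//; apply: le_trans (doob_ge j w1 N0).
  by rewrite lerDr divr_ge0 ?powR_ge0.
move: h1 h2; rewrite /doob; set F := doob_fun _ _ _; set B := K / N%:R.
rewrite (mulrDr B) => h1 h2; rewrite mulrDl mul1r; apply: (le_trans (lerD (lexx F) h1)).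
by move: h2; lra.
Qed.

Let block_doob : exists2 K : R, 0 < K & forall N, (0 < N)%N ->
  (\int[P]_w (doob N N w)%:E <= (K * c N `^ p)%:E)%E.
Proof.
have [K Kp hK] := block_step.
(* For the initial value: at [S = m = s] Burkholder's function is at most
   [(1 + (4^(p - 1) + 1)) s^p], and [s] is at most the norm of the error plus [c N]. *)
pose A0 := (1 + (4 `^ (p - 1) + 1)) * 2 `^ p.
have A00 : 0 < A0 by rewrite mulr_gt0 ?powR_gt0// !addr_gt0// powR_gt0.
exists (expR K * (A0 * K0 + A0 + 1)) => [|N N0].
  by rewrite mulr_gt0 ?expR_gt0// !addr_gt0// mulr_gt0.
have NR : 0 < N%:R :> R by rewrite ltr0n.
have cN := c_gt0 N0.
have cp : 0 < c N `^ p by rewrite powR_gt0.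
set U := A0 * K0 + A0 + 1.
have base : (\int[P]_w (doob N 0 w)%:E <= (A0 * (K0 * c N `^ p) + A0 * c N `^ p)%:E)%E.
  have mp : measurable_fun setT ((fun w => dnorm dot (err N w) `^ p) : Omega -> R).
    apply: (measurableT_comp (measurable_powR p)); apply: measurable_dnorm.
    exact: measurable_sub_space (@measurable_err N).
  have A01 : 0 <= A0 * c N `^ p by rewrite mulr_ge0// ltW.
  have hl : (\int[P]_w (dnorm dot (err N w) `^ p)%:E <= (K0 * c N `^ p)%:E)%E.
    by rewrite /c -powRrM mulNr; exact: lp_small.
  apply: (le_trans _ (integral_affine_le (fun w => powR_ge0 _ _) mp (ltW A00) A01 hl)).
  apply: ge0_le_integral => //.
  - by move=> w _; rewrite lee_fin doob_ge0.
  - apply/measurable_EFinP; have := measurable_sub_space (@measurable_doob N 0).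
    by [].
  - apply/measurable_EFinP; apply: measurable_funD; last exact: measurable_cst.
    by apply: measurable_funM => //; exact: measurable_cst.
  - move=> w _; rewrite lee_fin /doob /=; set s := snorm _ _ _.
    have s0 : 0 <= s by exact: snorm_ge0.
    have sp : s `^ p <= 2 `^ p * (dnorm dot (err N w) `^ p + c N `^ p).
      apply: le_trans (powRD_le (ltW p0) (dnorm_ge0 _ _) (ltW cN)).
      apply: ler_powR2r; [exact: ltW|exact: s0|exact: (snorm_le dot cN)].
    have d1 : doob_fun p s s <= (1 + (4 `^ (p - 1) + 1)) * s `^ p.
      have e1 : s `^ (p - 1) * s = s `^ p by rewrite powR_mulB1.
      have e2 : (p - 1) / p <= 1.
        by rewrite ler_pdivrMr// mul1r gerBl.
      rewrite /doob_fun e1; have sp0 : 0 <= s `^ p by exact: powR_ge0.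
      have e3 := ler_wpM2r sp0 e2; lra.
    apply: (le_trans d1); rewrite -mulrDr /A0 -mulrA ler_wpM2l//.
have q1 : 0 <= 1 + K / N%:R by rewrite addr_ge0// divr_ge0// ltW.
(* Adding [c N ^ p] turns the affine recursion into multiplication by [1 + K / N]; after [N] steps
   the factor is at most [expR K]. *)
have rec j : (\int[P]_w (doob N j w)%:E <=
    ((1 + K / N%:R) ^+ j * (U * c N `^ p) - c N `^ p)%:E)%E.
  elim: j => [|j IH].
    apply: (le_trans base); rewrite lee_fin expr0 mul1r /U; lra.
  apply: (le_trans (hK N j _ N0 IH)); rewrite lee_fin exprS.
  by rewrite le_eqVlt; apply/orP; left; apply/eqP; ring.
apply: (le_trans (rec N)); rewrite lee_fin.
apply: (@le_trans _ _ ((1 + K / N%:R) ^+ N * (U * c N `^ p))).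
  by rewrite gerBl ltW.
rewrite -(mulrA (expR K)) ler_wpM2r//.
  by rewrite mulr_ge0 ?(ltW cp)// /U !addr_ge0 ?mulr_ge0// ltW.
apply: (@le_trans _ _ (expR (K / N%:R) ^+ N)).
  by rewrite lerXn2r ?nnegrE ?expR_ge0// expR_ge1Dx.
by rewrite -expRM_natl mulrC divfK ?gt_eqF.
Qed.

Lemma block_sup : exists W : nat -> Omega -> R, exists2 K : R, 0 < K &
  forall N, (0 < N)%N -> [/\ measurable_fun setT (W N), forall w, 0 <= W N w,
    forall k w, (N <= k <= N + N)%N -> dnorm dot (rm_error dot D Z theta0 gamma theta_star k w) <= W N w &
    (\int[P]_w (W N w `^ p)%:E <= (K * N%:R `^ (- (rho * p)))%:E)%E].
Proof.
have [K Kp hK] := block_doob.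
(* The running maximum is the measurable majorant; the factor 4 undoes the quarter of [m^p] kept in
   [doob_fun_ge]. *)
exists (fun N w => (block N N w).2), (4 * K) => [|N N0]; first by rewrite mulr_gt0.
have [_ m2] := measurable_block N N.
have mb : measurable_fun setT ((fun w => (block N N w).2) : Omega -> R).
  exact: measurable_sub_space m2.
split => //.
- by move=> w; exact: block2_ge0.
- move=> k w /andP[Nk kN]; rewrite -(subnKC Nk).
  apply: le_trans (snorm_ge_dnorm dot (c N) _) _.
  apply: (le_trans (block_ge _ w N0)); apply: block_max.
  by rewrite leq_subLR.
have h4 : (0:R) <= 4 by [].
have mdo : measurable_fun setT (doob N N : Omega -> R).
  exact: measurable_sub_space (@measurable_doob N N).
have := integral_affine_le (fun w => doob_ge0 N w N0) mdo h4 (lexx 0) (hK N N0).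
have -> : 4 * K * N%:R `^ (- (rho * p)) = 4 * (K * c N `^ p) + 0.
  by rewrite addr0 mulrA /c -powRrM mulNr.
apply: le_trans; apply: ge0_le_integral => //.
- by move=> w _; rewrite lee_fin powR_ge0.
- by apply/measurable_EFinP; exact: (measurableT_comp (measurable_powR p)).
- apply/measurable_EFinP; apply: measurable_funD; last exact: measurable_cst.
  by apply: measurable_funM => //; exact: measurable_cst.
- move=> w _; rewrite lee_fin addr0; have := doob_ge N w N0.
  have := powR_ge0 (block N N w).1 p; lra.
Qed.

End maximal_inequality.

(** * Maximal decay from block estimates *)

Lemma dyadic_block (n k : nat) : (0 < n)%N -> (n <= k)%N ->
  exists i, (2 ^ i * n <= k <= 2 ^ i * n + 2 ^ i * n)%N.
Proof.
move=> n0 nk; have q0 : (0 < k %/ n)%N by rewrite divn_gt0.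
exists (trunc_log 2 (k %/ n)); apply/andP; split.
  by rewrite -leq_divRL// trunc_logP.
rewrite addnn -mul2n mulnA -expnS ltnW// -ltn_divLR//.
exact: trunc_log_ltn.
Qed.

Lemma nneseries_geometric_le (R : realType) (a q : R) : 0 <= a -> 0 <= q -> q < 1 ->
  (\sum_(0 <= i <oo) (a * q ^+ i)%:E <= (a / (1 - q))%:E)%E.
Proof.
move=> a0 q0 q1; apply: lime_le.
  by apply: is_cvg_nneseries => i _ _; rewrite lee_fin mulr_ge0// exprn_ge0.
apply: nearW => m; rewrite sumEFin lee_fin big_mkord -mulr_sumr ler_wpM2l//.
rewrite -[leRHS]mul1r ler_pdivlMr ?subr_gt0//.
have := subrX1 q m; rewrite -(opprB 1 q) => e.
have := exprn_ge0 m q0; lra.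
Qed.

Section maximal_decay.
Context {R : realType} {dO : measure_display} {Omega : measurableType dO}.
Variables (P : probability Omega R) (e : nat -> Omega -> R).
Variables (p rho : R) (p0 : 0 < p) (W : nat -> Omega -> R) (K : R) (K0 : 0 < K).
Hypotheses (e0 : forall n w, 0 <= e n w) (me : forall n, measurable_fun setT (e n)).
Hypothesis block_sup : forall N, (0 < N)%N -> [/\ measurable_fun setT (W N),
  forall w, 0 <= W N w,
  forall k w, (N <= k <= N + N)%N -> e k w <= W N w &
  (\int[P]_w (W N w `^ p)%:E <= (K * N%:R `^ (- (rho * p)))%:E)%E].
Variables (eta : R) (eta0 : 0 < eta) (eta_rho : eta < rho).

Definition weighted_sup n w : \bar R := ereal_sup
  [set ((k%:R `^ (eta * p) * e k w `^ p)%R)%:E | k in [set k | (n <= k)%N]].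

Lemma measurable_weighted_sup n : measurable_fun setT (weighted_sup n).
Proof.
apply: (@measurable_fun_esups _ _ _ setT
  (fun k w => ((k%:R `^ (eta * p) * e k w `^ p)%R)%:E)) => k.
apply/measurable_EFinP; apply: measurable_funM; first exact: measurable_cst.
exact: (measurableT_comp (measurable_powR p)).
Qed.

Lemma weighted_sup_ge n k w : (n <= k)%N ->
  ((k%:R `^ (eta * p) * e k w `^ p)%:E <= weighted_sup n w)%E.
Proof. by move=> nk; apply: ereal_sup_ubound; exists k. Qed.

Lemma weighted_sup_ge0 n w : (0 <= weighted_sup n w)%E.
Proof.
apply: le_trans (weighted_sup_ge w (leqnn n)).
by rewrite lee_fin mulr_ge0 ?powR_ge0.
Qed.

Lemma integral_weighted_sup_le : exists2 C : R, 0 < C & forall n, (0 < n)%N ->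
  (\int[P]_w weighted_sup n w <= (C * n%:R `^ (- ((rho - eta) * p)))%:E)%E.
Proof.
pose q : R := 2 `^ (- ((rho - eta) * p)).
have s0 : 0 < (rho - eta) * p by rewrite mulr_gt0// subr_gt0.
have q0 : 0 < q by rewrite powR_gt0.
have q1 : q < 1.
  by rewrite /q powRN invf_lt1 ?powR_gt0// powR_gt1// ltr1n.
have c0 : 0 < 2 `^ (eta * p) * K by rewrite mulr_gt0 ?powR_gt0.
exists (2 `^ (eta * p) * K / (1 - q)) => [|n n0]; first by rewrite divr_gt0 ?subr_gt0.
pose N i := (2 ^ i * n)%N.
have N0 i : (0 < N i)%N by rewrite muln_gt0 expn_gt0.
have NR i : 0 < (N i)%:R :> R by rewrite ltr0n.
(* The weight is evaluated at the right end [2 N i] of the block, which costs the constant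
   [2^(eta p)]. The weighted block moment then has the exponent [- (rho - eta) p], with ratio [q]
   from one block to the next. *)
pose a i : R := (2 * (N i)%:R) `^ (eta * p).
pose g i w := ((a i * W (N i) w `^ p)%R)%:E.
have a0 i : 0 <= a i by rewrite powR_ge0.
have g0 i w : (0 <= g i w)%E by rewrite lee_fin mulr_ge0 ?powR_ge0.
have mWp i : measurable_fun setT (fun w => W (N i) w `^ p).
  by have [mW _ _ _] := block_sup (N0 i); exact: (measurableT_comp (measurable_powR p)).
have mg i : measurable_fun setT (g i).
  apply/measurable_EFinP; apply: measurable_funM => //; exact: measurable_cst.
have dom w : (weighted_sup n w <= \sum_(0 <= i <oo) g i w)%E.
  apply: ub_ereal_sup => _ [k /= nk <-].
  have [i hi] := dyadic_block n0 nk.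
  have [_ W0 We _] := block_sup (N0 i).
  apply: (@le_trans _ _ (g i w)).
    rewrite lee_fin; apply: ler_pM; rewrite ?powR_ge0//.
      apply: ler_powR2r => //; first by rewrite mulr_ge0 ?(ltW p0)// ltW.
      by move: hi => /andP[_]; rewrite addnn -mul2n -(ler_nat R) natrM.
    by apply: ler_powR2r; [exact: ltW|exact: e0|exact: We].
  apply: le_trans (nneseries_lim_ge i.+1 _) => //.
  by rewrite big_nat_recr//= leeDr// sume_ge0.
apply: (@le_trans _ _ (\int[P]_w \sum_(0 <= i <oo) g i w)%E).
  apply: ge0_le_integral => //.
  - by move=> w _; exact: weighted_sup_ge0.
  - exact: measurable_weighted_sup.
  - by apply: ge0_emeasurable_sum.
rewrite integral_nneseries//.
have -> : 2 `^ (eta * p) * K / (1 - q) * n%:R `^ (- ((rho - eta) * p)) =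
    2 `^ (eta * p) * K * n%:R `^ (- ((rho - eta) * p)) / (1 - q) by rewrite mulrAC.
apply: le_trans (nneseries_geometric_le _ (ltW q0) q1); last first.
  by rewrite mulr_ge0 ?powR_ge0// ltW.
apply: lee_nneseries => [i _ _|i _]; first by apply: integral_ge0.
have [_ _ _ hW] := block_sup (N0 i).
rewrite /g; under eq_integral do rewrite -[(a i * _)%R]addr0.
apply: (le_trans (integral_affine_le (fun w => powR_ge0 _ _) (mWp i) (a0 i) (lexx 0) hW)).
rewrite lee_fin addr0 /a powRM// le_eqVlt; apply/orP; left; apply/eqP.
have e1 : (N i)%:R `^ (eta * p) * (N i)%:R `^ (- (rho * p)) =
    (N i)%:R `^ (- ((rho - eta) * p)) :> R.
  by rewrite -powR_gtD//; congr (_ `^ _); ring.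
have e2 : (N i)%:R `^ (- ((rho - eta) * p)) = q ^+ i * n%:R `^ (- ((rho - eta) * p)).
  rewrite natrM powRM// natrX /q; congr (_ * _).
  by rewrite -powR_mulrn// -powRrM mulrC powRrM powR_mulrn ?powR_ge0.
transitivity (2 `^ (eta * p) * K *
  ((N i)%:R `^ (eta * p) * (N i)%:R `^ (- (rho * p)))); first by ring.
by rewrite e1 e2; ring.
Qed.

Lemma weighted_sup_ae : {ae P, forall w, weighted_sup 1 w \is a fin_num}.
Proof.
have [C C0 hC] := integral_weighted_sup_le.
have iS : P.-integrable setT (weighted_sup 1).
  apply/integrableP; split; first exact: measurable_weighted_sup.
  under eq_integral do rewrite gee0_abs ?weighted_sup_ge0//.
  by rewrite (le_lt_trans (hC 1%N isT))// ltry.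
have := integrable_ae measurableT iS.
by apply: filterS => w; apply.
Qed.

(** A finite weighted supremum bounds [n^eta * e n w] along the path, and the spare power [n^(- x)]
    with [x = eta - (rho - delta)] tends to zero. *)
Lemma cvg_of_weighted_sup w delta : rho - delta < eta -> weighted_sup 1 w \is a fin_num ->
  (fun n => n%:R `^ (rho - delta) * e n w) @ \oo --> (0 : R).
Proof.
move=> hd hs; pose s := fine (weighted_sup 1 w).
have s0 : 0 <= s by rewrite fine_ge0// weighted_sup_ge0.
pose t := s `^ p^-1.
have t0 : 0 <= t by exact: powR_ge0.
pose x := eta - (rho - delta); have x0 : 0 < x by rewrite subr_gt0.
have ub n : (0 < n)%N -> n%:R `^ (rho - delta) * e n w <= t * n%:R `^ (- x).
  move=> n0; have nR : 0 < n%:R :> R by rewrite ltr0n.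
  have := weighted_sup_ge w n0; rewrite -[X in (_ <= X)%E]fineK// lee_fin -/s => h.
  have : n%:R `^ eta * e n w <= t.
    have -> : n%:R `^ eta * e n w = (n%:R `^ (eta * p) * e n w `^ p) `^ p^-1.
      rewrite powRrM -powRM ?powR_ge0// -powRrM mulfV ?gt_eqF// powRr1//.
      by rewrite mulr_ge0 ?powR_ge0.
    by apply: ler_powR2r => //; [rewrite invr_ge0 ltW|rewrite mulr_ge0 ?powR_ge0].
  move=> h2; have -> : n%:R `^ (rho - delta) = n%:R `^ (- x) * n%:R `^ eta.
    by rewrite -powR_gtD//; congr (_ `^ _); rewrite /x; ring.
  by rewrite -mulrA mulrC ler_pM2r ?powR_gt0.
apply/cvgrPdist_lt => eps eps0.
near=> n.
have n0 : (0 < n)%N by near: n; exact: nbhs_infty_gt.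
have nR : 0 < n%:R :> R by rewrite ltr0n.
rewrite sub0r normrN ger0_norm ?mulr_ge0 ?powR_ge0//.
apply: (le_lt_trans (ub n n0)); rewrite powRN ltr_pdivrMr ?powR_gt0// mulrC.
rewrite -ltr_pdivrMr//.
have tn : (t / eps) `^ x^-1 < n%:R by near: n; exact: nbhs_infty_gtr.
have te0 : 0 <= t / eps by rewrite divr_ge0// ltW.
have -> : t / eps = ((t / eps) `^ x^-1) `^ x.
  by rewrite -powRrM mulVf ?gt_eqF// powRr1.
by apply: gt0_ltr_powR; rewrite ?nnegrE ?powR_ge0// ltW.
Unshelve. all: by end_near.
Qed.

End maximal_decay.

(** * Computational cost *)

Lemma powR_ge1 (R : realType) (a s : R) : 1 <= a -> 0 <= s -> 1 <= a `^ s.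
Proof. by move=> a1 s0; rewrite -[leLHS](powRr0 a) ler_powR. Qed.

Lemma cross_sum_le (R : realDomainType) (a b u v : R) :
  0 <= a * v -> 0 <= b * u -> a * u + b * v <= (a + b) * (u + v).
Proof. by move=> *; rewrite mulrDl !mulrDr lerD ?lerDl ?lerDr. Qed.

Section one_step_cost.
Context {R : realType} {d : nat}.
Variables (dot : {dot 'rV[R]_d for idfun}) (D : set 'rV[R]_d).
Variables (p : R) (hp : 2 <= p) (Gamma1 Gamma2 : 'rV[R]_d -> R).
Hypotheses (hG1pos : forall theta, D theta -> 0 < Gamma1 theta)
  (hG2pos : forall theta, D theta -> 0 < Gamma2 theta).
Variables (M K K1 alpha beta beta1 : R).
Hypotheses (hM : 1 < M) (hK : 0 < K) (hK1 : 0 < K1) (halpha : 0 < alpha).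
Hypotheses (hbeta1 : beta != 2^-1 -> 0 <= beta1 <= Num.min beta 2^-1)
  (hbeta1' : beta = 2^-1 -> 0 <= beta1 < 2^-1).
Variable C : nat -> R.
Hypotheses (hC : forall k, (0 < k)%N -> 0 < C k)
  (hiii : forall k, (0 < k)%N -> C k <= K * M ^+ k).
Hypotheses
  (hiv1 : forall theta, D theta ->
     Gamma1 theta <= K1 * (1 + dnorm dot theta) `^ (beta1 * p))
  (hiv2 : forall theta, D theta ->
     Gamma2 theta <= K1 * (1 + dnorm dot theta) `^ (alpha * p)).
Variables (r sigma0 eps0 rho : R) (sigma eps : nat -> R).
Hypotheses (hr : -1 < r) (hsigma0 : 0 < sigma0) (heps0 : 0 < eps0)
  (hrho : rho = 2^-1 * (1 + r))
  (hsigma_pos : forall n, (0 < n)%N -> 0 < sigma n)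
  (hsigma : forall n, (0 < n)%N -> sigma n ^+ 2 = sigma0 ^+ 2 / n%:R `^ r)
  (heps : forall n, (0 < n)%N -> eps n = eps0 / n%:R `^ rho).

Let m := max_level Gamma2 M alpha eps.
Let N := repl Gamma1 Gamma2 M alpha beta eps sigma.
Let rho0 : 0 < rho. Proof. by move: (hr) (hrho); lra. Qed.
Let p0 : 0 < p. Proof. by move: (hp); lra. Qed.
Let M0 : 0 < M. Proof. exact: lt_trans hM. Qed.
Let eps_gt0 n : (0 < n)%N -> 0 < eps n.
Proof. by move=> n0; rewrite heps// divr_gt0// powR_gt0// ltr0n. Qed.

(** Rounding raises each replication number by at most 1. The unrounded part produces [level_weight]
    twice, once from [kappa] and once from summing against the cost [M^k]; the rounding produces a
    geometric sum of order [M^m]. *)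
Lemma step_cost_le : exists2 B : R, 0 < B & forall n theta, (0 < n)%N -> D theta ->
  \sum_(1 <= k < (m n theta).+1) (N n k theta)%:R * C k <=
  B * ((Gamma1 theta / sigma n) ^+ 2 * level_weight M beta (m n theta) ^+ 2 +
       M `^ (m n theta)%:R).
Proof.
have [K2 K20 hK2] := level_sum_le beta hM.
have c2 : 0 < M / (M - 1) by rewrite divr_gt0// subr_gt0.
exists (K * K2 + K * (M / (M - 1))) => [|n theta n0 Dt].
  by rewrite addr_gt0// mulr_gt0.
set lw := level_weight _ _ _; set x := (Gamma1 theta / sigma n) ^+ 2.
have x0 : 0 <= x by exact: sqr_ge0.
have lw0 : 0 < lw by apply: level_weight_gt0 => //; exact: max_level_gt0.
have Mm0 : 0 <= M `^ (m n theta)%:R by exact: powR_ge0.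
apply: (@le_trans _ _ (\sum_(1 <= k < (m n theta).+1)
    (K * (x * lw) * M `^ (k%:R * (2^-1 - beta)) + K * M ^+ k))).
  rewrite big_nat_cond [leRHS]big_nat_cond; apply: ler_sum => k.
  rewrite andbT => /andP[k1 _].
  have h1 : (N n k theta)%:R <=
      x * lw * M `^ (- (k%:R * (beta + 2^-1))) + 1.
    have := @repl_le _ _ Gamma1 Gamma2 M alpha beta eps sigma hM n theta
      (hG1pos Dt) (hsigma_pos n0) k.
    by rewrite repl_factorE.
  apply: (@le_trans _ _ ((x * lw * M `^ (- (k%:R * (beta + 2^-1))) + 1) * (K * M ^+ k))).
    by apply: ler_pM => //; [exact/ltW/hC|exact: hiii].
  have e : M `^ (- (k%:R * (beta + 2^-1))) * M ^+ k = M `^ (k%:R * (2^-1 - beta)).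
    rewrite -powR_mulrn ?(ltW M0)// -powR_gtD//; congr (_ `^ _).
    by field.
  by rewrite -e le_eqVlt; apply/orP; left; apply/eqP; ring.
rewrite big_split /= -!mulr_sumr.
have s1 := hK2 (m n theta); have s2 := geometric_sum_gt1 (m n theta) hM.
have e : M ^+ m n theta = M `^ (m n theta)%:R by rewrite powR_mulrn// ltW.
rewrite e in s2.
have y0 : 0 <= K * (x * lw) by rewrite mulr_ge0 ?(ltW hK)// mulr_ge0// ltW.
have t1 := ler_wpM2l y0 s1; have t2 := ler_wpM2l (ltW hK) s2.
apply: (le_trans (lerD t1 t2)).
have z1 : 0 <= K * K2 * M `^ (m n theta)%:R by rewrite !mulr_ge0// ltW.
have z2 : 0 <= K * (M / (M - 1)) * (x * lw ^+ 2).
  apply: mulr_ge0; first by rewrite mulr_ge0 ?(ltW hK) ?(ltW c2).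
  by rewrite mulr_ge0// exprn_ge0// ltW.
rewrite -/lw; have -> : K * (x * lw) * (K2 * lw) = K * K2 * (x * lw ^+ 2) by ring.
by rewrite (mulrA K (M / _)); exact: cross_sum_le.
Qed.

Let X theta : R := 1 + dnorm dot theta.
Let X1 theta : 1 <= X theta. Proof. by rewrite lerDl dnorm_ge0. Qed.
Let X0 theta : 0 < X theta. Proof. exact: lt_le_trans (X1 _). Qed.

Let ratio_le n theta : (0 < n)%N -> D theta ->
  Gamma2 theta / eps n <= K1 / eps0 * (X theta `^ (alpha * p) * n%:R `^ rho).
Proof.
move=> n0 Dt; have nR : 0 < n%:R :> R by rewrite ltr0n.
rewrite heps// invfM invrK.
apply: (@le_trans _ _ (K1 * X theta `^ (alpha * p) * (eps0^-1 * n%:R `^ rho))).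
  rewrite ler_pM2r; first exact: hiv2.
  by rewrite mulr_gt0 ?invr_gt0 ?powR_gt0.
by rewrite le_eqVlt; apply/orP; left; apply/eqP; ring.
Qed.

(** Up to a factor [M], the left side is at most the larger of 1 and
    [(Gamma2 theta / eps n)^(1 / alpha)]; the growth exponent [alpha p] of [Gamma2] is exactly what
    leaves a moment of order [p]. *)
Lemma powR_level_le : exists2 B : R, 0 < B & forall n theta, (0 < n)%N -> D theta ->
  M `^ (m n theta)%:R <= B * (X theta `^ p * n%:R `^ (rho / alpha)).
Proof.
pose c := (K1 / eps0) `^ alpha^-1.
have c0 : 0 <= c by exact: powR_ge0.
exists (M * (1 + c)) => [|n theta n0 Dt].
  by rewrite mulr_gt0// ltr_wpDr.
have nR : 0 < n%:R :> R by rewrite ltr0n.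
have g0 : 0 < Gamma2 theta / eps n by rewrite divr_gt0 ?hG2pos ?eps_gt0.
set y := X theta `^ p * _.
have y1 : 1 <= y.
  rewrite -[leLHS]mulr1; apply: ler_pM => //.
    by rewrite powR_ge1// ltW.
  rewrite powR_ge1 ?ler1n//.
  by rewrite divr_ge0 ?(ltW rho0) ?ltW.
set x := alpha^-1 * (ln (Gamma2 theta / eps n) / ln M).
have lnM0 : 0 < ln M by rewrite ln_gt0.
have xE : M `^ x = (Gamma2 theta / eps n) `^ alpha^-1.
  rewrite /powR !gt_eqF// /x; congr expR.
  by rewrite -mulrA divfK// gt_eqF.
have h1 : M `^ (m n theta)%:R <= M * M `^ Num.max 0 x.
  rewrite -[X in X * _](powRr1 (ltW M0)) -powR_gtD//.
  by rewrite ler_powR ?(ltW hM)//; exact: max_level_le.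
apply: (le_trans h1); rewrite -mulrA ler_pM2l//.
have h2 : M `^ x <= c * y.
  rewrite xE /c /y.
  have -> : X theta `^ p * n%:R `^ (rho / alpha) =
      (X theta `^ (alpha * p) * n%:R `^ rho) `^ alpha^-1.
    rewrite powRM ?powR_ge0// -!powRrM; congr (_ `^ _ * _).
    by field; rewrite gt_eqF.
  have k0 : 0 <= K1 / eps0 by rewrite divr_ge0 ?ltW.
  have z0 : 0 <= X theta `^ (alpha * p) * n%:R `^ rho by rewrite mulr_ge0 ?powR_ge0.
  rewrite -powRM//.
  apply: ler_powR2r; rewrite ?invr_ge0 ?(ltW halpha) ?(ltW g0)//.
  exact: ratio_le.
have cy : 0 <= c * y by rewrite mulr_ge0// (le_trans ler01).
rewrite mulrDl mul1r; case: (leP 0 x) => x0.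
  by apply: (le_trans h2); rewrite lerDr (le_trans ler01).
by rewrite powRr0 ler_wpDr.
Qed.

(** The rate for a single step; multiplied by the number of steps it becomes the bound of the
    theorem. *)
Definition cost_rate (n : nat) : R :=
  if 2^-1 < beta then n%:R `^ r
  else if beta == 2^-1 then n%:R `^ r * ln n.+1%:R ^+ 2
  else n%:R `^ (r + rho * (1 - 2 * beta) / alpha).

Let Gamma1_le n theta : (0 < n)%N -> D theta ->
  (Gamma1 theta / sigma n) ^+ 2 <=
  K1 ^+ 2 / sigma0 ^+ 2 * (X theta `^ (2 * beta1 * p) * n%:R `^ r).
Proof.
move=> n0 Dt; have nR : 0 < n%:R :> R by rewrite ltr0n.
rewrite expr_div_n hsigma// invfM invrK.
have h : Gamma1 theta ^+ 2 <= K1 ^+ 2 * X theta `^ (2 * beta1 * p).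
  have -> : K1 ^+ 2 * X theta `^ (2 * beta1 * p) =
      (K1 * X theta `^ (beta1 * p)) ^+ 2.
    rewrite exprMn -(powR_mulrn 2 (powR_ge0 _ _)) -powRrM.
    by congr (_ * _ `^ _); ring.
  rewrite lerXn2r ?nnegrE ?(ltW (hG1pos Dt))//; last exact: hiv1.
  by rewrite mulr_ge0 ?powR_ge0// ltW.
apply: (@le_trans _ _ (K1 ^+ 2 * X theta `^ (2 * beta1 * p) * ((sigma0 ^+ 2)^-1 * n%:R `^ r))).
  by rewrite ler_pM2r// mulr_gt0 ?invr_gt0 ?exprn_gt0 ?powR_gt0.
by rewrite le_eqVlt; apply/orP; left; apply/eqP; ring.
Qed.

Let ln2_gt0 : 0 < ln 2 :> R. Proof. by rewrite ln_gt0 ?ltr1n. Qed.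

Let lnS_ge n : (0 < n)%N -> ln 2 <= ln n.+1%:R :> R.
Proof. by move=> n0; rewrite ler_ln ?posrE ?ltr0n// ler_nat. Qed.

(** The logarithm of the parameter's size grows slower than any power, so an arbitrarily small order
    [s] suffices. Constants are absorbed through [ln n.+1 >= ln 2], which would fail for [ln n] at
    [n = 1]. *)
Let level_log_le s : 0 < s -> exists2 B : R, 0 < B &
  forall n theta, (0 < n)%N -> D theta ->
  (m n theta)%:R <= B * (X theta `^ s * ln n.+1%:R).
Proof.
move=> s0; have lnM0 : 0 < ln M by rewrite ln_gt0.
pose A0 : R := `|ln (K1 / eps0)|.
pose w := alpha^-1 / ln M.
have w0 : 0 < w by rewrite divr_gt0 ?invr_gt0.
have A00 : 0 <= A0 by exact: normr_ge0.
pose B := (1 + w * A0 + w * (alpha * p) / s) / ln 2 + w * rho.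
exists B => [|n theta n0 Dt].
  have : 0 < w * rho by rewrite mulr_gt0.
  have : 0 <= w * (alpha * p) / s by rewrite !mulr_ge0 ?invr_ge0 ?(ltW p0)// ltW.
  have : 0 <= w * A0 by rewrite mulr_ge0// ltW.
  move=> h1 h2 h3; rewrite /B ltr_wpDl// divr_ge0 ?(ltW ln2_gt0)//.
  by rewrite !addr_ge0.
have nR : 0 < n%:R :> R by rewrite ltr0n.
have g0 : 0 < Gamma2 theta / eps n by rewrite divr_gt0 ?hG2pos ?eps_gt0.
set Y := X theta `^ s; set l := ln _.
have Y1 : 1 <= Y by rewrite powR_ge1// ltW.
have l2 : ln 2 <= l by exact: lnS_ge.
have Yl : ln 2 <= Y * l.
  by apply: (le_trans l2); rewrite ler_peMl// (le_trans (ltW ln2_gt0)).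
have lnX : ln (X theta) <= Y / s.
  rewrite ler_pdivlMr// mulrC -ln_powR.
  by apply/ltW/ln_sublinear; rewrite powR_gt0.
have lnr : ln (Gamma2 theta / eps n) <= A0 + alpha * p * (Y / s) + rho * l.
  have r0 : 0 < K1 / eps0 * (X theta `^ (alpha * p) * n%:R `^ rho).
    by rewrite !mulr_gt0 ?invr_gt0 ?powR_gt0.
  apply: (@le_trans _ _ (ln (K1 / eps0 * (X theta `^ (alpha * p) * n%:R `^ rho)))).
    by rewrite ler_ln ?posrE//; exact: ratio_le.
  have k0 : 0 < K1 / eps0 by rewrite divr_gt0.
  have z0 : 0 < X theta `^ (alpha * p) * n%:R `^ rho by rewrite mulr_gt0 ?powR_gt0.
  rewrite lnM ?posrE// [ln (X theta `^ _ * _)]lnM ?posrE ?powR_gt0// !ln_powR.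
  rewrite -[leRHS]addrA lerD ?ler_norm// lerD//.
    by rewrite ler_wpM2l// mulr_ge0 ?(ltW p0)// ltW.
  by rewrite ler_pM2l// /l ler_ln ?posrE ?ltr0n// ler_nat.
have h := max_level_le Gamma2 M alpha eps n theta.
apply: (le_trans h).
have mx : Num.max 0 (alpha^-1 * (ln (Gamma2 theta / eps n) / ln M)) <=
    w * (A0 + alpha * p * (Y / s) + rho * l).
  have -> : alpha^-1 * (ln (Gamma2 theta / eps n) / ln M) =
    w * ln (Gamma2 theta / eps n) by rewrite /w; ring.
  rewrite ge_max ler_pM2l// lnr andbT mulr_ge0 ?(ltW w0)// !addr_ge0//.
    by rewrite !mulr_ge0 ?invr_ge0 ?(ltW p0) ?(ltW s0) ?(ltW halpha)// (le_trans ler01).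
  by rewrite mulr_ge0 ?(ltW rho0)// (le_trans (ltW ln2_gt0)).
have wA : 0 <= w * A0 by rewrite mulr_ge0// ltW.
have ws : 0 <= w * (alpha * p) / s by rewrite !mulr_ge0 ?invr_ge0 ?(ltW p0)// ltW.
have q1 : 1 + w * A0 <= (1 + w * A0) / ln 2 * (Y * l).
  by rewrite -[leRHS]mulrA ler_peMr ?addr_ge0// ler_pdivlMl// mulr1.
have q2 : w * (alpha * p) / s * Y <= w * (alpha * p) / s / ln 2 * (Y * l).
  have -> : w * (alpha * p) / s / ln 2 * (Y * l) =
      w * (alpha * p) / s * Y * ((ln 2)^-1 * l) by ring.
  rewrite ler_peMr//; first by rewrite mulr_ge0// (le_trans ler01).
  by rewrite ler_pdivlMl// mulr1.
have q3 : w * rho * l <= w * rho * (Y * l).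
  have wr : 0 < w * rho by exact: mulr_gt0.
  by rewrite (ler_pM2l wr) ler_peMl// (le_trans (ltW ln2_gt0)).
rewrite /B; apply: (le_trans (lerD (lexx 1) mx)).
have -> : 1 + w * (A0 + alpha * p * (Y / s) + rho * l) =
  (1 + w * A0) + w * (alpha * p) / s * Y + w * rho * l by ring.
apply: (le_trans (lerD (lerD q1 q2) q3)).
by rewrite le_eqVlt; apply/orP; left; apply/eqP; ring.
Qed.

(** The square of [Gamma1] takes a moment of order [2 beta1 p]. The squared level weight takes
    [p (1 - 2 beta)] if [beta < 1/2], nothing if [beta > 1/2], and any positive amount if
    [beta = 1/2]; the conditions on [beta1] keep the total at most [p]. *)
Lemma variance_cost_le : exists2 B : R, 0 < B & forall n theta, (0 < n)%N -> D theta ->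
  (Gamma1 theta / sigma n) ^+ 2 * level_weight M beta (m n theta) ^+ 2 <=
  B * (X theta `^ p * cost_rate n).
Proof.
have a0 : 0 < K1 ^+ 2 / sigma0 ^+ 2 by rewrite divr_gt0 ?exprn_gt0.
have Xle theta s : s <= p -> X theta `^ s <= X theta `^ p by move=> sp; rewrite ler_powR.
rewrite /cost_rate /level_weight; case: (ltgtP beta 2^-1) => [bh|bh|bh].
- have [B B0 hB] := powR_level_le.
  have u0 : 0 < 1 - 2 * beta by lra.
  exists (K1 ^+ 2 / sigma0 ^+ 2 * B `^ (1 - 2 * beta)) => [|n theta n0 Dt].
    by rewrite mulr_gt0 ?powR_gt0.
  have nR : 0 < n%:R :> R by rewrite ltr0n.
  have -> : Num.max (2^-1 - beta) 0 = 2^-1 - beta by apply: max_idPl; lra.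
  have e : (M `^ ((m n theta)%:R * (2^-1 - beta))) ^+ 2 =
      (M `^ (m n theta)%:R) `^ (1 - 2 * beta).
    rewrite -(powR_mulrn 2 (powR_ge0 _ _)) -!powRrM; congr (_ `^ _).
    by field.
  rewrite e.
  have h1 : (M `^ (m n theta)%:R) `^ (1 - 2 * beta) <= B `^ (1 - 2 * beta) *
     (X theta `^ (p * (1 - 2 * beta)) * n%:R `^ (rho * (1 - 2 * beta) / alpha)).
    have -> : B `^ (1 - 2 * beta) *
      (X theta `^ (p * (1 - 2 * beta)) * n%:R `^ (rho * (1 - 2 * beta) / alpha)) =
      (B * (X theta `^ p * n%:R `^ (rho / alpha))) `^ (1 - 2 * beta).
      rewrite !powRM ?mulr_ge0 ?powR_ge0 ?(ltW B0)// -!powRrM.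
      by congr (_ * (_ * _ `^ _)); ring.
    apply: ler_powR2r; [exact: ltW|exact: powR_ge0|exact: hB].
  have := ler_pM (sqr_ge0 _) (powR_ge0 _ _) (Gamma1_le n0 Dt) h1.
  move/le_trans; apply.
  have -> : forall a b x y z t : R, a * (x * y) * (b * (z * t)) = a * b * ((x * z) * (y * t)).
    by move=> *; ring.
  have ab0 : 0 < K1 ^+ 2 / sigma0 ^+ 2 * B `^ (1 - 2 * beta) by rewrite mulr_gt0 ?powR_gt0.
  rewrite -!powR_gtD// (ler_pM2l ab0) ler_pM2r ?powR_gt0//.
  apply: Xle.
  have bn : beta != 2^-1 by rewrite lt_eqF.
  have := hbeta1 bn.
  have -> : 2 * beta1 * p + p * (1 - 2 * beta) = p * (1 - 2 * (beta - beta1)) by ring.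
  rewrite le_min => /andP[_ /andP[b1 _]].
  by rewrite -[leRHS]mulr1 ler_pM2l//; lra.
- exists (K1 ^+ 2 / sigma0 ^+ 2) => // n theta n0 Dt.
  have nR : 0 < n%:R :> R by rewrite ltr0n.
  have -> : Num.max (2^-1 - beta) 0 = 0 by apply: max_idPr; lra.
  rewrite mulr0 powRr0 expr1n mulr1.
  apply: (le_trans (Gamma1_le n0 Dt)); rewrite ler_pM2l// ler_pM2r ?powR_gt0//.
  have bn : beta != 2^-1 by rewrite gt_eqF.
  apply: Xle; have := hbeta1 bn.
  rewrite le_min => /andP[_ /andP[_ b1]].
  by rewrite -[leRHS]mul1r ler_pM2r//; lra.
- have /andP[b0 b1] := hbeta1' bh.
  (* The squared logarithm spends the order [2 s], exactly what [Gamma1] leaves over; [s > 0] is the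
     strict bound [beta1 < 1/2]. *)
  pose s := (1 - 2 * beta1) * p / 2.
  have s0 : 0 < s by rewrite divr_gt0// mulr_gt0//; lra.
  have [B B0 hB] := level_log_le s0.
  exists (K1 ^+ 2 / sigma0 ^+ 2 * B ^+ 2) => [|n theta n0 Dt].
    by rewrite mulr_gt0 ?exprn_gt0.
  have nR : 0 < n%:R :> R by rewrite ltr0n.
  have h1 : (m n theta)%:R ^+ 2 <= B ^+ 2 * (X theta `^ ((1 - 2 * beta1) * p) * ln n.+1%:R ^+ 2).
    have -> : B ^+ 2 * (X theta `^ ((1 - 2 * beta1) * p) * ln n.+1%:R ^+ 2) =
        (B * (X theta `^ s * ln n.+1%:R)) ^+ 2.
      rewrite !exprMn -(powR_mulrn 2 (powR_ge0 _ _)) -powRrM.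
      by congr (_ * (_ `^ _ * _)); rewrite /s; field.
    rewrite lerXn2r ?nnegrE//; last exact: hB.
    rewrite mulr_ge0 ?(ltW B0)// mulr_ge0 ?powR_ge0//.
    exact: le_trans (ltW ln2_gt0) (lnS_ge n0).
  have := ler_pM (sqr_ge0 _) (sqr_ge0 _) (Gamma1_le n0 Dt) h1.
  move/le_trans; apply.
  have -> : forall a b x y z t : R, a * (x * y) * (b * (z * t)) = a * b * ((x * z) * (y * t)).
    by move=> *; ring.
  rewrite -powR_gtD//; have -> : 2 * beta1 * p + (1 - 2 * beta1) * p = p by ring.
  exact: lexx.
Qed.

Hypothesis halphabeta : Num.min beta 2^-1 < alpha.
Hypothesis hr2 : Num.min beta 2^-1 / (alpha - Num.min beta 2^-1) < r.

(** The scheme allows [r > -1], but the additional condition on [r] forces nonnegativity, hence a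
    cost rate that is monotone in the step. *)
Let r_ge0 : 0 < beta -> 0 <= r.
Proof.
move=> b0; apply: le_trans (ltW hr2); apply: divr_ge0.
  by rewrite le_min (ltW b0) invr_ge0 ler0n.
by rewrite subr_ge0 ltW.
Qed.

(** The condition on [r] cleared of division, using [2 rho = 1 + r]. In this form it says that the
    rounding cost [n^(rho / alpha)] grows no faster than the variance cost. *)
Let cond : 2 * rho * Num.min beta 2^-1 < r * alpha.
Proof.
move: hr2; rewrite ltr_pdivrMr ?subr_gt0// hrho.
by set b := Num.min _ _; lra.
Qed.

Lemma level_cost_le : exists2 B : R, 0 < B & forall n, (0 < n)%N ->
  n%:R `^ (rho / alpha) <= B * cost_rate n.
Proof.
rewrite /cost_rate; case: (ltgtP beta 2^-1) => bh; move: cond.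
- rewrite (min_idPl _) ?ltW// => c; exists 1 => // n n0.
  rewrite mul1r ler_powR ?ler1n// ler_pdivrMr// mulrDl divfK ?gt_eqF//; lra.
- rewrite (min_idPr _) ?ltW// => c; exists 1 => // n n0.
  rewrite mul1r ler_powR ?ler1n// ler_pdivrMr//; lra.
- rewrite bh minxx => c; exists (ln 2 ^- 2) => [|n n0].
    by rewrite invr_gt0 exprn_gt0.
  rewrite ler_pdivlMl ?exprn_gt0// mulrC; apply: ler_pM; rewrite ?powR_ge0 ?sqr_ge0//.
    rewrite ler_powR ?ler1n// ler_pdivrMr//; lra.
  rewrite lerXn2r ?nnegrE ?(ltW ln2_gt0) ?lnS_ge//.
  exact: le_trans (ltW ln2_gt0) (lnS_ge n0).
Qed.

Hypothesis hbeta : 0 < beta.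

Lemma cost_rate_homo j n : (0 < j)%N -> (j <= n)%N -> cost_rate j <= cost_rate n.
Proof.
move=> j0 jn; have r0 := r_ge0 hbeta.
have jR : 0 <= j%:R :> R by [].
have jnR : j%:R <= n%:R :> R by rewrite ler_nat.
rewrite /cost_rate; case: (ltgtP beta 2^-1) => bh.
- apply: ler_powR2r => //; rewrite addr_ge0// divr_ge0 ?(ltW halpha)//.
  rewrite mulr_ge0 ?(ltW rho0)//; lra.
- exact: ler_powR2r.
- apply: ler_pM; rewrite ?powR_ge0 ?sqr_ge0//; first exact: ler_powR2r.
  have l0 := ltW ln2_gt0.
  have lj := lnS_ge j0; have ln := lnS_ge (leq_trans j0 jn).
  rewrite lerXn2r ?nnegrE ?(le_trans l0)//.
  by rewrite ler_ln ?posrE ?ltr0n// ler_nat.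
Qed.

Lemma cost_rate_mul n : (0 < n)%N -> n%:R * cost_rate n =
  if 2^-1 < beta then n%:R `^ (2 * rho)
  else if beta == 2^-1 then n%:R `^ (2 * rho) * ln (n.+1%:R) ^+ 2
  else n%:R `^ (2 * rho * (1 + (1 - 2 * beta) / (2 * alpha))).
Proof.
move=> n0; have nR : 0 < n%:R :> R by rewrite ltr0n.
have e (x : R) : n%:R * n%:R `^ x = n%:R `^ (1 + x) :> R by rewrite powR_gtD// powRr1// ltW.
rewrite /cost_rate; case: (ltgtP beta 2^-1) => bh.
- by rewrite e hrho; congr (_ `^ _); field; rewrite gt_eqF.
- by rewrite e hrho; congr (_ `^ _); field.
- by rewrite mulrA e hrho; congr (_ `^ _ * _); field.
Qed.

Context {dO : measure_display} {Omega : measurableType dO} (P : probability Omega R).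
Variables (hD : closed D) (theta : nat -> Omega -> 'rV[R]_d).
Hypotheses
  (hG1meas : measurable_fun (D : set (borel_rV R d)) (Gamma1 : borel_rV R d -> R))
  (hG2meas : measurable_fun (D : set (borel_rV R d)) (Gamma2 : borel_rV R d -> R))
  (mtheta : forall n, measurable_fun setT (theta n : Omega -> borel_rV R d))
  (Dtheta : forall n w, D (theta n w)).
Variable G : R.
Hypothesis hG : forall n,
  (\int[P]_w ((1 + dnorm dot (theta n w)) `^ p)%:E <= G%:E)%E.

Let step_cost n w : R := \sum_(1 <= k < (m n (theta n.-1 w)).+1)
  (N n k (theta n.-1 w))%:R * C k.

Let measurable_step_cost n : (0 < n)%N -> measurable_fun setT (step_cost n).
Proof.
move=> n0; pose g j w : R := \sum_(1 <= k < j.+1) (N n k (theta n.-1 w))%:R * C k.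
apply: (@measurable_fun_nat_family R _ _ Omega R _ g).
  exact: (measurable_max_level hD M alpha hG2meas eps (mtheta n.-1) (Dtheta n.-1)).
move=> j; apply: measurable_sum => k.
apply: measurable_funM; last exact: measurable_cst.
apply: (@measurableT_comp _ _ _ _ _ _ (fun j : nat => j%:R : R) setT) => //.
exact: (@measurable_repl _ _ D hD Gamma1 Gamma2 M alpha beta hG1meas hG2meas hG1pos
  hM eps sigma _ _ (theta n.-1) (mtheta n.-1) (Dtheta n.-1) n k (hsigma_pos n0)).
Qed.

Lemma expected_cost_le : exists2 B : R, 0 < B & forall n, (0 < n)%N ->
  (\int[P]_w (\sum_(1 <= j < n.+1) step_cost j w)%:E <= (B * (n%:R * cost_rate n))%:E)%E.
Proof.
have [B1 B10 h1] := step_cost_le; have [B2 B20 h2] := powR_level_le.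
have [B3 B30 h3] := variance_cost_le; have [B4 B40 h4] := level_cost_le.
have mY n : measurable_fun setT (fun w => (1 + dnorm dot (theta n w)) `^ p).
  apply: (measurableT_comp (measurable_powR p)); apply: measurable_funD.
    exact: measurable_cst.
  exact: measurable_dnorm.
have hb n := bounded_moment_has_mean (fun w => powR_ge0 _ _) (mY n) (hG n).
have G0 : 0 <= G.
  rewrite -lee_fin; apply: le_trans (hG 0%N).
  by apply: integral_ge0 => w _; rewrite lee_fin powR_ge0.
pose T := B1 * (B3 + B2 * B4).
have T0 : 0 < T by rewrite mulr_gt0// addr_gt0// mulr_gt0.
exists (T * (G + 1)) => [|n n0]; first by rewrite mulr_gt0// ltr_wpDl.
have cr0 j : (0 < j)%N -> 0 <= cost_rate j.
  move=> j0; rewrite -(pmulr_rge0 _ B40); apply: le_trans (h4 j j0).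
  exact: powR_ge0.
have step j w : (0 < j)%N -> step_cost j w <= T * cost_rate j * X (theta j.-1 w) `^ p.
  move=> j0; have Dj := Dtheta j.-1 w.
  apply: (le_trans (h1 j _ j0 Dj)).
  have -> : T * cost_rate j * X (theta j.-1 w) `^ p =
    B1 * ((B3 + B2 * B4) * (cost_rate j * X (theta j.-1 w) `^ p)) by rewrite /T; ring.
  rewrite ler_pM2l//; apply: (le_trans (lerD (h3 j _ j0 Dj) (h2 j _ j0 Dj))).
  have := ler_wpM2l (ltW B20) (ler_wpM2l (powR_ge0 (X (theta j.-1 w)) p) (h4 j j0)).
  set u := X _ `^ p; set v := cost_rate j => h.
  have -> : (B3 + B2 * B4) * (v * u) = B3 * (u * v) + B2 * (u * (B4 * v)) by ring.
  by rewrite lerD2l.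
have sc0 j w : (0 < j)%N -> 0 <= step_cost j w.
  move=> j0; rewrite /step_cost big_nat_cond; apply: sumr_ge0 => k.
  by rewrite andbT => /andP[k0 _]; rewrite mulr_ge0// ltW// hC.
pose b j := projT1 (cid2 (hb j)).
have bG j : b j <= G by rewrite /b; case: cid2.
have hbj j : has_mean P (fun w => (1 + dnorm dot (theta j w)) `^ p) (b j).
  by rewrite /b; case: cid2.
have hs := has_mean_sum (index_iota 1 n.+1)
  (fun j => has_meanZ (T * cost_rate j) (hbj j.-1)).
apply: (@le_trans _ _ (\sum_(1 <= j < n.+1) T * cost_rate j * b j.-1)%:E).
  rewrite -(proj2 hs); apply: ge0_le_integral => //.
  - by move=> w _; rewrite lee_fin big_nat_cond; apply: sumr_ge0 => j;
      rewrite andbT => /andP[j0 _]; exact: sc0.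
  (* Measurability of [step_cost j] is available for positive [j] only; replacing it by 0 at [j = 0]
     does not change the sum. *)
  - apply/measurable_EFinP; rewrite (_ : (fun w => _) = (fun w =>
      \sum_(j <- index_iota 1 n.+1) if (0 < j)%N then step_cost j w else 0)).
      apply: measurable_sum => -[|j] /=; first exact: measurable_cst.
      exact: measurable_step_cost.
    apply/funext => w; rewrite big_nat_cond [RHS]big_nat_cond.
    by apply: eq_bigr => j /andP[/andP[j0 _] _]; rewrite j0.
  - by apply/measurable_EFinP; exact: has_mean_measurable hs.
  - move=> w _; rewrite lee_fin big_nat_cond [leRHS]big_nat_cond.
    by apply: ler_sum => j /andP[/andP[j0 _] _]; exact: step.
rewrite lee_fin; apply: (@le_trans _ _ (\sum_(1 <= j < n.+1) T * cost_rate n * (G + 1))).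
  rewrite big_nat_cond [leRHS]big_nat_cond.
  apply: ler_sum => j /andP[/andP[j0 jn] _].
  apply: (@le_trans _ _ (T * cost_rate j * (G + 1))).
    rewrite ler_wpM2l//; first by rewrite mulr_ge0 ?cr0// ltW.
    by rewrite (le_trans (bG _))// lerDl.
  rewrite ler_wpM2r ?addr_ge0// ler_pM2l//.
  exact: cost_rate_homo.
rewrite sumr_const_nat subn1 /= -mulr_natl.
by rewrite le_eqVlt; apply/orP; left; apply/eqP; ring.
Qed.

End one_step_cost.

Theorem mainTheorem14
    (R : realType) (p : R) (hp : 2 <= p)
    (dO : measure_display) (Omega : measurableType dO) (P : probability Omega R)
    (d : nat) (dot : {dot 'rV[R]_d for idfun})
    (D : set 'rV[R]_d) (hDclosed : closed D)
    (hDconvex : @convex_set R 'rV[R]_d D)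
    (dS : measure_display) (S : measurableType dS) (U : {RV P >-> S})
    (F : 'rV[R]_d -> S -> 'rV[R]_d)
    (hFmeas : product_measurable D F)
    (hFint : forall theta, D theta -> vintegrable P (fun w => F theta (U w)))
    (f : 'rV[R]_d -> 'rV[R]_d)
    (hf : forall theta, D theta ->
      f theta = vexpectation P (fun w => F theta (U w)))
    (theta_star : 'rV[R]_d) (hstarD : D theta_star)
    (hstar0 : f theta_star = 0)
    (hstar_uniq : forall theta, D theta -> f theta = 0 -> theta = theta_star)
    (Fk : nat -> 'rV[R]_d -> S -> 'rV[R]_d)
    (hFk0 : forall theta u, Fk 0%N theta u = 0)
    (hFkmeas : forall k, (0 < k)%N -> product_measurable D (Fk k))
    (hFkint : forall k theta, (0 < k)%N -> D theta ->
      vintegrable P (fun w => Fk k theta (U w)))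
    (C : nat -> R) (hC : forall k, (0 < k)%N -> 0 < C k)
    (L L' : R) (hL : 0 < L) (hL' : 0 < L')
    (hfL : forall theta, D theta ->
      dot (theta - theta_star) (f theta)
        <= - L * dnorm dot (theta - theta_star) ^+ 2)
    (hfL' : forall theta, D theta ->
      dot (theta - theta_star) (f theta) <= - L' * dnorm dot (f theta) ^+ 2)
    (Gamma1 Gamma2 : 'rV[R]_d -> R)
    (hG1meas : measurable_fun (D : set (borel_rV R d)) (Gamma1 : borel_rV R d -> R))
    (hG2meas : measurable_fun (D : set (borel_rV R d)) (Gamma2 : borel_rV R d -> R))
    (hG1pos : forall theta, D theta -> 0 < Gamma1 theta)
    (hG2pos : forall theta, D theta -> 0 < Gamma2 theta)
    (M K K1 alpha beta beta1 : R)
    (hM : 1 < M) (hK : 0 < K) (hK1 : 0 < K1) (halpha : 0 < alpha)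
    (hbeta : 0 < beta) (halphabeta : beta <= alpha)
    (hbeta1 : beta != 2^-1 -> 0 <= beta1 <= Num.min beta 2^-1)
    (hbeta1' : beta = 2^-1 -> 0 <= beta1 < 2^-1)
    (hi : forall k theta, (0 < k)%N -> D theta ->
      let incr := fun w => Fk k theta (U w) - Fk k.-1 theta (U w) in
      ('E_P[fun w => (dnorm dot (incr w - vexpectation P incr) `^ p)%R] `^ p^-1
        <= (Gamma1 theta * M `^ (- (k%:R * beta)))%:E)%E)
    (hii : forall k theta, (0 < k)%N -> D theta ->
      dnorm dot (vexpectation P (fun w => Fk k theta (U w) - F theta (U w)))
        <= Gamma2 theta * M `^ (- (k%:R * alpha)))
    (hiii : forall k, (0 < k)%N -> C k <= K * M ^+ k)
    (hiv1 : forall theta, D theta ->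
      Gamma1 theta <= K1 * (1 + dnorm dot theta) `^ (beta1 * p))
    (hiv2 : forall theta, D theta ->
      Gamma2 theta <= K1 * (1 + dnorm dot theta) `^ (alpha * p))
    (theta0 : 'rV[R]_d) (htheta0 : D theta0)
    (r gamma0 sigma0 eps0 rho : R)
    (hr : -1 < r) (hgamma0 : (1 + r) / (2 * L) < gamma0)
    (hsigma0 : 0 < sigma0) (heps0 : 0 < eps0)
    (hrho : rho = 2^-1 * (1 + r))
    (gamma sigma eps : nat -> R)
    (hgamma : forall n, (0 < n)%N -> gamma n = gamma0 / n%:R)
    (hsigma_pos : forall n, (0 < n)%N -> 0 < sigma n)
    (hsigma : forall n, (0 < n)%N -> sigma n ^+ 2 = sigma0 ^+ 2 / n%:R `^ r)
    (heps : forall n, (0 < n)%N -> eps n = eps0 / n%:R `^ rho)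
    (V : nat -> nat -> nat -> {RV P >-> S})
    (hVindep : mutually_independent
      [set i : nat * nat * nat | [/\ 0 < i.1.1, 0 < i.1.2 & 0 < i.2]%N]
      (fun i => V i.1.1 i.1.2 i.2))
    (hVcopy : forall n k l, (0 < n)%N -> (0 < k)%N -> (0 < l)%N ->
      same_distribution (V n k l) U) :
  let theta := ml_scheme dot D Gamma1 Gamma2 M alpha beta gamma eps sigma Fk V
                 theta0 in
  let cost := ml_cost P dot D Gamma1 Gamma2 M alpha beta gamma eps sigma Fk V
                theta0 C in
  [/\ forall eta, 0 < eta < rho ->
        exists2 kappa : R, 0 < kappa & forall n, (0 < n)%N ->
          ((\int[P]_w ereal_sup
              [set ((k%:R `^ (eta * p) *
                     dnorm dot (theta k w - theta_star) `^ p)%R)%:E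
                | k in [set k | (n <= k)%N]]) `^ p^-1
            <= (kappa * n%:R `^ (- (rho - eta)))%:E)%E,
      forall delta, 0 < delta ->
        {ae P, forall w,
          (fun n => n%:R `^ (rho - delta) * dnorm dot (theta n w - theta_star))
            @ \oo --> (0 : R)}
    & Num.min beta 2^-1 < alpha ->
      Num.min beta 2^-1 / (alpha - Num.min beta 2^-1) < r ->
        exists2 kappa' : R, 0 < kappa' & forall n, (0 < n)%N ->
          (cost n <= (kappa' *
             (if 2^-1 < beta then n%:R `^ (2 * rho)
              else if beta == 2^-1 then
                n%:R `^ (2 * rho) * ln (n.+1%:R) ^+ 2
              else n%:R `^ (2 * rho * (1 + (1 - 2 * beta) / (2 * alpha)))))%:E)%E].
Proof.
move=> theta cost.
have p0 : 0 < p by lra.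
have rho0 : 0 < rho by rewrite hrho; lra.
have g0 : 0 < gamma0.
  by apply: le_lt_trans hgamma0; rewrite divr_ge0 ?mulr_ge0 ?(ltW hL)//; lra.
have eps_pos n : (0 < n)%N -> 0 < eps n.
  by move=> n0; rewrite heps// divr_gt0// powR_gt0// ltr0n.
pose Z := ml_estimator Gamma1 Gamma2 M alpha beta eps sigma Fk V.
have thE n w : theta n w = rm_scheme dot D Z theta0 gamma n w.
  by rewrite /theta; elim: n => //= n ->.
pose A := [set i : nat * nat * nat | [/\ 0 < i.1.1, 0 < i.1.2 & 0 < i.2]%N].
pose X (i : nat * nat * nat) := V i.1.1 i.1.2 i.2.
(* All potential simulations of step [n], over every level and replication: the random numbers of
   levels and replications never lead out of this set. *)
pose lev (n : nat) : set (nat * nat * nat) := [set i | A i /\ i.1.1 = n].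
have levA n : lev n `<=` A by move=> i [].
have lev_disj n k i : lev n i -> lev k i -> n = k by move=> [_ <-] [_ <-].
have mZ n : (0 < n)%N -> forall dT (T : measurableType dT) (t : T -> 'rV[R]_d)
    (v : T -> Omega), measurable_fun setT (t : T -> borel_rV R d) ->
    (forall x, D (t x)) -> measurable_fun setT (v : T -> sub_space X (lev n)) ->
    measurable_fun setT (fun x => Z n (t x) (v x) : borel_rV R d).
  move=> n0 dT T t v mt tD mv.
  have mV k l : (0 < k)%N -> (0 < l)%N -> measurable_fun setT (fun x => V n k l (v x)).
    move=> k0 l0; have Jn : lev n (n, k, l) by [].
    exact: (measurableT_comp (measurable_sub_space_RV (X:=X) Jn) mv).
  pose v' n k l x := V n k l (v x).
  exact: (@measurable_ml_estimator _ _ _ _ D hDclosed Fk hFk0 hFkmeas Gamma1 Gamma2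
    M alpha beta hG1meas hG2meas hG1pos hM eps sigma _ _ t mt tD n v' (hsigma_pos n n0) mV).
have [B B0 hB] := estimator_moments hDclosed hp hFk0 hFkmeas hFint hFkint hG1pos
  hG2pos hM halpha hi hii hsigma_pos eps_pos hVindep hVcopy.
have Zm n t : (0 < n)%N -> D t -> exists zbar : 'rV[R]_d,
    [/\ dnorm dot (zbar - f t) <= eps n,
        has_vmean P (fun w => Z n t w - zbar) 0 &
        (\int[P]_w (dnorm dot (Z n t w - zbar) `^ p)%:E <=
          ((B * sigma n) `^ p)%:E)%E].
  by move=> n0 Dt; rewrite hf//; exact: hB.
have [K0 K00 lp] := lp_rate hDclosed hDconvex hp hVindep levA lev_disj mZ htheta0
  hstarD hL hL' hfL hfL' hr hgamma0 hsigma0 heps0 hrho hgamma hsigma_pos hsigma heps B0 Zm.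
have [kap kap0 noise] := noise_moments hp hL hr hgamma0 hsigma0 heps0 hrho hgamma
  hsigma_pos hsigma heps B0 Zm.
(* One constant for both the noise and the drift; by [drift_le] the latter moves the error by at
   most [gamma0 / (L' n)] times its norm. *)
pose kappa := kap + gamma0 / L'.
have gL0 : 0 < gamma0 / L' by rewrite divr_gt0.
have kappa0 : 0 < kappa by rewrite addr_gt0.
have kapk : kap <= kappa by rewrite lerDl ltW.
have drift_small n t : (0 < n)%N -> D t ->
    dnorm dot (gamma n *: f t) <= kappa / n%:R * dnorm dot (t - theta_star).
  move=> n0 Dt; have nR : 0 < n%:R :> R by rewrite ltr0n.
  rewrite dnormZ_ge0 hgamma// ?divr_ge0 ?(ltW g0)//.
  have h := drift_le hL' (hfL' t Dt).
  have gn0 : 0 <= gamma0 / n%:R by rewrite divr_ge0 ?(ltW g0).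
  apply: (le_trans (ler_wpM2l gn0 h)).
  have -> : gamma0 / n%:R * (dnorm dot (t - theta_star) / L') =
    gamma0 / L' / n%:R * dnorm dot (t - theta_star) by ring.
  by rewrite ler_wpM2r ?dnorm_ge0// ler_pM2r ?invr_gt0// lerDr ltW.
have noise_small n t : (0 < n)%N -> D t -> exists m,
    [/\ has_vmean P (fun w => gamma n *: (Z n t w - f t)) m,
      dnorm dot m <= kappa * n%:R `^ (- rho) / n%:R &
      (\int[P]_w (dnorm dot (gamma n *: (Z n t w - f t)) `^ p)%:E <=
        ((kappa * n%:R `^ (- rho) / Num.sqrt n%:R) `^ p)%:E)%E].
  move=> n0 Dt; have nR : 0 < n%:R :> R by rewrite ltr0n.
  have [mm [h1 h2 h3]] := noise n t n0 Dt; exists mm; split => //.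
    by apply: (le_trans h2); rewrite ler_pM2r ?invr_gt0// ler_pM2r// powR_gt0.
  have sn0 : 0 < Num.sqrt n%:R :> R by rewrite sqrtr_gt0.
  apply: (le_trans h3); rewrite lee_fin; apply: ler_powR2r; first exact: ltW.
    by rewrite divr_ge0 ?(ltW sn0)// mulr_ge0 ?powR_ge0// ltW.
  by rewrite ler_pM2r ?invr_gt0// ler_pM2r// powR_gt0.
have [W [Kb Kb0 hW]] := block_sup hDclosed hDconvex hp hVindep levA lev_disj mZ
  htheta0 hstarD kappa0 rho0 K00 drift_small noise_small lp.
have mtheta n : measurable_fun setT (theta n : Omega -> borel_rV R d).
  rewrite (_ : theta n = rm_scheme dot D Z theta0 gamma n); last first.
    by apply/funext => w; exact: thE.
  exact: (measurable_rm_scheme_Omega dot hDclosed hDconvex mZ htheta0).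
have Dtheta n w : D (theta n w) by rewrite thE; exact: rm_scheme_in.
pose e n w := dnorm dot (theta n w - theta_star).
have e0 n w : 0 <= e n w by exact: dnorm_ge0.
have me n : measurable_fun setT (e n).
  by apply: measurable_dnorm; apply: measurable_rVB => //; exact: measurable_cst.
have eW N : (0 < N)%N -> [/\ measurable_fun setT (W N), forall w, 0 <= W N w,
    forall k w, (N <= k <= N + N)%N -> e k w <= W N w &
    (\int[P]_w (W N w `^ p)%:E <= (Kb * N%:R `^ (- (rho * p)))%:E)%E].
  by move=> /hW[h1 h2 h3 h4]; split => // k w; rewrite /e thE; exact: h3.
split.
- move=> eta /andP[eta0 eta_rho].
  have [C1 C10 hC1] := integral_weighted_sup_le p0 Kb0 e0 me eW eta0 eta_rho.
  exists (C1 `^ p^-1) => [|n n0]; first exact: powR_gt0.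
  have -> : C1 `^ p^-1 * n%:R `^ (- (rho - eta)) =
      (C1 * n%:R `^ (- ((rho - eta) * p))) `^ p^-1.
    rewrite powRM ?(ltW C10) ?powR_ge0// -powRrM -mulNr -mulrA mulfV ?mulr1//.
    by rewrite gt_eqF.
  have I0 : (0 <= \int[P]_w weighted_sup e p eta n w)%E.
    by apply: integral_ge0 => w _; exact: weighted_sup_ge0.
  rewrite -poweR_EFin; apply: gt0_ler_poweR => //.
  + by rewrite invr_ge0 ltW.
  + by rewrite in_itv/= I0 leey.
  + by rewrite in_itv/= lee_fin leey andbT mulr_ge0 ?powR_ge0// ltW.
  + exact: hC1.
- move=> delta delta0.
  (* The midpoint lies in []0, rho[] and above [rho - delta], also when [delta >= rho]. *)
  pose eta := (Num.max 0 (rho - delta) + rho) / 2.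
  have mr : Num.max 0 (rho - delta) < rho by rewrite gt_max rho0 ltrBlDr ltrDl.
  have m0 : 0 <= Num.max 0 (rho - delta) by rewrite le_max lexx.
  have m1 : rho - delta <= Num.max 0 (rho - delta) by rewrite le_max lexx orbT.
  have eta0 : 0 < eta by rewrite /eta; lra.
  have eta_rho : eta < rho by rewrite /eta; lra.
  have eta_delta : rho - delta < eta by rewrite /eta; lra.
  have := weighted_sup_ae p0 Kb0 e0 me eW eta0 eta_rho.
  apply: filterS => w; exact: cvg_of_weighted_sup.
- move=> ha hr2.
  (* A moment bound uniform in time; time 0 is treated separately because the rate is stated for
     positive times. *)
  have [G hG] : exists G : R, forall n,
      (\int[P]_w ((1 + dnorm dot (theta n w)) `^ p)%:E <= G%:E)%E.
    pose E0 := dnorm dot (theta0 - theta_star) `^ p.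
    have hE n : (\int[P]_w (e n w `^ p)%:E <= (K0 + E0)%:E)%E.
      case: n => [|n].
        have h : (\int[P]_w (e 0 w `^ p)%:E = E0%:E)%E := proj2 (has_mean_cst P E0).
        by rewrite h lee_fin lerDr ltW.
      have n1 : 1 <= n.+1%:R :> R by rewrite ler1n.
      apply: (@le_trans _ _ (K0 * n.+1%:R `^ (- (rho * p)))%:E).
        by rewrite /e; under eq_integral do rewrite thE; exact: lp.
      rewrite lee_fin -[leLHS]addr0 lerD ?powR_ge0//.
      rewrite -[leRHS]mulr1 ler_pM2l// powRN invf_le1 ?powR_gt0 ?(lt_le_trans ltr01)//.
      by rewrite powR_ge1// mulr_ge0 ?ltW.
    pose a := 1 + dnorm dot theta_star.
    have a0 : 0 <= a by rewrite addr_ge0 ?dnorm_ge0.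
    exists (2 `^ p * (K0 + E0) + 2 `^ p * a `^ p) => n.
    have mep : measurable_fun setT (fun w => e n w `^ p).
      exact: (measurableT_comp (measurable_powR p)).
    have b0 : 0 <= 2 `^ p * a `^ p by rewrite mulr_ge0 ?powR_ge0.
    apply: le_trans (integral_affine_le (fun w => powR_ge0 _ _) mep (powR_ge0 2 p) b0 (hE n)).
    apply: ge0_le_integral => //.
    + by move=> w _; rewrite lee_fin powR_ge0.
    + apply/measurable_EFinP; apply: (measurableT_comp (measurable_powR p)).
      apply: measurable_funD; first exact: measurable_cst.
      exact: measurable_dnorm.
    + apply/measurable_EFinP; apply: measurable_funD; last exact: measurable_cst.
      by apply: measurable_funM => //; exact: measurable_cst.
    + move=> w _; rewrite lee_fin -mulrDr.
      apply: le_trans (powRD_le (ltW p0) (e0 n w) a0).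
      apply: ler_powR2r; rewrite ?(ltW p0) ?addr_ge0 ?dnorm_ge0//.
      have := dnorm_distl dot (theta n w) theta_star; rewrite /e /a; lra.
  have [C1 C10 hC1] := expected_cost_le hp hG1pos hG2pos hM hK hK1 halpha hbeta1
    hbeta1' hC hiii hiv1 hiv2 hr hsigma0 heps0 hrho hsigma_pos hsigma heps ha hr2
    hbeta hDclosed hG1meas hG2meas mtheta Dtheta hG.
  exists C1 => // n n0.
  rewrite -(cost_rate_mul beta halpha hrho n0); apply: le_trans (hC1 n n0).
  by rewrite /cost /ml_cost unlock.
Qed.
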